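(* Let $(\bar x,\bar u)$ be a weak local minimizer of problem (P) such that $\bar g(0)=0$ and $\bar g_u(0)=0$ (in the sense of essential limits). Suppose there exist $\varepsilon>0$ and a non-decreasing function $\omega:(0,1]\to(0,\infty)$ with $$\int_0^1\frac{dt}{\omega(t)}<\infty$$ such that $|\bar g_u(t)|\ge\omega(t)$ for a.e. $t\in\{\bar g\ge-\varepsilon\}$. Then there exists a multiplier tuple $(\lambda,\beta,\lambda_0,z,\zeta)$ for (P) at $(\bar x,\bar u)$ with $\zeta=0$ and $\beta\equiv0$; in particular, the multipliers are nondegenerate.
   Context: Notation. $|\cdot|$ is the Euclidean norm; ''a.e.'' refers to Lebesgue measure $\mathrm{Leb}$; $\mathfrak L$ is the $\sigma$-algebra of Lebesgue measurable subsets of $[0,1]$. $BV([0,1];\mathbb R^n)$ denotes functions of bounded variation that are right-continuous on $(0,1)$. A measurable $k:[0,1]\to\mathbb R$ has essential limit $\alpha$ at $t$ if for every $\varepsilon>0$ there is a neighborhood $V$ of $t$ with $|k(s)-\alpha|<\varepsilon$ for a.e. $s\in V\cap[0,1]$; for $k$ in a Lebesgue space, ''$k(t)=\alpha$'' at a given instant $t$ means that the essential limit exists and equals $\alpha$ (componentwise for vector functions). Problem (P): minimize $J(x,u)=\int_0^1L(t,x(t),u(t))\,dt$ over $(x,u)\in W^{1,1}([0,1];\mathbb R^n)\times L^\infty([0,1];\mathbb R^m)$ subject to $\dot x(t)=f(t,x(t),u(t))$ a.e., $g(t,x(t),u(t))\le 0$ a.e., $x(0)=x_0$, where $x_0\in\mathbb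 R^n$ is fixed and $(L,f,g):[0,1]\times\mathbb R^n\times\mathbb R^m\to\mathbb R\times\mathbb R^n\times\mathbb R$ are continuous in $(t,x,u)$ and continuously differentiable in $(x,u)$ (derivatives jointly continuous in $(t,x,u)$). Pairs satisfying the constraints are admissible processes. A weak local minimizer is an admissible $(\bar x,\bar u)$ for which there is $\varepsilon>0$ with $J(\bar x,\bar u)\le J(x,u)$ for all admissible $(x,u)$ with $\|x-\bar x\|_C<\varepsilon$, $\|u-\bar u\|_{L^\infty}<\varepsilon$. A bar denotes evaluation along $(\bar x,\bar u)$: $\bar k(t)=k(t,\bar x(t),\bar u(t))$; $\bar L_x,\bar L_u,\bar g_x,\bar g_u$ are row vectors and $\bar f_x,\bar f_u$ Jacobian matrices. $\{\bar g\ge-\varepsilon\}=\{t\in[0,1]:\bar g(t)\ge-\varepsilon\}$. Charges. A charge is a finitely additive set function on $\mathfrak L$ vanishing at $\emptyset$; $\operatorname{ba}$ denotes the bounded charges vanishing on Lebesgue null sets (isometric to $L^\infty([0,1];\mathbb R)^*$ with the total variation norm). A positive charge $\zeta$ is pure if the only countably additive measure $\mu$ with $0\le\mu\le\zeta$ is $\mu=0$; a general charge $\zeta$ is pure if its total variation $|\zeta|$ is. For $k\in L^\infty$, $\int_E k\,d\zeta$ is the limit of integrals of simple functions converging to $k\chi_E$ uniformly a.e. (componentwise for vectors). ''$k=0$ $\zeta$-a.e.'' means $|\zeta|(\{|k|>\varepsilon\})=0$ for all $\varepsilon>0$. $\zeta$ is right-concentrated at $t^*$ if $\zeta((t^*,t^*+\varepsilon))=\zeta([0,1])$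 for all $\varepsilon>0$, and left-concentrated at $t^*$ if $\zeta((t^*-\varepsilon,t^* ))=\zeta([0,1])$ for all $\varepsilon>0$ (intervals intersected with $[0,1]$). Multiplier tuple for (P) at $(\bar x,\bar u)$: $(\lambda,\beta,\lambda_0,z,\zeta)$ with $\lambda_0\ge0$ a scalar, $z\in L^1([0,1];\mathbb R)$, $z\ge0$, $\zeta\in\operatorname{ba}$ a pure charge, $\zeta\ge0$, $\lambda,\beta\in BV([0,1];\mathbb R^n)$ such that: (a) $\lambda_0+\|z\|_{L^1}+\zeta([0,1])>0$; (b) $z(t)\bar g(t)=0$ a.e. and $\bar g=0$ $\zeta$-a.e.; (c) $\lambda(1)=\beta(1)=0$, $-d\lambda=[\bar f_x^T\lambda+\lambda_0\bar L_x^T+z\bar g_x^T]\,dt+d\beta$ (as measures on $[0,1]$), where $\beta(0)=-\int_0^1\bar g_x^T\,d\zeta$ and $\beta(t)=-\lim_{k\to\infty}\int_{t+1/k}^1\bar g_x^T\,d\zeta$ for $t\in(0,1)$; (d) $0=\bar f_u^T\lambda+\lambda_0\bar L_u^T+\bar g_u^Tz$ a.e., and $\int_E\bar g_u^T\,d\zeta=0$ for every $E\in\mathfrak L$. The tuple is degenerate if $\lambda_0=0$, $z\equiv0$, and there are $t^*\in[0,1]$ and a vector $\alpha\in\mathbb R^n$ such that $\lambda(t)=-\beta(t)=\alpha$ for $t<t^*$ and $=0$ for $t\ge t^*$, and $\zeta$ is a pure charge in $\operatorname{ba}$ concentrated at $t^*$ from the left or from the right (when $t^*=0$, the value at the single instant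 $0$ is instead $\lambda(0)=-\beta(0)=\int_0^1\bar g_x^T\,d\zeta$). Otherwise it is nondegenerate. *)

(* Defs.v *)
From HB Require Import structures.
From mathcomp Require Import all_boot all_order all_algebra.
From mathcomp Require Import all_classical all_reals all_analysis.
From mathcomp Require Import measurable_realfun ess_sup_inf.

Set Implicit Arguments.
Unset Strict Implicit.
Unset Printing Implicit Defensive.

Import Order.TTheory GRing.Theory Num.Theory.
Import numFieldNormedType.Exports.

Local Open Scope classical_set_scope.
Local Open Scope ring_scope.

(** Conventions.
    - Functions on [0,1] are total functions on [R], of which only the
      restriction to [0,1] matters.
    - Elements of L^1 and L^oo are given by Borel representatives (every class
      modulo Lebesgue-null sets has one).
    - Vectors of R^n are columns; derivatives are rows (scalar functions) or
      Jacobian matrices (vector functions).  The topology of ['cV_n] is the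
      product topology, but every norm below is the Euclidean one. *)

Definition I01 {R : realType} : set R := [set t | 0 <= t <= 1].

Notation leb := (@lebesgue_measure _).

(** Euclidean norm of a row or column vector (the library's norm on matrices
    is the sup norm). *)
Definition eucl {R : realType} {p q : nat} (v : 'M[R]_(p, q)) : R :=
  Num.sqrt (\sum_i \sum_j v i j ^+ 2).

Definition ess_limit {R : realType} (k : R -> R) (t a : R) : Prop :=
  forall e : R, 0 < e -> exists2 V : set R, nbhs t V &
    {ae leb, forall s, V s -> I01 s -> `|k s - a| < e}.

Section spaces.
Context {R : realType} {p : nat}.

(** [x] belongs to W^{1,1} and [v] is its weak derivative. *)
Definition W11 (x v : R -> 'cV[R]_p) : Prop :=
  forall i, leb.-integrable I01 (EFin \o (fun t => v t i ord0)) /\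
    forall t, I01 t ->
      x t i ord0 = x 0 i ord0 + \int[leb]_(s in `[0, t]) v s i ord0.

Definition C_norm (x : R -> 'cV[R]_p) : \bar R :=
  ereal_sup [set (eucl (x t))%:E | t in I01].

Definition Linfty_norm (u : R -> 'cV[R]_p) : \bar R :=
  ess_sup leb ((fun t => (eucl (u t))%:E) \_ I01).

Definition Linfty (u : R -> 'cV[R]_p) : Prop :=
  (forall i, measurable_fun I01 (fun t => u t i ord0)) /\
  (Linfty_norm u < +oo)%E.

Definition BV01 (l : R -> 'cV[R]_p) : Prop :=
  forall i, bounded_variation 0 1 (fun t => l t i ord0) /\
    forall t, 0 < t < 1 -> l s i ord0 @[s --> t^'+] --> l t i ord0.

End spaces.

(** [nu] is the measure d[phi] on [0,1], for [phi] of bounded variation and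
    right-continuous on (0,1).  Atoms are allowed at 0 (of mass
    [phi 0+ - phi 0]) and at 1; only the values of [nu] on Borel subsets of
    [0,1] are determined, and meaningful. *)
Definition is_dmeasure {R : realType} (phi : R -> R)
    (nu : {charge set (measurableTypeR R) -> \bar R}) : Prop :=
  forall t, 0 < t <= 1 -> nu `[0, t]%classic = (phi t - phi 0)%:E.

Section charges.
Context {R : realType}.
Implicit Types (zeta : set R -> R) (E : set R) (k : R -> R).

(** Lebesgue measurable subsets of [0,1].  A set function on this
    sigma-algebra is a total [zeta : set R -> R], constrained on [Leb01]. *)
Definition Leb01 : set (set R) :=
  [set E | E `<=` I01 /\ completed_algebra_gen leb E].

Definition is_ba zeta : Prop :=
  [/\ zeta set0 = 0,
      forall A B, Leb01 A -> Leb01 B -> A `&` B = set0 ->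
        zeta (A `|` B) = zeta A + zeta B,
      exists M, forall E, Leb01 E -> `|zeta E| <= M
    & forall E, Leb01 E -> leb.-negligible E -> zeta E = 0].

Definition tvar zeta E : R :=
  sup [set r | exists N (A : 'I_N -> set R),
    [/\ forall i, Leb01 (A i), trivIset [set: 'I_N] A, \bigcup_i A i = E
      & r = \sum_i `|zeta (A i)|]].

Definition countably_additive (nu : set R -> R) : Prop :=
  nu set0 = 0 /\
  forall A : nat -> set R, (forall i, Leb01 (A i)) -> trivIset [set: nat] A ->
    (fun N => \sum_(i < N) nu (A i)) @ \oo --> nu (\bigcup_i A i).

Definition pure_positive zeta : Prop :=
  forall nu : set R -> R, countably_additive nu ->
    (forall E, Leb01 E -> 0 <= nu E <= zeta E) ->
    forall E, Leb01 E -> nu E = 0.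

Definition pure zeta : Prop := pure_positive (tvar zeta).

Definition simple01 (s : R -> R) : Prop :=
  finite_set (s @` I01) /\ forall y, Leb01 (I01 `&` s @^-1` [set y]).

Definition simple_integral zeta (s : R -> R) : R :=
  \sum_(y \in s @` I01) y * zeta (I01 `&` s @^-1` [set y]).

Definition is_charge_integral zeta E k (r : R) : Prop :=
  exists s : nat -> R -> R,
    [/\ forall j, simple01 (s j),
        forall e : R, 0 < e -> \forall j \near \oo,
          {ae leb, forall t, I01 t -> `|s j t - k t * \1_E t| <= e}
      & (fun j => simple_integral zeta (s j)) @ \oo --> r].

(** For [zeta] in ba, [E] in [Leb01] and [k] in L^oo there is exactly one [r]
    with [is_charge_integral zeta E k r]; 0 is a default value otherwise. *)
Definition charge_integral zeta E k : R :=
  xget 0 [set r | is_charge_integral zeta E k r].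

Definition charge_integral_col {p : nat} zeta E (K : R -> 'cV[R]_p) : 'cV[R]_p :=
  \col_i charge_integral zeta E (fun t => K t i ord0).

Definition charge_ae_zero zeta k : Prop :=
  forall e : R, 0 < e -> tvar zeta (I01 `&` [set t | e < `|k t|]) = 0.

Definition right_concentrated zeta (ts : R) : Prop :=
  forall e : R, 0 < e -> zeta (`]ts, (ts + e)[ `&` I01) = zeta I01.

Definition left_concentrated zeta (ts : R) : Prop :=
  forall e : R, 0 < e -> zeta (`](ts - e), ts[ `&` I01) = zeta I01.

End charges.

Section derivatives.
Context {R : realType} {n m : nat}.
Implicit Types (h : R -> 'cV[R]_n -> 'cV[R]_m -> R).

Definition grad_x h t x u : 'rV[R]_n :=
  \row_j 'D_(delta_mx j ord0) (fun y => h t y u) x.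

Definition grad_u h t x u : 'rV[R]_m :=
  \row_j 'D_(delta_mx j ord0) (fun w => h t x w) u.

Definition domain01 : set (R * 'cV[R]_n * 'cV[R]_m) := [set q | I01 q.1.1].

Definition C1_data h : Prop :=
  [/\ {within domain01, continuous (fun q => h q.1.1 q.1.2 q.2)},
      forall t x u, I01 t ->
        differentiable (fun q : 'cV[R]_n * 'cV[R]_m => h t q.1 q.2) (x, u),
      {within domain01, continuous (fun q => grad_x h q.1.1 q.1.2 q.2)}
    & {within domain01, continuous (fun q => grad_u h q.1.1 q.1.2 q.2)}].

Definition jac_x (F : R -> 'cV[R]_n -> 'cV[R]_m -> 'cV[R]_n) t x u : 'M[R]_n :=
  \matrix_(i, j) grad_x (fun t x u => F t x u i ord0) t x u ord0 j.

Definition jac_u (F : R -> 'cV[R]_n -> 'cV[R]_m -> 'cV[R]_n) t x u :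
    'M[R]_(n, m) :=
  \matrix_(i, j) grad_u (fun t x u => F t x u i ord0) t x u ord0 j.

(** The "bar" notation of the problem: evaluation along [(x, u)]. *)
Definition along {T : Type} (h : R -> 'cV[R]_n -> 'cV[R]_m -> T)
  (x : R -> 'cV[R]_n) (u : R -> 'cV[R]_m) (t : R) : T := h t (x t) (u t).

End derivatives.

Section problem.
Context {R : realType} {n m : nat}.
Variables (L : R -> 'cV[R]_n -> 'cV[R]_m -> R).
Variables (f : R -> 'cV[R]_n -> 'cV[R]_m -> 'cV[R]_n).
Variables (g : R -> 'cV[R]_n -> 'cV[R]_m -> R).
Variable (x0 : 'cV[R]_n).
Implicit Types (x : R -> 'cV[R]_n) (u : R -> 'cV[R]_m).

Definition problem_data : Prop :=
  [/\ C1_data L, forall i, C1_data (fun t y w => f t y w i ord0) & C1_data g].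

Definition cost x u : R := \int[leb]_(t in I01) along L x u t.

Definition admissible x u : Prop :=
  [/\ exists2 v, W11 x v & {ae leb, forall t, I01 t -> v t = along f x u t},
      Linfty u,
      {ae leb, forall t, I01 t -> along g x u t <= 0}
    & x 0 = x0].

Definition weak_local_minimizer xb ub : Prop :=
  admissible xb ub /\
  exists2 e : R, 0 < e & forall x u, admissible x u ->
    (C_norm (fun t => (x t - xb t)%R) < e%:E)%E ->
    (Linfty_norm (fun t => (u t - ub t)%R) < e%:E)%E ->
    cost xb ub <= cost x u.

Section multipliers.
Variables (xb : R -> 'cV[R]_n) (ub : R -> 'cV[R]_m).
Variables (lam beta : R -> 'cV[R]_n) (lam0 : R) (z : R -> R).
Variable (zeta : set R -> R).

Let gxT t : 'cV[R]_n := (along (grad_x g) xb ub t)^T.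
Let guT t : 'cV[R]_m := (along (grad_u g) xb ub t)^T.

Definition adjoint_density (t : R) : 'cV[R]_n :=
  (along (jac_x f) xb ub t)^T *m lam t
  + lam0 *: (along (grad_x L) xb ub t)^T + z t *: gxT t.

(** [- d lam = adjoint_density dt + d beta] as measures on [0,1]. *)
Definition adjoint_equation : Prop :=
  forall i, exists dlam dbeta : {charge set (measurableTypeR R) -> \bar R},
    [/\ is_dmeasure (fun t => lam t i ord0) dlam,
        is_dmeasure (fun t => beta t i ord0) dbeta
      & forall A : set R, measurable A -> A `<=` I01 ->
          (- dlam A =
           \int[leb]_(t in A) (adjoint_density t i ord0)%:E + dbeta A)%E].

Definition beta_of_charge : Prop :=
  beta 0 = - charge_integral_col zeta I01 gxT /\
  forall t, 0 < t < 1 ->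
    (fun k : nat => - charge_integral_col zeta `[t + k.+1%:R^-1, 1] gxT)
      @ \oo --> beta t.

Definition multiplier_tuple : Prop :=
  [/\ [/\ 0 <= lam0,
          leb.-integrable I01 (EFin \o z),
          {ae leb, forall t, I01 t -> 0 <= z t} &
          BV01 lam /\ BV01 beta],
      [/\ is_ba zeta, pure zeta & forall E, Leb01 E -> 0 <= zeta E],
      0 < lam0 + \int[leb]_(t in I01) `|z t| + zeta I01,
      {ae leb, forall t, I01 t -> z t * along g xb ub t = 0} /\
        charge_ae_zero zeta (along g xb ub) &
      [/\ lam 1 = 0 /\ beta 1 = 0,
          adjoint_equation,
          beta_of_charge,
          {ae leb, forall t, I01 t ->
            0 = (along (jac_u f) xb ub t)^T *m lam t
                + lam0 *: (along (grad_u L) xb ub t)^T + z t *: guT t} &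
          forall E, Leb01 E -> charge_integral_col zeta E guT = 0]].

Definition degenerate : Prop :=
  [/\ lam0 = 0,
      {ae leb, forall t, I01 t -> z t = 0} &
      exists2 ts : R, I01 ts & exists alpha : 'cV[R]_n,
        [/\ forall t, I01 t -> t < ts -> lam t = alpha /\ - beta t = alpha,
            forall t, I01 t -> ts <= t -> ~ (ts = 0 /\ t = 0) ->
              lam t = 0 /\ - beta t = 0,
            ts = 0 ->
              lam 0 = - beta 0 /\ - beta 0 = charge_integral_col zeta I01 gxT,
            is_ba zeta /\ pure zeta &
            left_concentrated zeta ts \/ right_concentrated zeta ts]].

End multipliers.

End problem.

(* Main.v *)
Require Import Defs.
From HB Require Import structures.
From mathcomp Require Import all_boot all_order all_algebra.
From mathcomp Require Import all_classical all_reals all_analysis.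
From mathcomp Require Import measurable_realfun ess_sup_inf ring lra.

Set Implicit Arguments.
Unset Strict Implicit.
Unset Printing Implicit Defensive.

Import Order.TTheory GRing.Theory Num.Theory.
Import numFieldNormedType.Exports.

Local Open Scope classical_set_scope.
Local Open Scope ring_scope.

(** With initial state fixed and final state free the problem is normal, so we
    look for multipliers with [lam0 = 1] and [zeta = 0].  Solving the
    stationarity condition for [z] where [gbar = 0] gives
    [z = - <gu, fu^T lam + Lu^T> / |gu|^2]; substituted in the adjoint equation
    this leaves a linear backward equation for [lam] whose coefficients are
    O(1 + 1 / omega), hence integrable: this is where the integrability of
    [1 / omega] enters.  It remains to see that this [z] is nonnegative and
    that stationarity holds a.e.  Both are local, so it suffices to argue on
    [[delta, 1]], where [|gu|] is bounded below near the active set.  There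
    [ub] is perturbed by [s w + K y], where [y] is the resulting deviation of
    the state and the feedback [K = - gu^T gx / |gu|^2] keeps the mixed
    constraint satisfied; as nothing is perturbed on [[0, delta[], the
    degeneracy of [gu] at 0 is harmless.  Minimality, combined with the duality
    between [lam] and [y], yields [0 <= \int <h, w>] with
    [h = fu^T lam + Lu^T] in the limit; for [w = - (h + max z 0 gu^T)] the
    integrand is [- (|h + z gu^T|^2 + (min z 0)^2 |gu|^2)], which must therefore
    vanish. *)

(** * Integration on the unit interval *)

(** No separation theorem is involved: [lam] and [z] are constructed outright, and minimality only
    has to confirm two pointwise statements about them. The main obstacle is the band where [gbar]
    is negative but close to 0. The constraint is nearly binding there, so the feedback must act,
    yet [z] vanishes: the descent direction may increase [g], and the feedback has no counterpart
    [z gx] in the adjoint equation. The remedy is to switch the descent direction off on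
    [- eta <= gbar < 0] and to accept the feedback error; both costs are a fixed constant times the
    measure of the band, which tends to 0 with [eta]. Hence constants must be fixed before [eta] and
    the perturbation, which explains the order of quantifiers in [feedback_trajectory] and
    [first_variation]. The control also receives a push proportional to [- eta gu^T / |gu|^2]: the
    strict decrease of the linearized constraint absorbs the Taylor remainder, which has no rate
    since derivatives are merely continuous. Estimates use the sup norm of vectors and matrices;
    Euclidean lengths enter only through the hypotheses and [sqn]. *)

Section integration_on_unit_interval.
Context {R : realType}.
Implicit Types (h a b : R -> R) (D : set (measurableTypeR R)).

Definition L1 h := leb.-integrable I01 (EFin \o h).

Lemma I01E : (I01 : set R) = `[0, 1]%classic.
Proof. by apply/seteqP; split => t /=; rewrite in_itv. Qed.

Lemma measurable_I01 : measurable (I01 : set (measurableTypeR R)).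
Proof. by rewrite I01E. Qed.
Hint Resolve measurable_I01 : core.

Lemma leb_I01 : leb (I01 : set (measurableTypeR R)) = 1%E.
Proof. by rewrite I01E lebesgue_measure_itv /= lte_fin ltr01 oppr0 adde0. Qed.

Lemma L1_measurable h : L1 h -> measurable_fun I01 h.
Proof. by move=> /integrableP[/measurable_EFinP]. Qed.

Lemma L1_bounded h M : measurable_fun I01 h ->
  (forall t, I01 t -> `|h t| <= M) -> L1 h.
Proof.
move=> mh hM; apply: measurable_bounded_integrable => //.
  by rewrite [X in (X < _)%E]leb_I01 ltry.
by exists M; split; [exact: num_real|move=> x Mx t It];
  exact: le_trans (hM t It) (ltW Mx).
Qed.

Lemma L1_le h a : measurable_fun I01 h -> L1 a ->
  (forall t, I01 t -> `|h t| <= a t) -> L1 h.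
Proof.
move=> mh ia ha; apply: le_integrable ia => //; first exact/measurable_EFinP.
by move=> t It; rewrite lee_fin (le_trans (ha t It))// ler_norm.
Qed.

Lemma L1D h a : L1 h -> L1 a -> L1 (fun t => h t + a t).
Proof. by move=> ih ia; have := integrableD measurable_I01 ih ia. Qed.

Lemma L1Z (c : R) h : L1 h -> L1 (fun t => c * h t).
Proof. by move=> ih; have := integrableZl measurable_I01 c ih. Qed.

Lemma L1N h : L1 h -> L1 (fun t => - h t).
Proof. by move=> ih; have := integrableN ih. Qed.

Lemma L1B h a : L1 h -> L1 a -> L1 (fun t => h t - a t).
Proof. by move=> ih ia; apply: L1D => //; apply: L1N. Qed.

Lemma L1_cst (c : R) : L1 (fun=> c).
Proof. exact: (@L1_bounded _ `|c|). Qed.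

Lemma L1_sum I (s : seq I) (P : pred I) (F : I -> R -> R) :
  (forall i, P i -> L1 (F i)) -> L1 (fun t => \sum_(i <- s | P i) F i t).
Proof.
move=> iF; elim: s => [|i s IHs].
  rewrite (_ : (fun _ => _) = fun=> 0); first exact: L1_cst.
  by apply/funext => t; rewrite big_nil.
have [Pi|nPi] := boolP (P i); last first.
  rewrite (_ : (fun _ => _) = fun t => \sum_(i <- s | P i) F i t)//.
  by apply/funext => t; rewrite big_cons (negbTE nPi).
rewrite (_ : (fun _ => _) = fun t => F i t + \sum_(i <- s | P i) F i t).
  by apply: L1D => //; exact: iF.
by apply/funext => t; rewrite big_cons Pi.
Qed.

Lemma L1M_bounded h a M : L1 a -> measurable_fun I01 h ->
  (forall t, I01 t -> `|h t| <= M) -> L1 (fun t => a t * h t).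
Proof.
move=> ia mh hM; apply: (@L1_le _ (fun t => M * `|a t|)).
- by apply: measurable_funM => //; exact: L1_measurable.
- by apply: L1Z; have := integrable_norm ia.
- by move=> t It; rewrite normrM mulrC ler_wpM2r// hM.
Qed.

Lemma eq_L1 h a : (forall t, I01 t -> h t = a t) -> L1 h -> L1 a.
Proof.
move=> ha; apply: eq_integrable => // t; rewrite inE => It /=.
by rewrite ha.
Qed.

Lemma L1_sub D h : measurable D -> D `<=` I01 -> L1 h ->
  leb.-integrable D (EFin \o h).
Proof. by move=> mD DI; apply: integrableS. Qed.

Lemma Rintegral_abs_le D h a : measurable D -> D `<=` I01 ->
  measurable_fun I01 h -> L1 a -> (forall t, D t -> `|h t| <= a t) ->
  `|\int[leb]_(t in D) h t| <= \int[leb]_(t in D) a t.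
Proof.
move=> mD DI mh ia ha.
have iaD : leb.-integrable D (EFin \o a) by exact: L1_sub.
have ihD : leb.-integrable D (EFin \o h).
  apply: le_integrable iaD => //.
    by apply/measurable_EFinP; apply: measurable_funS mh.
  by move=> t Dt; rewrite lee_fin (le_trans (ha t Dt))// ler_norm.
apply: (le_trans (le_normr_Rintegral _ ihD)) => //.
by apply: le_Rintegral => //; exact: integrable_norm.
Qed.

Lemma Rintegral_restrict D h : D `<=` I01 ->
  \int[leb]_(t in D) h t = \int[leb]_(t in I01) (h t * \1_D t).
Proof.
move=> DI; rewrite -[in LHS](setIidr DI) Rintegral_mkcondr.
apply: eq_Rintegral => t _; rewrite patchE indicE.
by case: ifP => _; rewrite ?mulr1 ?mulr0.
Qed.

Lemma Rintegral_sum D I (s : seq I) (P : pred I) (F : I -> R -> R) :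
  measurable D -> D `<=` I01 ->
  (forall i, P i -> L1 (F i)) ->
  \int[leb]_(t in D) (\sum_(i <- s | P i) F i t) =
  \sum_(i <- s | P i) \int[leb]_(t in D) F i t.
Proof.
move=> mD DI iF; elim: s => [|i s IHs].
  by rewrite big_nil; under eq_Rintegral do rewrite big_nil;
     rewrite Rintegral_cst// mul0r.
rewrite big_cons; under eq_Rintegral do rewrite big_cons.
case: ifP => // Pi; rewrite RintegralD ?IHs//; apply: L1_sub => //.
  exact: iF.
exact: L1_sum.
Qed.

Lemma continuous_L1_primitive h : L1 h ->
  {within I01, continuous (fun t => \int[leb]_(s in `[0, t]) h s)}.
Proof.
rewrite /L1 I01E => ih.
exact: (@parameterized_integral_continuous R 0 1 h ler01 ih).
Qed.

Lemma Rintegral_tail h t : L1 h -> I01 t ->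
  \int[leb]_(s in `[t, 1]) h s =
  \int[leb]_(s in I01) h s - \int[leb]_(s in `[0, t]) h s.
Proof.
move=> ih /andP[t0 t1]; rewrite /L1 I01E in ih *.
rewrite Rintegral_itvB ?bnd_simp//.
rewrite Rintegral_itv_obnd_cbnd//.
apply: integrableS ih => //; apply: subset_itvr.
by rewrite bnd_simp.
Qed.

Lemma continuous_L1_tail h : L1 h ->
  {within I01, continuous (fun t => \int[leb]_(s in `[t, 1]) h s)}.
Proof.
move=> ih; set c := \int[leb]_(s in I01) h s.
have : {within I01, continuous (fun t => c - \int[leb]_(s in `[0, t]) h s)}.
  move=> t; apply: cvgB; first exact: cvg_cst.
  exact: continuous_L1_primitive.
have e : {in (I01 : set R), (fun t => c - \int[leb]_(s in `[0, t]) h s) =1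
    (fun t => \int[leb]_(s in `[t, 1]) h s)}.
  by move=> t; rewrite inE => It; rewrite /= /c (Rintegral_tail ih It).
exact: subspace_eq_continuous e.
Qed.

Lemma within_continuous_measurable h :
  {within I01, continuous h} -> measurable_fun I01 h.
Proof. exact: subspace_continuous_measurable_fun. Qed.

Lemma within_continuous_bounded h :
  {within I01, continuous h} -> exists M, forall t, I01 t -> `|h t| <= M.
Proof.
move=> ch; have := continuous_compact ch; rewrite {1}I01E => /(_ (@segment_compact _ _ _)).
move=> /compact_bounded[M [_ hM]]; exists (M + 1) => t It.
by apply: hM; [rewrite ltrDl | exists t].
Qed.

Lemma subI01l t : I01 t -> `[0, t]%classic `<=` (I01 : set R).
Proof.
by move=> /andP[_ t1] s /=; rewrite in_itv /I01 /= => /andP[-> /le_trans ->].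
Qed.

Lemma subI01r t : I01 t -> `[t, 1]%classic `<=` (I01 : set R).
Proof.
by move=> /andP[t0 _] s /=; rewrite in_itv /I01 /= => /andP[/(le_trans t0) -> ->].
Qed.

End integration_on_unit_interval.
#[global] Hint Resolve measurable_I01 : core.

(** * Exchange of integrals on the triangle [t <= s] *)

Section fubini_unit_interval.
Context {R : realType}.
Implicit Types (p r : R -> R).

Lemma EFin_Rintegral (D : set R) p : leb.-integrable D (EFin \o p) ->
  measurable D ->
  (\int[leb]_(t in D) p t)%:E = (\int[leb]_(t in D) (p t)%:E)%E.
Proof. by move=> ip mD; rewrite fineK// integrable_fin_num. Qed.

(** The triangle is encoded as a factor and [I01] by extension with 0, so that both iterated
    integrals come from one integrable function on the whole plane. *)
Let kern p r (q : R * R) : R :=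
  (r \_ I01) q.1 * (p \_ I01) q.2 * (if q.1 <= q.2 then 1 else 0).

Lemma L1_restrictT p : L1 p -> leb.-integrable setT (EFin \o (p \_ I01)).
Proof.
move=> ip; rewrite -restrict_EFin; apply/integrable_restrict => //.
by rewrite setTI.
Qed.

Lemma kern_measurable p r : L1 p -> L1 r ->
  measurable_fun [set: measurableTypeR R * measurableTypeR R] (kern p r).
Proof.
move=> ip ir.
have mp : measurable_fun [set: measurableTypeR R] (p \_ I01).
  by have /integrableP[/measurable_EFinP] := L1_restrictT ip.
have mr : measurable_fun [set: measurableTypeR R] (r \_ I01).
  by have /integrableP[/measurable_EFinP] := L1_restrictT ir.
apply: measurable_funM; first apply: measurable_funM.
- by apply: (measurableT_comp mr); exact: measurable_fst.
- by apply: (measurableT_comp mp); exact: measurable_snd.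
- apply: measurable_fun_ifT => //.
  by apply: measurable_fun_ler; [exact: measurable_fst|exact: measurable_snd].
Qed.

Lemma kern_integrable p r : L1 p -> L1 r ->
  (leb \x leb)%E.-integrable [set: measurableTypeR R * measurableTypeR R]
    (EFin \o kern p r).
Proof.
move=> ip ir; have mk := kern_measurable ip ir.
apply/integrable12ltyP; first exact/measurable_EFinP.
have irT := L1_restrictT ir; have ipT := L1_restrictT ip.
pose C := (\int[leb]_x `|(p \_ I01) x|%:E)%E.
have C0 : (0 <= C)%E by exact: integral_ge0.
have Cfin : (C < +oo)%E by have /integrableP[_] := ipT.
have Ck : C \is a fin_num by rewrite ge0_fin_numE.
have mp : measurable_fun [set: measurableTypeR R] (p \_ I01).
  by have /integrableP[/measurable_EFinP] := ipT.
have mr : measurable_fun [set: measurableTypeR R] (r \_ I01).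
  by have /integrableP[/measurable_EFinP] := irT.
(* Dropping the triangle factor bounds the inner integral by [C], the L^1 norm of [p], so the double
   integral is at most the product of the two L^1 norms. *)
apply: (@le_lt_trans _ _ (\int[leb]_x (`|(r \_ I01) x|%:E * C))%E).
  apply: ge0_le_integral => //.
  - by move=> x _; exact: integral_ge0.
  - have mk' : measurable_fun setT (abse \o (EFin \o kern p r)).
      by apply: measurableT_comp => //; exact/measurable_EFinP.
    have := (@measurable_fun_fubini_tonelli_F _ _ (measurableTypeR R)
      (measurableTypeR R) R leb (abse \o (EFin \o kern p r)) mk').
    by apply => x; exact: abse_ge0.
  - by apply: emeasurable_funM => //; apply/measurable_EFinP; exact: measurableT_comp.
  - move=> x _; rewrite -ge0_integralZl//; last first.
      by apply/measurable_EFinP; exact: measurableT_comp.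
    apply: ge0_le_integral => //.
    + by apply: measurableT_comp => //; apply/measurable_EFinP; exact: (measurableT_comp mk).
    + apply: emeasurable_funM => //; apply/measurable_EFinP; exact: measurableT_comp.
    + move=> y _; rewrite /= -EFinM lee_fin /kern /= !normrM ler_piMr ?mulr_ge0//.
      by case: ifP; rewrite ?normr1 ?normr0.
rewrite -(fineK Ck) ge0_integralZr//; last by rewrite lee_fin fine_ge0.
  rewrite lte_mul_pinfty ?integral_ge0//.
  by rewrite ge0_fin_numE ?integral_ge0//; have /integrableP[_] := irT.
  exact: ltry.
by apply/measurable_EFinP; exact: measurableT_comp.
Qed.

(** This takes the place of integration by parts in the duality between costate and state deviation,
    both of which are known only as primitives. *)
Lemma Rintegral_exchange p r : L1 p -> L1 r ->
  \int[leb]_(t in I01) (r t * \int[leb]_(s in `[t, 1]) p s) =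
  \int[leb]_(s in I01) (p s * \int[leb]_(t in `[0, s]) r t).
Proof.
move=> ip ir; have := Fubini (kern_integrable ip ir).
rewrite [X in X = _ -> _](_ : _ =
  \int[leb]_(t in I01) (r t * \int[leb]_(s in `[t, 1]) p s)%:E)%E; last first.
  rewrite [RHS]integral_mkcond; apply: eq_integral => t _.
  rewrite [in RHS]patchE; case: ifPn => [|It].
    rewrite inE => It.
    rewrite EFinM EFin_Rintegral//; last first.
      by apply: L1_sub => //; exact: subI01r.
    rewrite -integralZl//; last by apply: L1_sub => //; exact: subI01r.
    rewrite [RHS]integral_mkcond; apply: eq_integral => s _.
    rewrite /kern /= patchE mem_set// !patchE.
    case: ifPn => Is.
      have {}Is : I01 s by rewrite inE in Is.
      have [ts|ts] := leP t s.
        by rewrite mem_set ?mulr1//= in_itv /= ts; case/andP: Is.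
      by rewrite memNset ?mulr0//= in_itv /= leNgt ts.
    rewrite mulr0 mul0r; case: ifPn => //; rewrite inE => ts.
    by move: Is; rewrite mem_set//; exact: (subI01r It).
  under eq_integral.
    move=> s _; rewrite /kern /= patchE (negbTE It) !mul0r; over.
  by rewrite integral0.
rewrite [X in _ = X -> _](_ : _ =
  \int[leb]_(s in I01) (p s * \int[leb]_(t in `[0, s]) r t)%:E)%E; last first.
  rewrite [RHS]integral_mkcond; apply: eq_integral => s _.
  rewrite [in RHS]patchE; case: ifPn => [|Is].
    rewrite inE => Is.
    rewrite EFinM EFin_Rintegral//; last first.
      by apply: L1_sub => //; exact: subI01l.
    rewrite -integralZl//; last by apply: L1_sub => //; exact: subI01l.
    rewrite [RHS]integral_mkcond; apply: eq_integral => t _.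
    rewrite /kern /= [(p \_ _) _]patchE mem_set// !patchE.
    case: ifPn => It.
      have {}It : I01 t by rewrite inE in It.
      have [ts|ts] := leP t s.
        by rewrite mem_set ?mulr1//= 1?mulrC ?in_itv /= ?ts ?andbT//; case/andP: It.
      by rewrite memNset ?mulr0//= in_itv /= [t <= s]leNgt ts andbF.
    rewrite !mul0r; case: ifPn => //; rewrite inE => ts.
    by move: It; rewrite mem_set//; exact: (subI01l Is).
  under eq_integral.
    move=> t _; rewrite /kern /= [(p \_ _) _]patchE (negbTE Is) mulr0 mul0r; over.
  by rewrite integral0.
by rewrite /Rintegral => ->.
Qed.

End fubini_unit_interval.

(** * Exponential weights for integrable coefficients *)

Section weights.
Context {R : realType}.
Implicit Types (a b : R -> R).

(** The positive parts of [a - k] tend to 0 pointwise and are dominated by [a]. The value [1 / 4] is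
    the share that [weight_split] leaves to this remainder. *)
Lemma L1_truncation a : L1 a -> (forall t, I01 t -> 0 <= a t) ->
  exists2 K, 0 <= K & \int[leb]_(t in I01) Num.max (a t - K) 0 <= 1 / 4.
Proof.
move=> ia a0; pose b (k : nat) (t : R) := Num.max (a t - k%:R) 0.
have mb k : measurable_fun I01 (b k).
  by apply: measurable_maxr => //; apply: measurable_funB => //; exact: L1_measurable.
have bcvg t : I01 t -> (b k t)%:E @[k --> \oo] --> 0%E.
  move=> It; apply: cvg_near_cst; near=> k; congr EFin; apply/max_idPr.
  rewrite subr_le0; near: k; exact: nbhs_infty_ger.
have bdom k t : I01 t -> (`|(b k t)%:E| <= (a t)%:E)%E.
  move=> It; rewrite lee_fin ger0_norm ?le_max ?lexx ?orbT//.
  by rewrite ge_max a0// andbT gerBl.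
have := dominated_cvg measurable_I01
  (fun k => iffRL (measurable_EFinP _ _) (mb k)) bcvg _ ia bdom.
move=> /(_ (fun _ _ => isT)); rewrite integral0.
move=> /(_ [set y | (y < (1 / 4)%:E)%E]).
case; first by apply: open_ereal_lt'; rewrite lte_fin divr_gt0.
move=> k _ /(_ k (leqnn k)) /= bk.
exists k%:R => //.
have ib : L1 (b k).
  apply: (L1_le (mb k) ia) => t It; have := bdom k t It.
  by rewrite lee_fin.
have e := EFin_Rintegral ib measurable_I01.
by rewrite -lee_fin [X in (X <= _)%E]e; exact/ltW.
Unshelve. all: by end_near. Qed.

Lemma continuous_expR_affine (c d : R) : continuous (fun s => expR (c * s + d)).
Proof.
move=> s; apply: continuous_comp; last exact: continuous_expR.
by apply: cvgD; [apply: cvgM => //; exact: cvg_cst|exact: cvg_cst].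
Qed.

Lemma is_derive_expR_affine (c d s : R) :
  is_derive s 1 (fun s => expR (c * s + d)) (c * expR (c * s + d)).
Proof.
rewrite mulrC; apply: is_derive1_comp.
by apply: is_derive_eq; rewrite addr0 [_ *: _]mulr1.
Qed.

Lemma Rintegral_expR_affine (c d a b : R) : a <= b ->
  \int[leb]_(s in `[a, b]) (c * expR (c * s + d)) =
  expR (c * b + d) - expR (c * a + d).
Proof.
rewrite le_eqVlt => /predU1P[->|ab].
  by rewrite set_itv1 Rintegral_set1 subrr.
rewrite /Rintegral (@continuous_FTC2 _ _ (fun s => expR (c * s + d)))//.
- apply: continuous_subspaceT => s; apply: cvgM; first exact: cvg_cst.
  exact: continuous_expR_affine.
- split.
  + by move=> s _; have [] := is_derive_expR_affine c d s.
  + exact/cvg_at_right_filter/continuous_expR_affine.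
  + exact/cvg_at_left_filter/continuous_expR_affine.
- by move=> s _; rewrite derive1E; have [_ ->] := is_derive_expR_affine c d s.
Qed.

(** An exponential weight of rate [4 K] absorbs the bounded part [K] of [a] and
    leaves the remainder [b], which is small in L^1: no chain rule for
    absolutely continuous functions is needed. *)
Lemma weight_split a b (K W0 Wt : R) (W : R -> R)
    (D : set (measurableTypeR R)) :
  measurable D -> D `<=` I01 -> L1 a -> L1 b -> 0 <= K ->
  (forall t, 0 <= b t) -> (forall s, I01 s -> a s <= K + b s) ->
  measurable_fun I01 W -> (forall s, I01 s -> 0 <= W s <= W0) ->
  (forall s, D s -> W s <= Wt) -> 0 <= Wt ->
  \int[leb]_(s in I01) b s <= 1 / 4 ->
  \int[leb]_(s in D) (4 * K * W s) <= Wt ->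
  \int[leb]_(s in D) (a s * W s) <= Wt / 2.
Proof.
move=> mD DI ia ib K0 b0 aKb mW W0W WWt Wt0 ib4 iW.
have Wb s : I01 s -> `|W s| <= W0.
  by move=> Is; have /andP[W0s] := W0W s Is; rewrite ger0_norm.
have iaW : L1 (fun s => a s * W s) by exact: L1M_bounded mW Wb.
have iKW : L1 (fun s => 4 * K * W s) by apply: L1Z; exact: L1_bounded Wb.
have ibW : L1 (fun s => Wt * b s) by exact: L1Z.
(* The product [a * W] is split as [K * W + b * W]. The first term is a quarter of [4 * K * W], the
   second is at most [Wt * b]; each integrates to at most [Wt / 4]. *)
apply: (@le_trans _ _
  (\int[leb]_(s in D) (4^-1 * (4 * K * W s) + Wt * b s))).
  apply: le_Rintegral => //; [exact: L1_sub| |].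
    by apply: L1_sub => //; apply: L1D => //; exact: L1Z.
  move=> s Ds; have Is := DI s Ds; have /andP[W0s _] := W0W s Is.
  rewrite -mulrA mulKf ?pnatr_eq0//.
  apply: le_trans (ler_wpM2r W0s (aKb s Is)) _.
  by rewrite mulrDl lerD2l mulrC ler_wpM2r// WWt.
rewrite (RintegralD mD (L1_sub mD DI (L1Z _ iKW)) (L1_sub mD DI ibW)).
rewrite (RintegralZl _ mD (L1_sub mD DI iKW)) (RintegralZl _ mD (L1_sub mD DI ib)).
have : \int[leb]_(s in D) b s <= 1 / 4.
  apply: le_trans ib4; rewrite (Rintegral_restrict _ DI).
  apply: le_Rintegral => //.
    apply: (L1M_bounded (M := 1) ib).
      by apply: measurable_indic.
    by move=> s _; rewrite indicE; case: (_ \in _); rewrite ?normr1 ?normr0.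
  by move=> s Is; rewrite indicE; case: (_ \in _); rewrite ?mulr1 ?mulr0.
move=> /(ler_wpM2l Wt0); lra.
Qed.

(** For [W = expR (4 * K * s)] the function [4 * K * W] is the derivative of [W], so its integral
    over [[0, t]] is at most [W t]. The conclusion says that a Volterra operator with Lipschitz
    coefficient [a] has norm at most 1/2 in the sup norm weighted by [1 / W]. *)
Lemma forward_weight a : L1 a -> (forall t, I01 t -> 0 <= a t) ->
  exists (W : R -> R) (Wm : R),
  [/\ measurable_fun I01 W, forall t, I01 t -> 1 <= W t <= Wm &
      forall t, I01 t -> \int[leb]_(s in `[0, t]) (a s * W s) <= W t / 2].
Proof.
move=> ia a0; have [K K0 bK] := L1_truncation ia a0.
pose W s := expR (4 * K * s + 0); exists W, (W 1).
have mW : measurable_fun I01 W.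
  apply: within_continuous_measurable; apply: continuous_subspaceT.
  exact: continuous_expR_affine.
have Wle s t : s <= t -> W s <= W t.
  by move=> st; rewrite ler_expR lerD2r ler_wpM2l// mulr_ge0.
have W0 : W 0 = 1 by rewrite /W mulr0 addr0 expR0.
have Wb t : I01 t -> 1 <= W t <= W 1.
  by move=> /andP[t0 t1]; rewrite -{1}W0 !Wle.
split => // t It; have /andP[t0 t1] := It.
apply: (@weight_split a (fun s => Num.max (a s - K) 0) K (W 1) (W t)) => //.
- exact: subI01l.
- have mb : measurable_fun I01 (fun s => Num.max (a s - K) 0).
    by apply: measurable_maxr => //; apply: measurable_funB => //; exact: L1_measurable.
  apply: (L1_le mb ia) => s Is; rewrite ger0_norm ?le_max ?lexx ?orbT//.
  by rewrite ge_max a0// andbT gerBl.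
- by move=> s; rewrite le_max lexx orbT.
- by move=> s _; rewrite -lerBlDl le_max lexx.
- by move=> s /Wb/andP[+ ->]; rewrite andbT; exact: le_trans.
- by move=> s /=; rewrite in_itv /= => /andP[_]; exact: Wle.
- exact: expR_ge0.
- rewrite (Rintegral_expR_affine _ _ t0) -/(W t) -/(W 0) W0.
  by rewrite gerBl.
Qed.

(** The same in reversed time: the weight decreases to the value 1 at the terminal instant. *)
Lemma backward_weight a : L1 a -> (forall t, I01 t -> 0 <= a t) ->
  exists (W : R -> R) (Wm : R),
  [/\ measurable_fun I01 W, forall t, I01 t -> 1 <= W t <= Wm &
      forall t, I01 t -> \int[leb]_(s in `[t, 1]) (a s * W s) <= W t / 2].
Proof.
move=> ia a0; have [K K0 bK] := L1_truncation ia a0.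
pose W s := expR (- (4 * K) * s + 4 * K); exists W, (W 0).
have mW : measurable_fun I01 W.
  apply: within_continuous_measurable; apply: continuous_subspaceT.
  exact: continuous_expR_affine.
have Wle s t : s <= t -> W t <= W s.
  by move=> st; rewrite ler_expR lerD2r !mulNr lerN2 ler_wpM2l// mulr_ge0.
have W1 : W 1 = 1 by rewrite /W mulr1 addNr expR0.
have Wb t : I01 t -> 1 <= W t <= W 0.
  by move=> /andP[t0 t1]; rewrite -{1}W1 !Wle.
split => // t It; have /andP[t0 t1] := It.
apply: (@weight_split a (fun s => Num.max (a s - K) 0) K (W 0) (W t)) => //.
- exact: subI01r.
- have mb : measurable_fun I01 (fun s => Num.max (a s - K) 0).
    by apply: measurable_maxr => //; apply: measurable_funB => //; exact: L1_measurable.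
  apply: (L1_le mb ia) => s Is; rewrite ger0_norm ?le_max ?lexx ?orbT//.
  by rewrite ge_max a0// andbT gerBl.
- by move=> s; rewrite le_max lexx orbT.
- by move=> s _; rewrite -lerBlDl le_max lexx.
- by move=> s /Wb/andP[+ ->]; rewrite andbT; exact: le_trans.
- by move=> s /=; rewrite in_itv /= => /andP[+ _]; exact: Wle.
- exact: expR_ge0.
- have := Rintegral_expR_affine (- (4 * K)) (4 * K) t1.
  rewrite -/(W t) -/(W 1) W1 => e.
  rewrite (_ : \int[leb]_(s in `[t, 1]) _ = W t - 1) ?gerBl//.
  rewrite -[RHS]opprB -e -[RHS]mulN1r -RintegralZl//.
    by apply: eq_Rintegral => s _; rewrite mulN1r mulNr opprK.
  apply: L1_sub => //; first exact: subI01r.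
  apply: L1Z; apply: (L1_bounded mW) => s Is.
  by rewrite ger0_norm ?expR_ge0//; have /andP[_] := Wb s Is; exact.
Qed.

End weights.

(** * Volterra equations with integrable Lipschitz constant *)

Section picard.
Context {R : realType}.

Lemma mx_entry_le {p q} (M : 'M[R]_(p, q)) i j : `|M i j| <= `|M|.
Proof.
rewrite [leRHS]/Num.norm /= mx_normrE; apply/bigmax_geP; right => /=.
by exists (i, j).
Qed.

Lemma mx_norm_le {p q} (M : 'M[R]_(p, q)) c : 0 <= c ->
  (forall i j, `|M i j| <= c) -> `|M| <= c.
Proof.
by move=> c0 Mc; rewrite [leLHS]/Num.norm /= mx_normrE; apply: bigmax_le.
Qed.

Definition mvec {p} (y : R -> 'cV[R]_p) :=
  forall i, measurable_fun I01 (fun t => y t i ord0).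

(** The intervals of center [u k] and radius [e k = 2 * c / 2 ^+ k] are nested, because
    [e k - e k.+1 = c / 2 ^+ k] bounds the step; the supremum of their left ends lies in all of
    them. *)
Lemma geometric_limit (u : nat -> R) (c : R) :
  (forall k, `|u k.+1 - u k| <= c / 2 ^+ k) ->
  exists l, forall k, `|l - u k| <= 2 * c / 2 ^+ k.
Proof.
move=> uc; pose e k : R := 2 * c / 2 ^+ k.
have eS k : e k.+1 = c / 2 ^+ k.
  by rewrite /e exprS invfM mulrACA divff ?mul1r// pnatr_eq0.
have e2 k : e k = c / 2 ^+ k + c / 2 ^+ k by rewrite /e -mulrA mulr2n mulrDl mul1r.
have c0 k : 0 <= c / 2 ^+ k by exact: le_trans (uc k).
pose v k := u k - e k; pose w k := u k + e k.
have vS k : v k <= v k.+1.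
  by have := uc k; rewrite ler_norml /v eS e2 => /andP[]; lra.
have wS k : w k.+1 <= w k.
  by have := uc k; rewrite ler_norml /w eS e2 => /andP[]; lra.
have vw k : v k <= w k by have := c0 k; rewrite /v /w e2; lra.
have vle j k : (j <= k)%N -> v j <= v k.
  by move=> jk; rewrite (homo_leq (fun x => lexx x) le_trans vS).
have wle j k : (j <= k)%N -> w k <= w j.
  move=> /subnK <-; elim: (k - j)%N => // i IH.
  by rewrite addSn (le_trans (wS _)).
have vwjk j k : v j <= w k.
  by rewrite (le_trans (vle j (maxn j k) (leq_maxl _ _)))// (le_trans (vw _))//
    wle// leq_maxr.
pose S := [set v k | k in setT].
have S0 : S !=set0 by exists (v 0%N), 0%N.
have hS : has_sup S by split=> //; exists (w 0%N) => _ [k _ <-].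
exists (sup S) => k; rewrite ler_norml; apply/andP; split.
  have : v k <= sup S by apply: sup_upper_bound => //; exists k.
  by rewrite /v -/(e k); lra.
have : sup S <= w k by apply: ge_sup => // _ [j _ <-].
by rewrite /w -/(e k); lra.
Qed.

Lemma le_geometric_eq0 (x c : R) : (forall k, `|x| <= c / 2 ^+ k) -> x = 0.
Proof.
move=> xc; apply/eqP; rewrite -normr_le0; apply/ler_addgt0Pr => e e0.
rewrite add0r.
have := @cvg_geometric R c 2^-1.
rewrite ger0_norm ?invr_ge0// invf_lt1 ?ltr1n// => /(_ isT).
move=> /cvgr0_norm_le /(_ _ e0)[k _ /(_ k (leqnn k))] /=.
by rewrite exprVn; apply: le_trans; apply: le_trans (xc k) (ler_norm _).
Qed.

(** The integral operator is a contraction of ratio 1/2 for the sup norm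
    weighted by [1 / W]. *)
Theorem volterra_equation (p : nat) (It : R -> set (measurableTypeR R))
    (F : R -> 'cV[R]_p -> 'cV[R]_p) (a W : R -> R) (B Wm : R) :
  (forall t, I01 t -> measurable (It t)) ->
  (forall t, I01 t -> It t `<=` I01) ->
  (forall h, L1 h -> measurable_fun I01 (fun t => \int[leb]_(s in It t) h s)) ->
  L1 a -> (forall t, I01 t -> 0 <= a t) ->
  measurable_fun I01 W -> (forall t, I01 t -> 1 <= W t <= Wm) ->
  (forall t, I01 t -> \int[leb]_(s in It t) (a s * W s) <= W t / 2) ->
  (forall y, mvec y -> mvec (fun s => F s (y s))) ->
  (forall s x y, I01 s -> `|F s x - F s y| <= a s * `|x - y|) ->
  0 <= B -> (forall s, I01 s -> `|F s 0| <= a s * B) ->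
  exists y : R -> 'cV[R]_p,
    [/\ mvec y, forall t, I01 t -> `|y t| <= 2 * B * W t &
        forall t i, I01 t -> y t i ord0 = \int[leb]_(s in It t) F s (y s) i ord0].
Proof.
move=> mI sI mint ia a0 mW bW aW mF lF B0 F0.
pose T y t : 'cV[R]_p := \col_i \int[leb]_(s in It t) F s (y s) i ord0.
pose Y k := iter k T (fun=> 0).
have W0 t : I01 t -> 0 <= W t by move=> /bW/andP[+ _]; exact: le_trans.
have Wn t : I01 t -> `|W t| <= Wm.
  by move=> It'; rewrite ger0_norm ?W0//; have /andP[] := bW t It'.
have iaW : L1 (fun s => a s * W s) by exact: L1M_bounded mW Wn.
(* Integrability along [y] requires a bound on [y], which is why the bound [2 * B * W] is carried
   through the whole iteration. *)
have iF y : mvec y -> (forall t, I01 t -> `|y t| <= 2 * B * W t) ->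
    forall i, L1 (fun s => F s (y s) i ord0).
  move=> my yb i; apply: (@L1_le _ _ (fun s => B * a s + 2 * B * (a s * W s))).
  - exact: mF.
  - by apply: L1D; exact: L1Z.
  move=> s Is; apply: (le_trans (mx_entry_le _ _ _)).
  rewrite -[F s (y s)](subrK (F s 0)) (le_trans (ler_normD _ _))// addrC.
  apply: lerD; first by rewrite mulrC F0.
  rewrite (le_trans (lF _ _ _ Is))// subr0 mulrCA ler_wpM2l ?a0//.
  exact: yb.
(* One application of the integral operator halves the weighted distance. *)
have cmp x y i c t : 0 <= c -> I01 t ->
    mvec x -> mvec y -> (forall s, I01 s -> `|x s| <= 2 * B * W s) ->
    (forall s, I01 s -> `|y s| <= 2 * B * W s) ->
    (forall s, I01 s -> `|x s - y s| <= c * W s) ->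
    `|\int[leb]_(s in It t) F s (x s) i ord0 -
      \int[leb]_(s in It t) F s (y s) i ord0| <= c * (W t / 2).
  move=> c0 Ht mx my xb yb xyc.
  have mIt := mI _ Ht; have sIt := sI _ Ht.
  rewrite -RintegralB //; last 2 first.
    by apply: L1_sub; [exact: mI|exact: sI|exact: iF].
    by apply: L1_sub; [exact: mI|exact: sI|exact: iF].
  apply: (@le_trans _ _ (\int[leb]_(s in It t) (c * (a s * W s)))).
    apply: Rintegral_abs_le => //; [|exact: L1Z|].
      by apply: measurable_funB; [exact: (mF _ mx)|exact: (mF _ my)].
    move=> s Hs; have Is := sI _ Ht s Hs.
    have -> : F s (x s) i ord0 - F s (y s) i ord0 = (F s (x s) - F s (y s)) i ord0.
      by rewrite !mxE.
    rewrite (le_trans (mx_entry_le _ _ _))// (le_trans (lF _ _ _ Is))//.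
    by rewrite mulrCA ler_wpM2l ?a0// xyc.
  rewrite RintegralZl //; last exact: L1_sub.
  by rewrite ler_wpM2l// aW.
(* The first increment is at most [B * W] and each later one half of its predecessor;
   [2 * (1 - 2^-1 ^+ k)] is the sum of the first [k] terms of that geometric series. *)
have YP k : [/\ mvec (Y k),
    forall t, I01 t -> `|Y k t| <= 2 * (1 - 2^-1 ^+ k) * (B * W t) &
    forall t, I01 t -> `|Y k.+1 t - Y k t| <= B * 2^-1 ^+ k * W t].
  have bnd j u : I01 u -> 2 * (1 - 2^-1 ^+ j) * (B * W u) <= 2 * B * W u.
    move=> Ht; rewrite -!mulrA ler_wpM2l// -[leRHS]mul1r.
    apply: ler_wpM2r; first by rewrite mulr_ge0 ?W0.
    by rewrite gerBl exprn_ge0// invr_ge0.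
  elim: k => [|k [mY Yb Yd]].
    split.
    - by move=> i; exact: measurable_cst.
    - by move=> t Ht; rewrite /Y /= normr0 expr0 subrr mulr0 mul0r.
    - move=> t Ht; rewrite /Y /= subr0 expr0 mulr1.
      have mIt := mI _ Ht; have sIt := sI _ Ht.
      apply: mx_norm_le; first by rewrite mulr_ge0 ?W0.
      move=> i j; rewrite mxE.
      apply: (@le_trans _ _ (\int[leb]_(s in It t) (B * (a s * W s)))).
        apply: Rintegral_abs_le => //; [|exact: L1Z|].
          by apply: (mF (fun=> 0)) => {}i; exact: measurable_cst.
        move=> s Hs; have Is := sI _ Ht s Hs.
        rewrite (le_trans (mx_entry_le _ _ _))// (le_trans (F0 s Is))//.
        rewrite [leRHS]mulrCA ler_wpM2l ?a0// ler_peMr//.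
        by have /andP[] := bW s Is.
      rewrite RintegralZl //; last exact: L1_sub.
      rewrite ler_wpM2l// (le_trans (aW t Ht))// ler_pdivrMr// ler_peMr ?W0//.
      by rewrite ler1n.
  have mY1 : mvec (Y k.+1).
    move=> i; rewrite (_ : (fun _ => _) =
      fun t => \int[leb]_(s in It t) F s (Y k s) i ord0); last first.
      by apply/funext => t; rewrite /Y /= mxE.
    apply: mint; apply: iF => // t Ht.
    by rewrite (le_trans (Yb t Ht))// bnd.
  have Yb1 t : I01 t -> `|Y k.+1 t| <= 2 * (1 - 2^-1 ^+ k.+1) * (B * W t).
    move=> Ht; rewrite -[Y k.+1 t](subrK (Y k t)).
    apply: (le_trans (ler_normD _ _)).
    apply: (le_trans (lerD (Yd t Ht) (Yb t Ht))).
    by rewrite exprS; set q := 2^-1 ^+ k; lra.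
  split => // t Ht; apply: mx_norm_le.
    by rewrite !mulr_ge0 ?W0// exprn_ge0 ?invr_ge0.
  move=> i j; rewrite [Y k.+2]/Y iterS -/(Y k.+1) [X in _ - X]/Y iterS -/(Y k) !mxE ord1.
  rewrite exprSr !mulrA -[leRHS]mulrA [2^-1 * _]mulrC.
  apply: cmp => //; first by rewrite mulr_ge0// exprn_ge0// invr_ge0.
  - by move=> s Hs; rewrite (le_trans (Yb1 s Hs))// bnd.
  - by move=> s Hs; rewrite (le_trans (Yb s Hs))// bnd.
have Yb k t : I01 t -> `|Y k t| <= 2 * B * W t.
  move=> Ht; have [_ Yb _] := YP k; apply: (le_trans (Yb t Ht)).
  rewrite -!mulrA ler_wpM2l// -[leRHS]mul1r.
  apply: ler_wpM2r; first by rewrite mulr_ge0 ?W0.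
  by rewrite gerBl exprn_ge0// invr_ge0.
have lim t i : exists l, I01 t -> forall k, `|l - Y k t i ord0| <= 2 * (B * W t) / 2 ^+ k.
  have [Ht|nHt] := pselect (I01 t); last by exists 0.
  have [k|l ll] := @geometric_limit (fun k => Y k t i ord0) (B * W t).
    have [_ _ /(_ t Ht) d] := YP k; rewrite mulrAC -exprVn.
    apply: le_trans d; apply: le_trans (mx_entry_le _ i ord0).
    by rewrite !mxE.
  by exists l.
pose y t : 'cV[R]_p := \col_i sval (cid (lim t i)).
have yY k t : I01 t -> `|y t - Y k t| <= 2 * B / 2 ^+ k * W t.
  move=> Ht; apply: mx_norm_le; first by rewrite !mulr_ge0 ?W0// invr_ge0 exprn_ge0.
  move=> i j; rewrite (ord1 j) !mxE; case: (cid (lim t i)) => l /= hl.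
  by apply: le_trans (hl Ht k) _; rewrite [leRHS]mulrAC mulrA.
have my : mvec y.
  move=> i; apply: (@measurable_fun_cvg _ _ _ _ (fun k t => Y k t i ord0)).
    by move=> k; have [mYk _ _] := YP k; exact: mYk.
  move=> t Ht; apply/cvgrPdist_le => e e0.
  have := @cvg_geometric R (2 * B * W t) 2^-1.
  rewrite ger0_norm ?invr_ge0// invf_lt1 ?ltr1n// => /(_ isT).
  move=> /cvgr0_norm_le /(_ _ e0); apply: filterS => k /=; apply: le_trans.
  have := yY k t Ht; rewrite mulrAC -exprVn => yk.
  apply: le_trans (ler_norm _); apply: le_trans yk.
  by apply: le_trans (mx_entry_le _ i ord0); rewrite !mxE.
have yb t : I01 t -> `|y t| <= 2 * B * W t.
  by move=> Ht; have := yY 0%N t Ht; rewrite /Y /= subr0 expr0 divr1.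
exists y; split => // t i Ht; apply/eqP; rewrite -subr_eq0; apply/eqP.
(* Both [y] and its image under the operator are compared with [Y k.+1], the image of [Y k]: the
   first by the rate of convergence, the second by the contraction. The constant 4 is generous. *)
apply: (@le_geometric_eq0 _ (4 * B * W t)) => k.
have mYk : mvec (Y k) by have [] := YP k.
have c0 : 0 <= 2 * B / 2 ^+ k by rewrite mulr_ge0 ?mulr_ge0// invr_ge0 exprn_ge0.
have h := cmp y (Y k) i _ t c0 Ht my mYk yb (Yb k) (yY k).
rewrite -[y t i ord0](subrK (Y k.+1 t i ord0)) -addrA.
apply: (le_trans (ler_normD _ _)).
have d : `|y t i ord0 - Y k.+1 t i ord0| <= 2 * B / 2 ^+ k.+1 * W t.
  apply: le_trans (yY k.+1 t Ht); apply: le_trans (mx_entry_le _ i ord0).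
  by rewrite !mxE.
apply: (le_trans (lerD d _)).
  rewrite [Y k.+1 t i ord0](_ : _ = \int[leb]_(s in It t) F s (Y k s) i ord0).
    by rewrite distrC; exact: h.
  by rewrite /Y iterS mxE.
rewrite exprS invfM; set q := (2 ^+ k)^-1.
have q0 : 0 <= q by rewrite invr_ge0 exprn_ge0.
have : 0 <= B * W t * q by rewrite !mulr_ge0 ?W0.
lra.
Qed.

End picard.

(** * Uniform estimates for the data on compact sets *)

Section smooth_data.
Context {R : realType} {n m : nat}.
Local Notation triple := (R * 'cV[R]_n * 'cV[R]_m)%type.

Definition dot {p} (a : 'rV[R]_p) (v : 'cV[R]_p) : R := (a *m v) ord0 ord0.

Lemma dotE p (a : 'rV[R]_p) v : dot a v = \sum_j a ord0 j * v j ord0.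
Proof. by rewrite /dot mxE. Qed.

Lemma dotDr p (a : 'rV[R]_p) v w : dot a (v + w) = dot a v + dot a w.
Proof. by rewrite /dot mulmxDr mxE. Qed.

Lemma dotDl p (a b : 'rV[R]_p) v : dot (a + b) v = dot a v + dot b v.
Proof. by rewrite /dot mulmxDl mxE. Qed.

Lemma dotBl p (a b : 'rV[R]_p) v : dot (a - b) v = dot a v - dot b v.
Proof. by rewrite /dot mulmxBl !mxE. Qed.

Lemma dotBr p (a : 'rV[R]_p) v w : dot a (v - w) = dot a v - dot a w.
Proof. by rewrite /dot mulmxBr !mxE. Qed.

Lemma dotZr p (a : 'rV[R]_p) (c : R) v : dot a (c *: v) = c * dot a v.
Proof. by rewrite /dot -scalemxAr mxE. Qed.

Lemma dotZl p (a : 'rV[R]_p) (c : R) v : dot (c *: a) v = c * dot a v.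
Proof. by rewrite /dot -scalemxAl mxE. Qed.

Lemma dot0r p (a : 'rV[R]_p) : dot a 0 = 0.
Proof. by rewrite /dot mulmx0 mxE. Qed.

Lemma dot_le p (a : 'rV[R]_p) v : `|dot a v| <= p%:R * `|a| * `|v|.
Proof.
rewrite dotE (le_trans (ler_norm_sum _ _ _))//.
apply: (@le_trans _ _ (\sum_(j < p) `|a| * `|v|)).
  by apply: ler_sum => j _; rewrite normrM ler_pM// mx_entry_le.
by rewrite sumr_const card_ord -[leLHS]mulr_natl mulrA.
Qed.

Definition box (r : R) : set triple :=
  [set q | [/\ I01 q.1.1, `|q.1.2| <= r & `|q.2| <= r]].

Lemma box_domain r : box r `<=` domain01.
Proof. by move=> q []. Qed.

(** Compactness of closed bounded sets is applied to row vectors and carried over by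
    transposition. *)
Lemma cV_ball_compact p r : compact [set v : 'cV[R]_p | `|v| <= r].
Proof.
have ct : continuous (@trmx R 1 p).
  move=> v A /nbhs_ballP[e e0 eA]; apply/nbhs_ballP; exists e => // w vw.
  by apply: eA; case: vw => _ vw; split=> // i j; rewrite !mxE.
have -> : [set v : 'cV[R]_p | `|v| <= r] =
    (@trmx R 1 p) @` [set v : 'rV[R]_p | `|v| <= r].
  have trn q (v : 'M[R]_(q, p)) : `|v^T| <= `|v|.
    by apply: mx_norm_le => // i j; rewrite mxE mx_entry_le.
  have trn' q (v : 'M[R]_(p, q)) : `|v^T| <= `|v|.
    by apply: mx_norm_le => // i j; rewrite mxE mx_entry_le.
  apply/seteqP; split => [v /= vr|_ [v /= vr <-]].
    by exists v^T; rewrite /= ?trmxK// (le_trans (trn' _ _)).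
  exact: le_trans (trn _ _) vr.
apply: continuous_compact; first exact: continuous_subspaceT.
apply: bounded_closed_compact.
  exists r; split; first exact: num_real.
  by move=> x rx v /= vr; exact: le_trans vr (ltW rx).
have -> : [set v : 'rV[R]_p | `|v| <= r] = (fun v => `|v|) @^-1` [set x | x <= r] by [].
apply: closed_comp; last exact: closed_le.
by move=> v _; exact: norm_continuous.
Unshelve. all: by end_near. Qed.

Lemma box_compact r : compact (box r).
Proof.
have -> : box r = ((I01 `*` [set v : 'cV[R]_n | `|v| <= r]) `*`
    [set v : 'cV[R]_m | `|v| <= r]).
  by apply/seteqP; split => [q [? ? ?]|q [[? ?] ?]].
apply: compact_setX; last exact: cV_ball_compact.
apply: compact_setX; last exact: cV_ball_compact.
by rewrite I01E; exact: segment_compact.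
Qed.

Lemma box_bounded (V : normedModType R) (k : triple -> V) r :
  {within domain01, continuous k} ->
  exists2 M, 0 <= M & forall q, box r q -> `|k q| <= M.
Proof.
move=> ck.
have cb : {within box r, continuous k}.
  exact: continuous_subspaceW (@box_domain r) ck.
have /compact_bounded[M [_ hM]] := continuous_compact cb (@box_compact r).
exists (`|M| + 1) => [|q qr]; first by rewrite addr_ge0.
by apply: hM; [rewrite (le_lt_trans (ler_norm _))// ltrDl | exists q].
Qed.

(** Only the base point has to lie in the box; the perturbed point may leave it, since continuity
    holds on all of [domain01]. The near-covering form of compactness, with the perturbation size
    tending to 0 from the right, turns the local radii into a uniform one. *)
Lemma box_unif (V : normedModType R) (k : triple -> V) r e :
  {within domain01, continuous k} -> 0 < e ->
  exists2 d, 0 < d & forall t x u x' u', I01 t -> `|x| <= r -> `|u| <= r ->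
    `|x'| <= d -> `|u'| <= d ->
    `|k (t, x + x', u + u') - k (t, x, u)| <= e.
Proof.
move=> ck e0.
have /compact_near_coveringP/near_covering_withinP := @box_compact r.
move=> /(_ _ (0^'+)%R (fun d q => forall x' u', `|x'| <= d -> `|u'| <= d ->
  `|k (q.1.1, q.1.2 + x', q.2 + u') - k q| <= e)).
case.
  move=> q0 bq0; have /subspace_continuousP/(_ _ (box_domain bq0)) := ck.
  move=> /cvgrPdist_le /(_ (e / 2)); rewrite divr_gt0// => /(_ isT).
  move=> /nbhs_ballP[d /= d0 hd].
  exists (ball q0 (d / 2), [set x | 0 < x < d / 2]).
    split; first by apply: nbhsx_ballx; rewrite divr_gt0.
    near=> x => /=; apply/andP; split; first by near: x; exact: nbhs_right_gt.
    by near: x; apply: nbhs_right_lt; rewrite divr_gt0.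
  move=> [q x] /= [bq /andP[x0 xd]] qr x' u' x'd u'd.
  have dd : d / 2 <= d by rewrite ler_pdivrMr// ler_peMr ?ler1n// ltW.
  have h1 : `|k q0 - k q| <= e / 2.
    apply: hd; last exact: box_domain qr.
    exact: le_ball bq.
  have h2 : `|k q0 - k (q.1.1, q.1.2 + x', q.2 + u')| <= e / 2.
    apply: hd; last by case: qr.
    case: bq => [[b1 b2] b3]; split; first split => /=.
    - exact: le_ball b1.
    - rewrite (splitr d); apply: ball_triangle b2 _.
      rewrite -ball_normE /ball_ /= opprD addNKr normrN.
      exact: le_lt_trans xd.
    - rewrite (splitr d); apply: ball_triangle b3 _.
      rewrite -ball_normE /ball_ /= opprD addNKr normrN.
      exact: le_lt_trans xd.
  rewrite [e]splitr (le_trans _ (lerD h2 h1))// [X in _ <= X + _]distrC.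
  by rewrite (le_trans _ (ler_normD _ _))// addrA subrK.
move=> d /= d0 hd; exists (d / 2); first by rewrite divr_gt0.
move=> t x u x' u' It xr ur x'd u'd.
apply: (hd (d / 2) _ _ (t, x, u)) => //=.
- by rewrite sub0r normrN ger0_norm ?divr_ge0 ?ltW// ltr_pdivrMr// ltr_pMr// ltr1n.
- by rewrite divr_gt0.
Unshelve. all: by end_near. Qed.

End smooth_data.

Section calculus.
Context {R : realType} {n m : nat}.
Local Notation triple := (R * 'cV[R]_n * 'cV[R]_m)%type.
Implicit Types (h : R -> 'cV[R]_n -> 'cV[R]_m -> R).

Lemma cV_sum_delta p (v : 'cV[R]_p) : v = \sum_j v j ord0 *: delta_mx j ord0.
Proof.
by rewrite {1}[v]matrix_sum_delta; apply: eq_bigr => i _; rewrite big_ord1.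
Qed.

(** A directional derivative depends only on the restriction to a line; this identifies partial
    derivatives with directional derivatives of the joint map. *)
Lemma eq_derive_line (V1 V2 W : normedModType R) (f1 : V1 -> W) (f2 : V2 -> W)
    a1 v1 a2 v2 :
  (forall s : R, f1 (s *: v1 + a1) = f2 (s *: v2 + a2)) ->
  'D_v1 f1 a1 = 'D_v2 f2 a2.
Proof.
move=> f12; have f0 : f1 a1 = f2 a2 by have := f12 0; rewrite !scale0r !add0r.
have e : (fun s : R => s^-1 *: ((f1 \o shift a1) (s *: v1) - f1 a1)) =
    (fun s : R => s^-1 *: ((f2 \o shift a2) (s *: v2) - f2 a2)).
  by apply/funext => s /=; rewrite f12 f0.
by rewrite /derive e.
Qed.

Lemma derive_joint h t x u y w : C1_data h -> I01 t ->
  'D_(y, w) (fun q : 'cV[R]_n * 'cV[R]_m => h t q.1 q.2) (x, u) =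
  dot (grad_x h t x u) y + dot (grad_u h t x u) w.
Proof.
move=> [_ dh _ _] It; set H := (fun q => _); have dH := dh t x u It.
rewrite (deriveE _ dH).
have -> : (y, w) = \sum_j y j ord0 *: (delta_mx j ord0, 0 : 'cV[R]_m) +
    \sum_j w j ord0 *: (0 : 'cV[R]_n, delta_mx j ord0).
  have sum1 (I : Type) (s : seq I) (F : I -> 'cV[R]_n * 'cV[R]_m) :
      \sum_(i <- s) F i = (\sum_(i <- s) (F i).1, \sum_(i <- s) (F i).2).
    by elim/big_rec3: _ => [|i a b c _ ->] //; case: (F i).
  rewrite !sum1 /= -!cV_sum_delta.
  rewrite !big1 ?scaler0; last 2 first.
    by move=> i _; rewrite scaler0.
    by move=> i _; rewrite scaler0.
  by congr pair; rewrite ?addr0 ?add0r.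
rewrite linearD !linear_sum /=; congr (_ + _); rewrite dotE.
  apply: eq_bigr => j _; rewrite linearZ /= -deriveE// mulrC mxE.
  by congr (_ * _); apply: eq_derive_line => s /=; rewrite scaler0 add0r.
apply: eq_bigr => j _; rewrite linearZ /= -deriveE// mulrC mxE.
by congr (_ * _); apply: eq_derive_line => s /=; rewrite scaler0 add0r.
Qed.

(** The scalar mean value theorem on the segment of parameter [c]; both gradients are taken at the
    same intermediate point. *)
Lemma mean_value h t x u y w : C1_data h -> I01 t ->
  exists2 c, 0 <= c <= 1 & h t (x + y) (u + w) - h t x u =
    dot (grad_x h t (x + c *: y) (u + c *: w)) y +
    dot (grad_u h t (x + c *: y) (u + c *: w)) w.
Proof.
move=> hC It; pose H := fun q : 'cV[R]_n * 'cV[R]_m => h t q.1 q.2.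
pose phi c := h t (x + c *: y) (u + c *: w).
have dphi (c : R) : is_derive c 1 phi (dot (grad_x h t (x + c *: y) (u + c *: w)) y +
    dot (grad_u h t (x + c *: y) (u + c *: w)) w).
  rewrite -derive_joint//.
  have dH : differentiable H (x + c *: y, u + c *: w) by case: hC => _ dh _ _; exact: dh.
  have /(@derivableP _ _ _ _ _ _)[dd _] := @diff_derivable _ _ _ H _ (y, w) dH.
  have e : (fun s : R => s^-1 *: ((phi \o shift c) (s *: (1 : R)) - phi c)) =
      (fun s : R => s^-1 *: ((H \o shift (x + c *: y, u + c *: w)) (s *: (y, w)) -
        H (x + c *: y, u + c *: w))).
    apply/funext => s; congr (_ *: (_ - _)).
    rewrite /phi /H /= [s *: 1]mulr1 !scalerDl.
    by congr (h t _ _); rewrite addrCA.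
  by split; rewrite /derivable /derive e.
have [|c] := @MVT_segment R phi _ 0 1 ler01 (fun c _ => dphi c).
  by apply: derivable_within_continuous => c _; have [] := dphi c.
rewrite in_itv /= => c01; rewrite /phi !scale1r !scale0r !addr0 subr0 mulr1 => ->.
by exists c.
Qed.

Lemma box_lipschitz h r : C1_data h ->
  exists2 M, 0 <= M & forall t x u x' u', I01 t ->
    `|x| <= r -> `|u| <= r -> `|x'| <= r -> `|u'| <= r ->
    `|h t x' u' - h t x u| <= M * (`|x' - x| + `|u' - u|).
Proof.
move=> hC; have [_ _ cx cu] := hC.
have [Mx Mx0 hx] := box_bounded r cx.
have [Mu Mu0 hu] := box_bounded r cu.
exists (n%:R * Mx + m%:R * Mu); first by rewrite addr_ge0 ?mulr_ge0.
move=> t x u x' u' It xr ur x'r u'r.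
have [c /andP[c0 c1]] := mean_value x u (x' - x) (u' - u) hC It.
have seg p (a b : 'cV[R]_p) : `|a| <= r -> `|b| <= r -> `|a + c *: (b - a)| <= r.
  move=> ar br; rewrite scalerBr addrCA addrC -[X in X - _ + _]scale1r -scalerBl.
  rewrite (le_trans (ler_normD _ _))// !normrZ !ger0_norm ?subr_ge0//.
  have -> : r = (1 - c) * r + c * r by rewrite mulrBl mul1r subrK.
  by rewrite lerD// ler_wpM2l// subr_ge0.
have bq : box r (t, x + c *: (x' - x), u + c *: (u' - u)).
  by split => //=; exact: seg.
rewrite !subrKC => ->; rewrite (le_trans (ler_normD _ _))//.
rewrite mulrDl !mulrDr; have := hx _ bq; have := hu _ bq; rewrite /= => gu gx.
apply: lerD.
  rewrite (le_trans (dot_le _ _))// ler_wpDr ?mulr_ge0//.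
  by rewrite ler_wpM2r// ler_wpM2l.
rewrite (le_trans (dot_le _ _))// ler_wpDl ?mulr_ge0//.
by rewrite ler_wpM2r// ler_wpM2l.
Qed.

Lemma box_taylor h r e : C1_data h -> 0 < e ->
  exists2 d, 0 < d & forall t x u y w, I01 t ->
    `|x| <= r -> `|u| <= r -> `|y| <= d -> `|w| <= d ->
    `|h t (x + y) (u + w) - h t x u -
      (dot (grad_x h t x u) y + dot (grad_u h t x u) w)| <= e * (`|y| + `|w|).
Proof.
move=> hC e0; have [_ _ cx cu] := hC.
(* The denominator compensates the dimension factors [n] and [m] that [dot_le] produces for the sup
   norm; the added 1 keeps it positive in dimension 0. *)
pose e' := e / (n%:R + m%:R + 1).
have nm0 : 0 < n%:R + m%:R + 1 :> R by rewrite ltr_wpDl// addr_ge0.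
have e'0 : 0 < e' by rewrite divr_gt0.
have [dx dx0 hx] := box_unif r cx e'0.
have [du du0 hu] := box_unif r cu e'0.
exists (Num.min dx du); first by rewrite lt_min dx0.
move=> t x u y w It xr ur; rewrite !le_min => /andP[ydx ydu] /andP[wdx wdu].
have [c /andP[c0 c1] ->] := mean_value x u y w hC It.
have sc p (v : 'cV[R]_p) d : `|v| <= d -> `|c *: v| <= d.
  by move=> vd; rewrite normrZ ger0_norm// (le_trans _ vd)// ler_piMl.
rewrite opprD addrACA -!dotBl (le_trans (ler_normD _ _))// mulrDr.
have ne : n%:R * e' <= e.
  by rewrite /e' mulrCA ler_piMr ?(ltW e0)// ler_pdivrMr// mul1r -addrA lerDl addr_ge0.
have me : m%:R * e' <= e.
  by rewrite /e' mulrCA ler_piMr ?(ltW e0)// ler_pdivrMr// mul1r addrAC lerDr addr_ge0.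
apply: lerD; apply: (le_trans (dot_le _ _)); rewrite ler_wpM2r//.
  by apply: le_trans ne; rewrite ler_wpM2l//; apply: hx => //; exact: sc.
by apply: le_trans me; rewrite ler_wpM2l//; apply: hu => //; exact: sc.
Qed.

Definition grid p (k : nat) (a : 'cV[int]_p) : 'cV[R]_p :=
  \col_i ((a i ord0)%:~R / k.+1%:R).

Definition cfloor p (k : nat) (v : 'cV[R]_p) : 'cV[int]_p :=
  \col_i Num.floor (k.+1%:R * v i ord0).

Lemma grid_floor p k (v : 'cV[R]_p) : `|v - grid k (cfloor k v)| <= k.+1%:R^-1.
Proof.
apply: mx_norm_le; first by rewrite invr_ge0.
move=> i j; rewrite !mxE (ord1 j).
have k0 : 0 < k.+1%:R :> R by [].
have := floor_itv (k.+1%:R * v i ord0); rewrite intrD => /andP[f1 f2].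
have fl : (Num.floor (k.+1%:R * v i ord0))%:~R / k.+1%:R <= v i ord0.
  by rewrite ler_pdivrMr// [leRHS]mulrC.
rewrite ger0_norm ?subr_ge0// -[X in X - _](mulfK (lt0r_neq0 k0)) -mulrBl.
by rewrite ler_pdivrMr// mulVf ?gt_eqF// lerBlDl [leLHS]mulrC ltW.
Qed.

Lemma measurable_cfloor p k (v : R -> 'cV[R]_p) (a : 'cV[int]_p) : mvec v ->
  measurable (I01 `&` [set t | cfloor k (v t) = a] : set (measurableTypeR R)).
Proof.
move=> mv; have -> : I01 `&` [set t | cfloor k (v t) = a] =
    I01 `&` \bigcap_(i in [set: 'I_p])
      (I01 `&` (fun t => (Num.floor (k.+1%:R * v t i ord0))%:~R) @^-1`
        [set ((a i ord0)%:~R : R)]).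
  apply/seteqP; split => t [It /= ta]; split => //.
    by move=> i _; split => //=; rewrite -ta mxE.
  by apply/colP => i; rewrite mxE; have [_ /= /intr_inj] := ta i I.
apply: measurableI => //; apply: fin_bigcap_measurable => //.
move=> i _; have mf : measurable_fun setT (fun s : R => (Num.floor s)%:~R : R).
  by apply: nondecreasing_measurable => // x y xy; rewrite ler_int le_floor.
have : measurable_fun I01 (fun t => (Num.floor (k.+1%:R * v t i ord0))%:~R : R).
  by apply: (measurableT_comp mf); apply: measurable_funM.
by move=> mfl; exact: (mfl measurable_I01 _ (measurable_set1 _)).
Qed.

(** Rounding [x] and [u] to a grid makes them countably valued. *)
Lemma measurable_along (k : triple -> R) (x : R -> 'cV[R]_n) (u : R -> 'cV[R]_m) :
  {within domain01, continuous k} -> mvec x -> mvec u ->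
  measurable_fun I01 (fun t => k (t, x t, u t)).
Proof.
move=> ck mx mu.
apply: (@measurable_fun_cvg _ _ _ _
  (fun j t => k (t, grid j (cfloor j (x t)), grid j (cfloor j (u t))))).
  move=> j _ B mB.
  pose S (ab : 'cV[int]_n * 'cV[int]_m) : set (measurableTypeR R) :=
    ((I01 `&` [set t | cfloor j (x t) = ab.1]) `&`
     (I01 `&` [set t | cfloor j (u t) = ab.2])) `&`
    (I01 `&` (fun t => k (t, grid j ab.1, grid j ab.2)) @^-1` B).
  rewrite (_ : _ `&` _ = \bigcup_ab S ab); last first.
    apply/seteqP; split => [t [It Bt]|t [[a b] _ [[[It /= <-] [_ /= <-]] [_ Bt]]]].
      by exists (cfloor j (x t), cfloor j (u t)).
    by split.
  apply: countable_bigcupT_measurable; first exact: countableP.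
  move=> [a b]; apply: measurableI.
    by apply: measurableI; exact: measurable_cfloor.
  have : measurable_fun I01 (fun t => k (t, grid j a, grid j b)); last first.
    by move=> mk; exact: (mk measurable_I01 B mB).
  apply: within_continuous_measurable; apply/subspace_continuousP => t It.
  have /subspace_continuousP/(_ (t, grid j a, grid j b) It) := ck.
  move=> /cvgrPdist_le hk; apply/cvgrPdist_le => e e0.
  have /nbhs_ballP[d /= d0 hd] := hk e e0.
  apply/nbhs_ballP; exists d => // s ts Is; apply: hd => //=.
  by split; [split => //=; exact: ballxx|exact: ballxx].
move=> t It; have /subspace_continuousP/(_ (t, x t, u t) It) := ck.
move=> /cvgrPdist_le hk; apply/cvgrPdist_le => e e0.
have /nbhs_ballP[d /= d0 hd] := hk e e0.
have [j0 _ hj0] : \forall j \near \oo, (j.+1%:R^-1 : R) < d.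
  near=> j; rewrite invf_plt ?posrE//.
  rewrite -natr1 ltr_pwDr//; near: j; exact: nbhs_infty_ger.
exists j0 => // j /hj0 /= jd; apply: hd => //=; split; first split => /=.
- exact: ballxx.
- by rewrite -ball_normE /ball_ /= (le_lt_trans (grid_floor _ _)).
- by rewrite -ball_normE /ball_ /= (le_lt_trans (grid_floor _ _)).
Unshelve. all: by end_near. Qed.

End calculus.

(** * The costate *)

Section measurable_matrices.
Context {R : realType}.

Definition mmx {p q} (A : R -> 'M[R]_(p, q)) :=
  forall i j, measurable_fun I01 (fun t => A t i j).

Lemma mmx_mvec p (y : R -> 'cV[R]_p) : mmx y <-> mvec y.
Proof. by split => [my i|my i j]; [exact: my|rewrite (ord1 j); exact: my]. Qed.

Lemma mmxT p q (A : R -> 'M[R]_(p, q)) : mmx A -> mmx (fun t => (A t)^T).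
Proof. by move=> mA i j; under eq_fun do rewrite mxE; exact: mA. Qed.

Lemma mmxD p q (A B : R -> 'M[R]_(p, q)) :
  mmx A -> mmx B -> mmx (fun t => A t + B t).
Proof.
by move=> mA mB i j; under eq_fun do rewrite mxE; exact: measurable_funD.
Qed.

Lemma mmxZ p q (c : R -> R) (A : R -> 'M[R]_(p, q)) :
  measurable_fun I01 c -> mmx A -> mmx (fun t => c t *: A t).
Proof.
by move=> mc mA i j; under eq_fun do rewrite mxE; exact: measurable_funM.
Qed.

Lemma mmxN p q (A : R -> 'M[R]_(p, q)) : mmx A -> mmx (fun t => - A t).
Proof.
by move=> mA i j; under eq_fun do rewrite mxE; apply: measurableT_comp.
Qed.

Lemma mmxM p q s (A : R -> 'M[R]_(p, q)) (B : R -> 'M[R]_(q, s)) :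
  mmx A -> mmx B -> mmx (fun t => A t *m B t).
Proof.
move=> mA mB i j; under eq_fun do rewrite mxE.
by apply: measurable_sum => k; exact: measurable_funM.
Qed.

Lemma mdot p (A : R -> 'rV[R]_p) (v : R -> 'cV[R]_p) :
  mmx A -> mmx v -> measurable_fun I01 (fun t => dot (A t) (v t)).
Proof. by move=> mA mv; exact: mmxM. Qed.

Lemma mulmx_norm_le p q s (A : 'M[R]_(p, q)) (B : 'M[R]_(q, s)) :
  `|A *m B| <= q%:R * `|A| * `|B|.
Proof.
apply: mx_norm_le; first by rewrite !mulr_ge0.
move=> i j; rewrite mxE (le_trans (ler_norm_sum _ _ _))//.
apply: (@le_trans _ _ (\sum_(k < q) `|A| * `|B|)).
  by apply: ler_sum => k _; rewrite normrM ler_pM// mx_entry_le.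
by rewrite sumr_const card_ord -[leLHS]mulr_natl mulrA.
Qed.

Lemma mx_normT p q (A : 'M[R]_(p, q)) : `|A^T| = `|A|.
Proof.
have le a b (B : 'M[R]_(a, b)) : `|B^T| <= `|B|.
  by apply: mx_norm_le => // i j; rewrite mxE mx_entry_le.
by apply/eqP; rewrite eq_le le /= -{1}[A]trmxK le.
Qed.

End measurable_matrices.

Section adjoint.
Context {R : realType} {n m : nat}.
Variables (fx : R -> 'M[R]_n) (fu : R -> 'M[R]_(n, m)).
Variables (Lx gx : R -> 'rV[R]_n) (Lu gu : R -> 'rV[R]_m) (kap : R -> R).

(** The transposed gradient in [u] of the Hamiltonian [<v, f> + L], without the constraint term. *)
Definition switching s (v : 'cV[R]_n) : 'cV[R]_m := (fu s)^T *m v + (Lu s)^T.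

(** The value of [z] forced by stationarity on the active set, once [kap] is
    the indicator of that set divided by [|gu|^2]. *)
Definition zmult s (v : 'cV[R]_n) : R := - (kap s * dot (gu s) (switching s v)).

(** The adjoint density for [lam0 = 1] after elimination of [z]. It is affine in [v], with slope
    controlled by [1 + kap * |gu|]. *)
Definition costate_rhs s (v : 'cV[R]_n) : 'cV[R]_n :=
  (fx s)^T *m v + (Lx s)^T + zmult s v *: (gx s)^T.

Lemma mmx_switching (y : R -> 'cV[R]_n) : mmx fu -> mmx Lu -> mmx y ->
  mmx (fun s => switching s (y s)).
Proof. by move=> *; apply: mmxD; [apply: mmxM => //|]; exact: mmxT. Qed.

Lemma measurable_zmult (y : R -> 'cV[R]_n) : mmx fu -> mmx Lu -> mmx gu ->
  measurable_fun I01 kap -> mmx y ->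
  measurable_fun I01 (fun s => zmult s (y s)).
Proof.
move=> *; apply: measurableT_comp => //; apply: measurable_funM => //.
by apply: mdot => //; exact: mmx_switching.
Qed.

(** The unknown enters [zmult] only through [kap * gu], so it is [kap * |gu|], of order [1 / |gu|],
    that needs an integrable bound [b], and not [kap], of order [1 / |gu|^2]. *)
Lemma costate_exists (b : R -> R) (M : R) :
  mmx fx -> mmx fu -> mmx Lx -> mmx gx -> mmx Lu -> mmx gu ->
  measurable_fun I01 kap -> (forall s, 0 <= kap s) -> L1 b -> 0 <= M ->
  (forall s, I01 s -> `|fx s| <= M /\ `|fu s| <= M) ->
  (forall s, I01 s -> `|Lx s| <= M /\ `|gx s| <= M) ->
  (forall s, I01 s -> `|Lu s| <= M) ->
  (forall s, I01 s -> kap s * `|gu s| <= b s) ->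
  exists (lam : R -> 'cV[R]_n) (Lam : R),
    [/\ mmx lam, forall t, I01 t -> `|lam t| <= Lam,
        forall i, L1 (fun s => costate_rhs s (lam s) i ord0),
        L1 (fun s => zmult s (lam s)) &
        forall t i, I01 t -> lam t i ord0 =
          \int[leb]_(s in `[t, 1]) costate_rhs s (lam s) i ord0].
Proof.
move=> mfx mfu mLx mgx mLu mgu mk k0 ib M0 fxM LxM LuM kb.
(* The factors [1 + n] in place of [n] make the same [a] dominate both the Lipschitz constant in [v]
   and the inhomogeneous term at [v = 0], so that the Volterra theorem applies with [B = 1]. *)
pose a s := (1 + n%:R) * M + (1 + n%:R) * m%:R * M ^+ 2 * b s.
have b0 s : I01 s -> 0 <= b s.
  by move=> Is; rewrite (le_trans _ (kb s Is))// mulr_ge0.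
have ia : L1 a by apply: L1D; [exact: L1_cst|exact: L1Z].
have a0 s : I01 s -> 0 <= a s.
  by move=> Is; rewrite addr_ge0 ?mulr_ge0 ?exprn_ge0 ?b0 ?addr_ge0.
have [W [Wm [mW bW aW]]] := backward_weight ia a0.
have zb s v c : I01 s -> 0 <= c -> `|v| <= c ->
    `|kap s * dot (gu s) v| <= m%:R * c * b s.
  move=> Is c0 vc; rewrite normrM (ger0_norm (k0 s)).
  apply: (@le_trans _ _ (kap s * (m%:R * `|gu s| * c))).
    rewrite ler_wpM2l//; apply: le_trans (dot_le _ _) _.
    by rewrite ler_wpM2l// mulr_ge0.
  rewrite [leRHS]mulrC (_ : _ * _ = kap s * `|gu s| * (m%:R * c)); last by ring.
  by rewrite ler_wpM2r ?kb// mulr_ge0.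
have mP y : mmx y -> mmx (fun s => costate_rhs s (y s)).
  move=> my; apply: mmxD; first apply: mmxD.
  - by apply: mmxM => //; exact: mmxT.
  - exact: mmxT.
  - by apply: mmxZ; [exact: measurable_zmult|exact: mmxT].
have lipP s v w : I01 s ->
    `|costate_rhs s v - costate_rhs s w| <= a s * `|v - w|.
  move=> Is; have [fxs fus] := fxM s Is; have [Lxs gxs] := LxM s Is.
  have -> : costate_rhs s v - costate_rhs s w =
      (fx s)^T *m (v - w) -
      (kap s * dot (gu s) ((fu s)^T *m (v - w))) *: (gx s)^T.
    have sub3 (V : zmodType) (x y x' z z' : V) :
        x + y + z - (x' + y + z') = (x - x') + (z - z').
      by rewrite opprD addrACA; congr (_ + _); rewrite opprD addrACA subrr addr0.
    rewrite /costate_rhs sub3 -mulmxBr -scalerBl; congr (_ + _).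
    rewrite -scaleNr; congr (_ *: _); rewrite /zmult /switching !dotDr mulmxBr dotBr.
    ring.
  rewrite (le_trans (ler_normB _ _))// normrZ !mx_normT mulrDl.
  apply: lerD.
    rewrite (le_trans (mulmx_norm_le _ _))// ler_wpM2r// mx_normT.
    by apply: ler_pM => //; rewrite lerDr.
  rewrite [leRHS](_ : _ = (m%:R * ((1 + n%:R) * M * `|v - w|) * b s) * M); last by ring.
  apply: ler_pM => //; apply: zb => //; first by rewrite !mulr_ge0 ?addr_ge0.
  rewrite (le_trans (mulmx_norm_le _ _))// ler_wpM2r// mx_normT.
  by apply: ler_pM => //; rewrite lerDr.
have P0 s : I01 s -> `|costate_rhs s 0| <= a s * 1.
  move=> Is; have [fxs fus] := fxM s Is; have [Lxs gxs] := LxM s Is.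
  rewrite mulr1 /costate_rhs mulmx0 add0r /zmult /switching mulmx0 add0r scaleNr.
  rewrite (le_trans (ler_normB _ _))// normrZ !mx_normT.
  apply: lerD; first by rewrite (le_trans Lxs)// ler_peMl// lerDl.
  apply: (@le_trans _ _ (m%:R * M * b s * M)).
    by apply: ler_pM => //; apply: zb => //; rewrite mx_normT LuM.
  rewrite (_ : _ * _ * _ * _ = m%:R * M ^+ 2 * b s); last by ring.
  rewrite -!mulrA ler_peMl// ?lerDl// !mulr_ge0 ?exprn_ge0 ?b0//.
(* Integrating over [[t, 1]] builds in the terminal condition. *)
have [lam [mlam lamb lamE]] := @volterra_equation R n (fun t => `[t, 1]%classic)
    costate_rhs a W 1 Wm (fun _ _ => measurable_itv _) (fun t => @subI01r R t)
    (fun h ih => within_continuous_measurable (continuous_L1_tail ih))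
    ia a0 mW bW aW
    (fun y my => (mmx_mvec _).1 (mP y ((mmx_mvec _).2 my))) lipP ler01 P0.
have {}mlam : mmx lam by exact/mmx_mvec.
have Lb t : I01 t -> `|lam t| <= 2 * 1 * Wm.
  move=> It; rewrite (le_trans (lamb t It))// ler_wpM2l ?mulr_ge0//.
  by have /andP[] := bW t It.
exists lam, (2 * 1 * Wm); split => //.
- move=> i; apply: (@L1_le _ _ (fun s => (1 + 2 * 1 * Wm) * a s)).
  + exact: mP.
  + exact: L1Z.
  + move=> s Is; rewrite (le_trans (mx_entry_le _ _ _))//.
    rewrite -[costate_rhs s _](subrK (costate_rhs s 0)) (le_trans (ler_normD _ _))//.
    have h1 := lipP s (lam s) 0 Is; rewrite subr0 in h1.
    apply: le_trans (lerD h1 (P0 s Is)) _.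
    by rewrite -mulrDr [leLHS]mulrC ler_wpM2r ?a0// [leLHS]addrC lerD2l Lb.
- set c := n%:R * M * (2 * 1 * Wm) + M.
  apply: (@L1_le _ _ (fun s => m%:R * c * b s)).
  + exact: measurable_zmult.
  + exact: L1Z.
  + move=> s Is; have [fxs fus] := fxM s Is; have L0 := le_trans (normr_ge0 _) (Lb s Is).
    rewrite normrN; apply: zb => //; first by rewrite /c addr_ge0// mulr_ge0// mulr_ge0.
    rewrite (le_trans (ler_normD _ _))// mx_normT lerD ?LuM//.
    rewrite (le_trans (mulmx_norm_le _ _))// ler_pM ?mulr_ge0// ?Lb//.
    by rewrite ler_wpM2l// mx_normT.
Qed.

End adjoint.

(** * Perturbed trajectories and the first variation *)

Section vector_estimates.
Context {R : realType}.

Lemma finite_uniform_upper p (P : 'I_p -> R -> Prop) :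
  (forall i, exists2 M, 0 <= M & P i M) ->
  (forall i M M', P i M -> M <= M' -> P i M') ->
  exists2 M, 0 <= M & forall i, P i M.
Proof.
move=> h mono; have /choice[M hM] : forall i, exists M, 0 <= M /\ P i M.
  by move=> i; have [M] := h i; exists M.
exists (\sum_i M i); first by apply: sumr_ge0 => i _; have [] := hM i.
move=> i; have [Mi PMi] := hM i; apply: mono PMi _.
by rewrite (bigD1 i)//= lerDl sumr_ge0// => j _; have [] := hM j.
Qed.

(** The inverse of [1 + \sum_i (d i)^-1] is a positive number below every [d i], and it makes sense
    for an empty family too. *)
Lemma finite_uniform_lower p (P : 'I_p -> R -> Prop) :
  (forall i, exists2 d, 0 < d & P i d) ->
  (forall i d d', P i d -> 0 < d' -> d' <= d -> P i d') ->
  exists2 d, 0 < d & forall i, P i d.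
Proof.
move=> h mono; have /choice[d hd] : forall i, exists d, 0 < d /\ P i d.
  by move=> i; have [d] := h i; exists d.
have S0 : 0 <= \sum_i (d i)^-1.
  by apply: sumr_ge0 => i _; have [di _] := hd i; rewrite invr_ge0 ltW.
have S1 : 0 < 1 + \sum_i (d i)^-1 by rewrite ltr_wpDr.
exists (1 + \sum_i (d i)^-1)^-1; first by rewrite invr_gt0.
move=> i; have [di Pdi] := hd i; apply: mono Pdi _ _; first by rewrite invr_gt0.
rewrite -[leRHS]invrK lef_pV2 ?posrE ?invr_gt0// (bigD1 i)//= addrCA lerDl.
by rewrite addr_ge0// sumr_ge0// => j _; have [dj _] := hd j; rewrite invr_ge0 ltW.
Qed.

Context {n m p : nat}.
Variable (F : R -> 'cV[R]_n -> 'cV[R]_m -> 'cV[R]_p).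
Hypothesis hF : forall i, C1_data (fun t x u => F t x u i ord0).

Lemma box_lipschitz_vec r :
  exists2 M, 0 <= M & forall t x u x' u', I01 t ->
    `|x| <= r -> `|u| <= r -> `|x'| <= r -> `|u'| <= r ->
    `|F t x' u' - F t x u| <= M * (`|x' - x| + `|u' - u|).
Proof.
have [i M M' hM MM' t x u x' u' It *|M M0 hM] :=
  finite_uniform_upper (fun i => box_lipschitz r (hF i)).
  by rewrite (le_trans (hM _ _ _ _ _ It _ _ _ _))// ler_wpM2r// addr_ge0.
exists M => // t x u x' u' It *.
apply: mx_norm_le => [|i j]; first by rewrite mulr_ge0// addr_ge0.
by rewrite (ord1 j) 2!mxE; exact: hM.
Qed.

Lemma mmx_along (x : R -> 'cV[R]_n) (u : R -> 'cV[R]_m) :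
  mmx x -> mmx u -> mmx (fun t => F t (x t) (u t)).
Proof.
move=> mx mu i j; rewrite (ord1 j); have [ch _ _ _] := hF i.
exact: (measurable_along ch ((mmx_mvec _).1 mx) ((mmx_mvec _).1 mu)).
Qed.

End vector_estimates.

Lemma box_taylor_vec {R : realType} {n m : nat}
    (F : R -> 'cV[R]_n -> 'cV[R]_m -> 'cV[R]_n)
    (hF : forall i, C1_data (fun t x u => F t x u i ord0)) r e : 0 < e ->
  exists2 d, 0 < d & forall t x u y w, I01 t ->
    `|x| <= r -> `|u| <= r -> `|y| <= d -> `|w| <= d ->
    `|F t (x + y) (u + w) - F t x u - (jac_x F t x u *m y + jac_u F t x u *m w)|
      <= e * (`|y| + `|w|).
Proof.
move=> e0.
have [i d d' hd d'0 dd' t x u y w It xr ur yd wd|d d0 hd] :=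
  finite_uniform_lower (fun i => box_taylor r (hF i) e0).
  by apply: hd => //; [exact: le_trans yd dd'|exact: le_trans wd dd'].
exists d => // t x u y w It xr ur yd wd.
apply: mx_norm_le => [|i j]; first by rewrite mulr_ge0 ?addr_ge0// ltW.
rewrite (ord1 j); have := hd i t x u y w It xr ur yd wd.
congr (_ <= _); congr (`| _ |); rewrite !mxE !dotE.
by congr (_ - (_ + _)); apply: eq_bigr => k _; rewrite !mxE.
Qed.

Lemma maxr_lipschitz {R : realDomainType} (c x y : R) :
  `|Num.max c x - Num.max c y| <= `|x - y|.
Proof.
by have [xy|xy] := ler0P (x - y); rewrite ler_norml; case: (leP c x);
  case: (leP c y) => *; apply/andP; split; lra.
Qed.

Lemma minr_lipschitz {R : realDomainType} (c x y : R) :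
  `|Num.min x c - Num.min y c| <= `|x - y|.
Proof.
by have [xy|xy] := ler0P (x - y); rewrite ler_norml; case: (leP x c);
  case: (leP y c) => *; apply/andP; split; lra.
Qed.

Section clamp.
Context {R : realType} {n : nat}.

(** Truncation to the unit ball of the sup norm; acting coordinatewise, it is 1-Lipschitz for that
    norm. *)
Definition clamp (v : 'cV[R]_n) : 'cV[R]_n :=
  \col_i Num.max (-1) (Num.min (v i ord0) 1).

Lemma clamp_le1 v : `|clamp v| <= 1.
Proof.
apply: mx_norm_le => // i j; rewrite mxE ler_norml.
apply/andP; split; first by rewrite le_max lexx.
by rewrite ge_max ge_min lexx orbT andbT; lra.
Qed.

Lemma clamp_lipschitz v w : `|clamp v - clamp w| <= `|v - w|.
Proof.
apply: mx_norm_le => // i j; rewrite (ord1 j) !mxE.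
have := mx_entry_le (v - w) i ord0; rewrite !mxE; apply: le_trans.
set x := v _ _; set y := w _ _.
exact: le_trans (maxr_lipschitz _ _ _) (minr_lipschitz _ _ _).
Qed.

Lemma clamp_id v : `|v| <= 1 -> clamp v = v.
Proof.
move=> v1; apply/colP => i; rewrite mxE.
have := le_trans (mx_entry_le v i ord0) v1; rewrite ler_norml => /andP[a b].
by rewrite min_l// max_r.
Qed.

Lemma clamp0 : clamp 0 = 0.
Proof. by rewrite clamp_id ?normr0. Qed.

Lemma mmx_clamp (y : R -> 'cV[R]_n) : mmx y -> mmx (fun t => clamp (y t)).
Proof.
move=> my i j; under eq_fun do rewrite mxE.
by apply: measurable_maxr => //; apply: measurable_minr.
Qed.

End clamp.

Section trajectories.
Context {R : realType} {n m : nat}.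
Variables (f : R -> 'cV[R]_n -> 'cV[R]_m -> 'cV[R]_n).
Hypothesis hf : forall i, C1_data (fun t y w => f t y w i ord0).
Variables (xb : R -> 'cV[R]_n) (ub : R -> 'cV[R]_m) (r : R).
Hypotheses (mxb : mmx xb) (mub : mmx ub).
Hypothesis rb : forall t, I01 t -> `|xb t| <= r /\ `|ub t| <= r.

(** The perturbed control [ub + s w + K y] contains a feedback on the
    deviation [y] of the state; truncating [y] makes the equation for [y]
    globally Lipschitz. *)
Lemma feedback_trajectory (delta Cw Ck : R) : 0 <= Cw -> 0 <= Ck ->
  exists2 C, 0 <= C & forall (w : R -> 'cV[R]_m) (K : R -> 'M[R]_(m, n)) (s : R),
    mmx w -> mmx K -> (forall t, I01 t -> `|w t| <= Cw /\ `|K t| <= Ck) ->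
    (forall t, I01 t -> t < delta -> w t = 0 /\ K t = 0) ->
    0 <= s -> s <= 1 -> C * s <= 1 ->
    exists y : R -> 'cV[R]_n,
      [/\ mmx y, forall t, I01 t -> `|y t| <= C * s,
          forall t, I01 t -> t < delta -> y t = 0 &
          forall t i, I01 t -> y t i ord0 = \int[leb]_(q in `[0, t])
            (f q (xb q + y q) (ub q + (s *: w q + K q *m y q)) -
             f q (xb q) (ub q)) i ord0].
Proof.
(* The radius covers [xb + clamp v] and [ub + s w + K clamp v] for every [s <= 1], so [M] does not
   depend on the perturbation. *)
move=> Cw0 Ck0; have [M M0 hM] := box_lipschitz_vec hf (r + (1 + Cw + n%:R * Ck)).
pose a := M * (1 + n%:R * Ck).
have a0 : 0 <= a by rewrite mulr_ge0 ?addr_ge0 ?mulr_ge0.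
have [W [Wm [mW bW aW]]] := forward_weight (L1_cst a) (fun _ _ => a0).
have Wm0 : 0 <= Wm.
  have /andP[h1 h2] := bW 0 (introT andP (conj (lexx _) ler01)).
  by rewrite (le_trans _ h2)// (le_trans _ h1).
(* This is the Volterra bound [2 * B * W] with [B = s * Cw] and [W <= Wm], divided by [s]. *)
exists (2 * Cw * Wm); first by rewrite !mulr_ge0.
move=> w K s mw mK bd van s0 s1 Cs1.
(* The indicator makes the solution vanish before [delta] at once, without a uniqueness argument.
   Afterwards it can be removed: before [delta] all of [y], [w] and [K] are 0, so the true integrand
   vanishes as well. *)
pose F q (y : 'cV[R]_n) : 'cV[R]_n := \1_[set t | delta <= t] q *:
  (f q (xb q + clamp y) (ub q + (s *: w q + K q *m clamp y)) - f q (xb q) (ub q)).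
have mind : measurable_fun I01 (\1_[set t | delta <= t] : R -> R).
  apply: measurable_indic; rewrite (_ : [set _ | _] = `[delta, +oo[%classic)//.
  by apply/seteqP; split => t /=; rewrite in_itv /= andbT.
have mF y : mvec y -> mvec (fun q => F q (y q)).
  move=> /mmx_mvec/mmx_clamp my; apply/mmx_mvec; apply: mmxZ => //.
  apply: mmxD; last by apply: mmxN; exact: mmx_along.
  apply: mmx_along => //; first exact: mmxD.
  apply: mmxD => //; apply: mmxD; last exact: mmxM.
  exact: mmxZ.
have Kle q (v : 'cV[R]_n) : I01 q -> `|K q *m v| <= n%:R * Ck * `|v|.
  move=> Iq; rewrite (le_trans (mulmx_norm_le _ _))// ler_wpM2r// ler_wpM2l//.
  by have [] := bd q Iq.
have swle q : I01 q -> `|s *: w q| <= s * Cw.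
  move=> Iq; rewrite normrZ ger0_norm// ler_wpM2l//.
  by have [] := bd q Iq.
have inx q v : I01 q -> `|xb q + clamp v| <= r + (1 + Cw + n%:R * Ck).
  move=> Iq; have [xr _] := rb Iq; have := clamp_le1 v.
  have : 0 <= n%:R * Ck by rewrite mulr_ge0.
  by have := ler_normD (xb q) (clamp v); lra.
have inu q v : I01 q ->
    `|ub q + (s *: w q + K q *m clamp v)| <= r + (1 + Cw + n%:R * Ck).
  move=> Iq; have [_ ur] := rb Iq; have := swle q Iq.
  have h1 : s * Cw <= Cw by rewrite ler_piMl.
  have h2 : `|K q *m clamp v| <= n%:R * Ck.
    by rewrite (le_trans (Kle _ _ Iq))// ler_piMr ?mulr_ge0// clamp_le1.
  have := ler_normD (ub q) (s *: w q + K q *m clamp v).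
  by have := ler_normD (s *: w q) (K q *m clamp v); lra.
have i1 q (v : 'cV[R]_n) : `|\1_[set t | delta <= t] q *: v| <= `|v|.
  rewrite normrZ indicE; case: (_ \in _); first by rewrite normr1 mul1r.
  by rewrite normr0 mul0r.
have lF q v v' : I01 q -> `|F q v - F q v'| <= a * `|v - v'|.
  move=> Iq; rewrite -scalerBr (le_trans (i1 _ _))// opprB addrA subrK.
  rewrite (le_trans (hM _ _ _ _ _ Iq _ _ _ _))//; try by [exact: inx|exact: inu].
  rewrite /a -mulrA ler_wpM2l// mulrDl mul1r.
  rewrite opprD addrACA subrr add0r opprD [ub q + _ + _]addrACA subrr add0r.
  rewrite opprD addrACA subrr add0r -mulmxBr lerD ?clamp_lipschitz//.
  by rewrite (le_trans (Kle _ _ Iq))// ler_wpM2l ?mulr_ge0// clamp_lipschitz.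
have F0 q : I01 q -> `|F q 0| <= a * (s * Cw).
  move=> Iq; rewrite (le_trans (i1 _ _))// clamp0 mulmx0 !addr0.
  have [xr ur] := rb Iq.
  have R0 : 0 <= 1 + Cw + n%:R * Ck by rewrite !addr_ge0// mulr_ge0.
  rewrite (le_trans (hM _ _ _ _ _ Iq _ _ _ _))//; try by rewrite ler_wpDr.
    by have := inu q 0 Iq; rewrite clamp0 mulmx0 addr0.
  rewrite subrr normr0 add0r addrAC subrr add0r.
  rewrite /a -mulrA ler_wpM2l// (le_trans (swle q Iq))// ler_peMl ?mulr_ge0//.
  by rewrite lerDl mulr_ge0.
have [y [/mmx_mvec my yb yE]] := @volterra_equation R n (fun t => `[0, t]%classic)
    F (fun=> a) W (s * Cw) Wm (fun _ _ => measurable_itv _) (fun t => @subI01l R t)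
    (fun h ih => within_continuous_measurable (continuous_L1_primitive ih))
    (L1_cst a) (fun _ _ => a0) mW bW aW mF lF (mulr_ge0 s0 Cw0) F0.
have yC t : I01 t -> `|y t| <= 2 * Cw * Wm * s.
  move=> It; rewrite (le_trans (yb t It))// [leRHS](_ : _ = 2 * (s * Cw) * Wm).
    by rewrite ler_wpM2l ?mulr_ge0//; have /andP[] := bW t It.
  by ring.
have y0 t : I01 t -> t < delta -> y t = 0.
  move=> It td; apply/colP => i; rewrite yE// mxE.
  rewrite (@eq_Rintegral _ _ _ _ _ (fun=> 0)) ?Rintegral_cst ?mul0r// => q.
  rewrite inE /= in_itv /= => /andP[_ qt].
  by rewrite !mxE indicE memNset ?mul0r//= leNgt (le_lt_trans qt td).
exists y; split => // t i It; rewrite yE//; apply: eq_Rintegral => q.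
rewrite inE => /(subI01l It) Iq.
rewrite /F clamp_id; last by rewrite (le_trans (yC q Iq)).
rewrite indicE; have [dq|qd] := leP delta q.
  by rewrite mem_set// scale1r.
rewrite memNset /=; last by rewrite leNgt qd.
have [-> ->] := van q Iq qd.
by rewrite y0// scaler0 mul0mx !addr0 subrr scaler0.
Qed.

End trajectories.

Section norms.
Context {R : realType}.

Lemma ae_imp (P Q : R -> Prop) : (forall t, P t -> Q t) ->
  {ae leb, forall t, P t} -> {ae leb, forall t, Q t}.
Proof.
by move=> PQ; apply: negligibleS => t /= nQ Pt; apply: nQ; exact: PQ.
Qed.

Lemma ae_and (P Q : R -> Prop) : {ae leb, forall t, P t} ->
  {ae leb, forall t, Q t} -> {ae leb, forall t, P t /\ Q t}.
Proof.
move=> aP aQ; apply: negligibleS (negligibleU aP aQ) => t /= /not_andP[nP|nQ].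
  by left.
by right.
Qed.

Lemma W11_continuous p (x v : R -> 'cV[R]_p) i : W11 x v ->
  {within I01, continuous (fun t => x t i ord0)}.
Proof.
move=> xv; have [iv xE] := xv i.
have c : {within I01, continuous (fun t => x 0 i ord0 +
    \int[leb]_(s in `[0, t]) v s i ord0)}.
  move=> t; apply: cvgD; first exact: cvg_cst.
  exact: continuous_L1_primitive.
have e : {in (I01 : set R), (fun t => x 0 i ord0 +
    \int[leb]_(s in `[0, t]) v s i ord0) =1 (fun t => x t i ord0)}.
  by move=> t; rewrite inE => It; rewrite /= -xE.
exact: (subspace_eq_continuous e c).
Qed.

Lemma eucl_le p q (v : 'M[R]_(p, q)) : eucl v <= (p * q)%:R * `|v|.
Proof.
have N0 : 0 <= (p * q)%:R * `|v| by rewrite mulr_ge0.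
rewrite /eucl -(ger0_norm N0) -sqrtr_sqr ler_wsqrtr//.
apply: (@le_trans _ _ (\sum_(i < p) \sum_(j < q) `|v| ^+ 2)).
  apply: ler_sum => i _; apply: ler_sum => j _.
  by rewrite -real_normK ?num_real// lerXn2r ?nnegrE// mx_entry_le.
rewrite !sumr_const !card_ord -mulrnA [(q * p)%N]mulnC -[leLHS]mulr_natl exprMn.
rewrite ler_wpM2r ?exprn_ge0//.
rewrite -natrX ler_nat; case: (p * q)%N => // k.
by rewrite -mulnn leq_pmulr.
Qed.

Lemma Linfty_norm_le p (u : R -> 'cV[R]_p) c : 0 <= c ->
  (forall t, I01 t -> `|u t| <= c) -> (Linfty_norm u <= (p%:R * c)%:E)%E.
Proof.
move=> c0 uc; apply/ess_supP; apply: aeW => t; rewrite patchE.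
case: ifPn => [|_]; last by rewrite lee_fin mulr_ge0.
rewrite inE => It; rewrite lee_fin (le_trans (eucl_le _))// muln1.
by rewrite ler_wpM2l// uc.
Qed.

Lemma C_norm_le p (x : R -> 'cV[R]_p) c : 0 <= c ->
  (forall t, I01 t -> `|x t| <= c) -> (C_norm x <= (p%:R * c)%:E)%E.
Proof.
move=> c0 xc; apply: ge_ereal_sup => _ [t It <-].
rewrite lee_fin (le_trans (eucl_le _))// muln1.
by rewrite ler_wpM2l// xc.
Qed.

End norms.

Section first_variation.
Context {R : realType} {n m : nat}.
Variables (L : R -> 'cV[R]_n -> 'cV[R]_m -> R).
Variables (f : R -> 'cV[R]_n -> 'cV[R]_m -> 'cV[R]_n).
Variables (g : R -> 'cV[R]_n -> 'cV[R]_m -> R).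
Variables (x0 : 'cV[R]_n) (xb : R -> 'cV[R]_n) (ub : R -> 'cV[R]_m) (r : R).
Hypothesis hdata : problem_data L f g.
Hypothesis hmin : weak_local_minimizer L f g x0 xb ub.
Hypothesis rb : forall t, I01 t -> `|xb t| <= r /\ `|ub t| <= r.

Let gx := along (grad_x g) xb ub.
Let gu := along (grad_u g) xb ub.
Let Lx := along (grad_x L) xb ub.
Let Lu := along (grad_u L) xb ub.
Let fx := along (jac_x f) xb ub.
Let fu := along (jac_u f) xb ub.

Lemma mmx_state : mmx xb.
Proof.
have [[[v xv _] _ _ _] _] := hmin.
apply/mmx_mvec => i; apply: within_continuous_measurable.
exact: W11_continuous xv.
Qed.

Lemma mmx_control : mmx ub.
Proof. by have [[_ [mu _] _ _] _] := hmin; exact/mmx_mvec. Qed.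

Lemma L1_along (h : R -> 'cV[R]_n -> 'cV[R]_m -> R) x u s : C1_data h ->
  mmx x -> mmx u -> (forall t, I01 t -> `|x t| <= s /\ `|u t| <= s) ->
  L1 (along h x u).
Proof.
move=> [ch _ _ _] mx mu xus.
have [M M0 hM] := box_bounded s ch.
apply: (@L1_bounded _ _ M).
  exact: (measurable_along ch ((mmx_mvec _).1 mx) ((mmx_mvec _).1 mu)).
by move=> t It; have [xs us] := xus t It; apply: (hM (t, x t, u t)).
Qed.

Lemma within_continuous_entry q (k : R * 'cV[R]_n * 'cV[R]_m -> 'rV[R]_q) j :
  {within domain01, continuous k} ->
  {within domain01, continuous (fun p => k p ord0 j)}.
Proof.
move=> /subspace_continuousP ck; apply/subspace_continuousP => p dp.
have /cvgrPdist_le hk := ck p dp; apply/cvgrPdist_le => e e0.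
have := hk e e0; apply: filterS => p' /= h; apply: le_trans h.
by have := mx_entry_le (k p - k p') ord0 j; rewrite !mxE.
Qed.

Lemma mmx_grad h : C1_data h ->
  mmx (along (grad_x h) xb ub) /\ mmx (along (grad_u h) xb ub).
Proof.
move=> [_ _ cx cu]; have mx := (mmx_mvec _).1 mmx_state.
have mu := (mmx_mvec _).1 mmx_control.
split=> i j; rewrite (ord1 i).
  exact: (measurable_along (@within_continuous_entry _ _ j cx) mx mu).
exact: (measurable_along (@within_continuous_entry _ _ j cu) mx mu).
Qed.

Lemma grad_bounded h : C1_data h -> exists2 M, 0 <= M & forall t, I01 t ->
  `|along (grad_x h) xb ub t| <= M /\ `|along (grad_u h) xb ub t| <= M.
Proof.
move=> [_ _ cx cu].
have [M M0 hM] := box_bounded r cx; have [N N0 hN] := box_bounded r cu.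
exists (M + N) => [|t It]; first by rewrite addr_ge0.
have bt : box r (t, xb t, ub t) by have [] := rb It.
split; first by rewrite (le_trans (hM _ bt))// lerDl.
by rewrite (le_trans (hN _ bt))// lerDr.
Qed.

Lemma mmx_jac : mmx fx /\ mmx fu.
Proof.
have [_ hf _] := hdata.
by split=> i j; have [mx mu] := mmx_grad (hf i); under eq_fun do
  rewrite /fx /fu /along mxE; [exact: mx|exact: mu].
Qed.

Lemma jac_bounded : exists2 M, 0 <= M & forall t, I01 t ->
  `|fx t| <= M /\ `|fu t| <= M.
Proof.
have [_ hf _] := hdata.
have [i M M' hM MM' t It|M M0 hM] := finite_uniform_upper (fun i => grad_bounded (hf i)).
  by have [h1 h2] := hM t It; split; exact: le_trans MM'.
exists M => // t It; split; apply: mx_norm_le => // i j.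
  rewrite mxE; have [h1 _] := hM i t It; exact: le_trans (mx_entry_le _ _ _) h1.
rewrite mxE; have [_ h2] := hM i t It; exact: le_trans (mx_entry_le _ _ _) h2.
Qed.

Lemma L1_dot p (a : R -> 'rV[R]_p) (v : R -> 'cV[R]_p) A V :
  mmx a -> mmx v -> (forall t, I01 t -> `|a t| <= A) ->
  (forall t, I01 t -> `|v t| <= V) -> L1 (fun t => dot (a t) (v t)).
Proof.
move=> ma mv aA vV; apply: (@L1_bounded _ _ (p%:R * A * V)); first exact: mdot.
move=> t It; rewrite (le_trans (dot_le _ _))// ler_pM ?mulr_ge0// ?vV//.
by rewrite ler_wpM2l// aA.
Qed.

Lemma admissible_perturbation (y : R -> 'cV[R]_n) (v : R -> 'cV[R]_m) (B : R) :
  mmx v -> (forall t, I01 t -> `|v t| <= B) ->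
  (forall i, L1 (fun q => (f q (xb q + y q) (ub q + v q) - f q (xb q) (ub q)) i ord0)) ->
  (forall t i, I01 t -> y t i ord0 = \int[leb]_(q in `[0, t])
     (f q (xb q + y q) (ub q + v q) - f q (xb q) (ub q)) i ord0) ->
  {ae leb, forall t, I01 t -> g t (xb t + y t) (ub t + v t) <= 0} ->
  admissible f g x0 (fun t => xb t + y t) (fun t => ub t + v t).
Proof.
move=> mv vB iF yE gneg; have [[[vb xv vE] [mu lu] _ x0E] _] := hmin.
have I0 : (I01 : set R) 0 by rewrite /I01 /= lexx ler01.
have y0 : y 0 = 0.
  by apply/colP => i; rewrite yE// set_itv1 Rintegral_set1 mxE.
split => //; last by rewrite y0 addr0.
- exists (fun t => vb t + (f t (xb t + y t) (ub t + v t) - f t (xb t) (ub t))).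
    move=> i; have [iv xE] := xv i; split.
      have := L1D iv (iF i); apply: eq_L1 => t _.
      by rewrite [in RHS]mxE.
    move=> t It; rewrite !mxE xE// yE// y0 mxE addr0 -addrA; congr (_ + _).
    rewrite -RintegralD//; last 2 first.
      by apply: L1_sub => //; exact: subI01l.
      by apply: L1_sub => //; exact: subI01l.
    by apply: eq_Rintegral => q _; rewrite [in RHS]mxE.
  apply: ae_imp vE => t vE It; rewrite vE// /along.
  by rewrite addrC subrK.
- split.
    by apply/mmx_mvec; apply: mmxD => //; exact/mmx_mvec.
  have I0' : 0 <= r + B.
    have [_ ur] := rb I0; have vb0 := vB 0 I0.
    by rewrite addr_ge0// ?(le_trans (normr_ge0 _) ur)// (le_trans (normr_ge0 _) vb0).
  apply: le_lt_trans (ltry _); apply: (Linfty_norm_le I0') => t It.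
  by have [_ ur] := rb It; rewrite (le_trans (ler_normD _ _))// lerD// vB.
Qed.

(** Feasibility has three sources: before [delta] nothing changes; where [g <= - eta] a Lipschitz
    bound leaves enough room; elsewhere the feedback cancels the first-order effect of [y], and the
    decrease [- eta] beats the Taylor remainder. Here [rr] is the exact derivative of [y], only
    close to the linearized one. *)
Lemma first_variation (delta Cw Ck : R) : 0 <= Cw -> 0 <= Ck ->
  exists2 C, 0 <= C & forall (w : R -> 'cV[R]_m) (K : R -> 'M[R]_(m, n)) (eta : R),
    mmx w -> mmx K -> (forall t, I01 t -> `|w t| <= Cw /\ `|K t| <= Ck) ->
    (forall t, I01 t -> t < delta -> w t = 0 /\ K t = 0) -> 0 < eta ->
    {ae leb, forall t, I01 t -> delta <= t -> along g xb ub t <= - eta \/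
      (dot (gu t) (w t) <= - eta /\ gx t + gu t *m K t = 0)} ->
    forall sigma, 0 < sigma -> exists s (y rr : R -> 'cV[R]_n),
      [/\ [/\ 0 < s, mmx y, forall t, I01 t -> `|y t| <= C * s &
            forall t, I01 t -> t < delta -> y t = 0],
          forall i, L1 (fun t => rr t i ord0),
          forall t i, I01 t -> y t i ord0 = \int[leb]_(q in `[0, t]) rr q i ord0,
          forall t, I01 t ->
            `|rr t - (fx t *m y t + fu t *m (s *: w t + K t *m y t))| <= sigma * s &
          0 <= \int[leb]_(t in I01)
            (dot (Lx t) (y t) + dot (Lu t) (s *: w t + K t *m y t)) + sigma * s].
Proof.
move=> Cw0 Ck0; have [hL hf hg] := hdata.
have mxb := mmx_state; have mub := mmx_control.
have [C C0 hC] := feedback_trajectory hf mxb mub rb delta Cw0 Ck0.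
exists C => // w K eta mw mK bd van eta0 act sigma sigma0.
(* Bounds [|s w + K y|] per unit of [s]; [D] then does the same for [|y| + |v|]. *)
pose Cv := Cw + n%:R * Ck * C.
have Cv0 : 0 <= Cv by rewrite addr_ge0// !mulr_ge0.
pose D := C + Cv + 1.
have D0 : 0 < D by rewrite ltr_wpDl// addr_ge0.
(* With this tolerance every Taylor error is at most [Num.min sigma eta * s]: small against
   [sigma * s] in dynamics and cost, and against the gain [eta * s] in the constraint. *)
pose e' := Num.min sigma eta / D.
have e'0 : 0 < e' by rewrite divr_gt0// lt_min sigma0.
have [df df0 tf] := box_taylor_vec hf r e'0.
have [dL dL0 tL] := box_taylor r hL e'0.
have [dg dg0 tg] := box_taylor r hg e'0.
have [Mg Mg0 lg] := box_lipschitz (r + 1) hg.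
have [adm [e0 e00 opt]] := hmin.
(* The size of the perturbation. In turn: it stays in the box of radius [r + 1], it cannot use up a
   slack of [eta], the three Taylor estimates apply, and the Euclidean distances, up to [n] or [m]
   times larger than the sup norms, stay strictly below [e0]. *)
pose b := Num.min (Num.min 1 (eta / (Mg + 1)))
  (Num.min (Num.min df (Num.min dL dg)) (e0 / (2 * (n%:R + m%:R + 1)))).
have nm0 : 0 < n%:R + m%:R + 1 :> R by rewrite ltr_wpDl// addr_ge0.
have b0 : 0 < b.
  by rewrite !lt_min ltr01 df0 dL0 dg0 !divr_gt0 ?mulr_gt0// ltr_wpDl.
pose s := b / D.
have s0 : 0 < s by rewrite divr_gt0.
have Ds : D * s = b by rewrite mulrC divfK// gt_eqF.
have [b1 b_eta bdf bdL [bdg be]] : [/\ b <= 1, b <= eta / (Mg + 1), b <= df, b <= dL &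
    b <= dg /\ b <= e0 / (2 * (n%:R + m%:R + 1))].
  have : b <= b by [].
  by rewrite {2}/b !le_min => /andP[/andP[-> ->] /andP[/andP[-> /andP[-> ->]] ->]].
have D1 : 1 <= D by rewrite lerDr addr_ge0.
have Cle : C * s <= b by rewrite -Ds ler_wpM2r ?(ltW s0)// /D -addrA lerDl addr_ge0.
have Cvle : Cv * s <= b by rewrite -Ds ler_wpM2r ?(ltW s0)// /D addrAC lerDr addr_ge0.
have s1 : s <= 1 by rewrite (le_trans _ b1)// -Ds ler_peMl// ltW.
have [y [my yb y0 yE]] := hC w K s mw mK bd van (ltW s0) s1 (le_trans Cle b1).
pose v t := s *: w t + K t *m y t.
have mv : mmx v by apply: mmxD; [exact: mmxZ|exact: mmxM].
have vb t : I01 t -> `|v t| <= Cv * s.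
  move=> It; have [wC KC] := bd t It; rewrite (le_trans (ler_normD _ _))//.
  rewrite mulrDl lerD//; first by rewrite normrZ gtr0_norm// mulrC ler_wpM2r// ltW.
  rewrite (le_trans (mulmx_norm_le _ _))// -[leRHS]mulrA ler_pM ?mulr_ge0//; last exact: yb.
  by rewrite ler_wpM2l.
have yb' t : I01 t -> `|y t| <= b by move=> It; exact: le_trans (yb t It) Cle.
have vb' t : I01 t -> `|v t| <= b by move=> It; exact: le_trans (vb t It) Cvle.
have yv t : I01 t -> `|y t| + `|v t| <= D * s.
  move=> It; rewrite (le_trans (lerD (yb t It) (vb t It)))// -mulrDl.
  by rewrite ler_wpM2r ?(ltW s0)// lerDl.
have err t : I01 t -> e' * (`|y t| + `|v t|) <= Num.min sigma eta * s.
  move=> It; apply: le_trans (ler_wpM2l (ltW e'0) (yv t It)) _.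
  by rewrite mulrA divfK// gt_eqF.
have min_s : Num.min sigma eta * s <= sigma * s.
  by rewrite ler_wpM2r ?(ltW s0)// ge_min lexx.
have min_e : Num.min sigma eta * s <= eta * s.
  by rewrite ler_wpM2r ?(ltW s0)// ge_min lexx orbT.
have rx t : I01 t -> `|xb t + y t| <= r + 1 /\ `|ub t + v t| <= r + 1.
  move=> It; have [xr ur] := rb It.
  by split; rewrite (le_trans (ler_normD _ _))// lerD//;
    [exact: le_trans (yb' t It) b1|exact: le_trans (vb' t It) b1].
have rb1 t : I01 t -> `|xb t| <= r + 1 /\ `|ub t| <= r + 1.
  by move=> It; have [xr ur] := rb It; split; rewrite ler_wpDr.
pose rr t := f t (xb t + y t) (ub t + v t) - f t (xb t) (ub t).
have irr i : L1 (fun t => rr t i ord0).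
  have i1 := L1_along (hf i) (mmxD mxb my) (mmxD mub mv) rx.
  have i2 := L1_along (hf i) mxb mub rb1.
  by apply: eq_L1 (L1B i1 i2) => t _; rewrite !mxE.
have gneg : {ae leb, forall t, I01 t -> g t (xb t + y t) (ub t + v t) <= 0}.
  have [_ _ gle _] := adm.
  apply: ae_imp (ae_and gle act) => t [gt0 actt] It.
  have gt : along g xb ub t <= 0 by exact: gt0.
  have [td|dt] := ltP t delta.
    have [w0 K0] := van t It td.
    by rewrite /v w0 K0 y0// mulmx0 scaler0 !addr0; exact: gt.
  have [xr ur] := rb It; have [xr1 ur1] := rb1 t It; have [xr2 ur2] := rx t It.
  have [gle'|[gw gK]] := actt It dt.
    have := lg t _ _ _ _ It xr1 ur1 xr2 ur2; rewrite [xb t + _ - _]addrAC.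
    rewrite [ub t + _ - _]addrAC !subrr !add0r => gl.
    have Mle : Mg * (`|y t| + `|v t|) <= eta.
      have h1 : Mg * (`|y t| + `|v t|) <= Mg * b by rewrite ler_wpM2l// -Ds yv.
      apply: (le_trans h1); have M1 : 0 < Mg + 1 by rewrite ltr_wpDl.
      rewrite -[leRHS](divfK (lt0r_neq0 M1)) mulrC.
      by rewrite ler_pM// ?(ltW b0)// lerDl.
    rewrite -[leLHS](subrK (g t (xb t) (ub t))).
    apply: le_trans (lerD (le_trans (ler_norm _) (le_trans gl Mle)) gle') _.
    by rewrite subrr.
  have := tg t _ _ _ _ It xr ur (le_trans (yb' t It) bdg) (le_trans (vb' t It) bdg).
  (* The relation [gx + gu K = 0] removes [y] from the linearized constraint. *)
  have -> : dot (grad_x g t (xb t) (ub t)) (y t) + dot (grad_u g t (xb t) (ub t)) (v t)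
      = s * dot (gu t) (w t).
    rewrite /v dotDr dotZr addrCA.
    have -> : dot (grad_u g t (xb t) (ub t)) (K t *m y t) = dot (gu t *m K t) (y t).
      by rewrite /dot mulmxA.
    have d0 : dot (gx t + gu t *m K t) (y t) = 0 by rewrite gK /dot mul0mx mxE.
    by rewrite -dotDl d0 addr0.
  move=> /(le_trans (ler_norm _))/le_trans/(_ (err t It)).
  have : s * dot (gu t) (w t) <= s * - eta by rewrite ler_wpM2l ?(ltW s0).
  by move: gt min_e; rewrite /along; clear; lra.
have ad := admissible_perturbation mv vb irr yE gneg.
have be0 p : p%:R <= n%:R + m%:R :> R -> p%:R * b < e0.
  move=> pnm; have : p%:R * b <= (n%:R + m%:R + 1) * (e0 / (2 * (n%:R + m%:R + 1))).
    by rewrite ler_pM// ?(ltW b0)// (le_trans pnm)// lerDl.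
  rewrite invfM mulrCA [_ * (_ / _)]mulrCA divff ?gt_eqF// mulr1.
  by move=> /le_lt_trans; apply; rewrite ltr_pdivrMr// ltr_pMr// ltr1n.
have := opt _ _ ad.
have -> : (C_norm (fun t => (xb t + y t - xb t)%R) < e0%:E)%E.
  apply: le_lt_trans (C_norm_le (ltW b0) _) _; last by rewrite lte_fin be0// lerDl.
  by move=> t It; rewrite addrAC subrr add0r yb'.
have -> : (Linfty_norm (fun t => (ub t + v t - ub t)%R) < e0%:E)%E.
  apply: le_lt_trans (Linfty_norm_le (ltW b0) _) _; last by rewrite lte_fin be0// lerDr.
  by move=> t It; rewrite addrAC subrr add0r vb'.
move=> /(_ isT isT); rewrite /cost -subr_ge0 => cost0.
have [mLx mLu] := mmx_grad hL; have [ML ML0 bL] := grad_bounded hL.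
have iLx : L1 (fun t => dot (Lx t) (y t)).
  by apply: (L1_dot mLx my _ yb') => t It; have [h _] := bL t It; exact: h.
have iLu : L1 (fun t => dot (Lu t) (v t)).
  by apply: (L1_dot mLu mv _ vb') => t It; have [_ h] := bL t It; exact: h.
have iL1 := L1_along hL (mmxD mxb my) (mmxD mub mv) rx.
have iL := L1_along hL mxb mub rb1.
exists s, y, rr; split => //.
- move=> t It; have [xr ur] := rb It.
  apply: le_trans (tf t _ _ _ _ It xr ur _ _) _.
  + exact: le_trans (yb' t It) bdf.
  + exact: le_trans (vb' t It) bdf.
  + exact: le_trans (err t It) min_s.
- have e1 : \int[leb]_(t in I01) (sigma * s) = sigma * s :> R.
    by rewrite Rintegral_cst// [X in fine X]leb_I01 mulr1.
  rewrite -[X in _ + X]e1 -RintegralD//; [|exact: L1D|exact: L1_cst].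
  apply: (le_trans cost0); rewrite -RintegralB//.
  apply: le_Rintegral => //; [exact: L1B|by apply: L1D; [exact: L1D|exact: L1_cst]|].
  move=> t It; have [xr ur] := rb It.
  have := tL t _ _ _ _ It xr ur (le_trans (yb' t It) bdL) (le_trans (vb' t It) bdL).
  move=> /(le_trans (ler_norm _))/le_trans/(_ (err t It)).
  by move: min_s; rewrite /along /Lx /Lu /along -/(v t); clear; lra.
Qed.

End first_variation.

(** * Stationarity and the sign of the multiplier *)

Section measure_tools.
Context {R : realType}.
Implicit Types (a b k : R -> R) (c d : R -> bool).

Lemma measurable_bool_indicator c : measurable_fun I01 c ->
  measurable_fun I01 (fun t => (c t)%:R : R).
Proof.
move=> mc; have mb : measurable_fun setT (fun b : bool => b%:R : R) by [].
exact: (measurableT_comp mb mc).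
Qed.

(** On nonnegative numbers inversion, including the value 0 at 0, is the power of exponent [- 1]. *)
Lemma measurable_inv_nneg k : measurable_fun I01 k ->
  (forall t, I01 t -> 0 <= k t) -> measurable_fun I01 (fun t => (k t)^-1).
Proof.
move=> mk k0; have mp := measurableT_comp (measurable_powR (- 1 : R)) mk.
apply: eq_measurable_fun mp => t; rewrite inE => It /=.
by rewrite powR_inv1// k0.
Qed.

(** Replacing [b] by the maximum of [a] and [b] alters it on a null set only and makes the
    inequality pointwise. *)
Lemma ae_le_Rintegral a b : L1 a -> L1 b ->
  {ae leb, forall t, I01 t -> a t <= b t} ->
  \int[leb]_(t in I01) a t <= \int[leb]_(t in I01) b t.
Proof.
move=> ia ib ab; pose k t := Num.max (a t) (b t).
have mk : measurable_fun I01 k.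
  by apply: measurable_maxr; exact: L1_measurable.
have ik : L1 k.
  apply: (L1_le mk (L1D (integrable_norm ia) (integrable_norm ib))) => t It /=.
  rewrite /k; case: (leP (a t) (b t)) => _; first by rewrite lerDr.
  by rewrite lerDl.
have -> : \int[leb]_(t in I01) b t = \int[leb]_(t in I01) k t.
  congr fine; apply: ae_eq_integral => //.
  - by case/integrableP : ib.
  - by case/integrableP : ik.
  - by apply: ae_imp ab => t abt It; rewrite /k max_r// abt.
by apply: le_Rintegral => // t It; rewrite /k le_max lexx.
Qed.

Lemma ae_eq0_of_nonpos k : L1 k -> (forall t, I01 t -> k t <= 0) ->
  0 <= \int[leb]_(t in I01) k t -> {ae leb, forall t, I01 t -> k t = 0}.
Proof.
move=> ik k0 ik0; have mk := L1_measurable ik.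
have [h _] := ae_eq_integral_abs leb measurable_I01 (iffRL (measurable_EFinP _ _) mk).
have e : (\int[leb]_(x in I01) `|(EFin \o k) x|)%E = 0%E.
  have -> : (\int[leb]_(x in I01) `|(EFin \o k) x|)%E =
      (\int[leb]_(x in I01) (- k x)%:E)%E.
    by apply: eq_integral => t; rewrite inE => It /=; rewrite ler0_norm ?k0.
  rewrite -(EFin_Rintegral (L1N ik) measurable_I01); congr EFin.
  have kN : \int[leb]_(t in I01) - k t = - \int[leb]_(t in I01) k t.
    by rewrite -mulN1r -RintegralZl//; apply: eq_Rintegral => t _; rewrite mulN1r.
  apply/eqP; rewrite eq_le [X in X <= _]kN oppr_le0 ik0 /=.
  by apply: Rintegral_ge0 => t It; rewrite oppr_ge0; exact: k0.
by apply: ae_imp (h e) => t ht It; have [] := ht It.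
Qed.

(** The bands [- m / j.+1 <= k < 0] decrease to the empty set, because 0 is excluded; dominated
    convergence makes their measure small. *)
Lemma small_band k (e0 e : R) : measurable_fun I01 k -> 0 < e0 -> 0 < e ->
  exists eta, [/\ 0 < eta, eta <= e0, eta <= e &
    \int[leb]_(t in I01) ((- eta <= k t) && (k t < 0))%:R <= e].
Proof.
move=> mk e00 e1; pose m := Num.min e0 e.
have m0 : 0 < m by rewrite lt_min e00.
pose F (j : nat) t : R := ((- (m / j.+1%:R) <= k t) && (k t < 0))%:R.
have mF j : measurable_fun I01 (F j).
  apply: measurable_bool_indicator; apply: measurable_and.
    by apply: measurable_fun_ler.
  by apply: measurable_fun_ltr.
have F1 j t : I01 t -> (`|(F j t)%:E| <= (1 : R)%:E)%E.
  by move=> _; rewrite lee_fin /F; case: (_ && _); rewrite ?normr1 ?normr0.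
have Fcvg t : I01 t -> (F j t)%:E @[j --> \oo] --> 0%E.
  move=> It; have [k0|k0] := ltP (k t) 0; last first.
    by apply: cvg_near_cst; near=> j; rewrite /F ltNge k0 andbF.
  apply: cvg_near_cst; near=> j; rewrite /F k0 andbT.
  rewrite (_ : (_ <= _) = false)//; apply/negbTE; rewrite -ltNge ltrNr.
  rewrite ltr_pdivrMr// mulrC -ltr_pdivrMr ?oppr_gt0//.
  near: j; exists (Num.truncn (m / - k t)) => // j /= jt.
  by rewrite (lt_le_trans (truncnS_gt _))// ler_nat ltnS.
have := dominated_cvg measurable_I01
  (fun j => iffRL (measurable_EFinP _ _) (mF j)) Fcvg _ (L1_cst 1) F1.
move=> /(_ (fun _ _ => isT)); rewrite integral0 => /(_ [set y | (y < e%:E)%E]).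
case; first by apply: open_ereal_lt'; rewrite lte_fin.
move=> j _ /(_ j (leqnn j)) /= Fj.
have iF : L1 (F j).
  by apply: (L1_bounded (mF j)) => t It; have := F1 j t It; rewrite lee_fin; exact.
have mj : m / j.+1%:R <= m by rewrite ler_pdivrMr// ler_peMr ?ler1n// ltW.
exists (m / j.+1%:R); split.
- by rewrite divr_gt0.
- by rewrite (le_trans mj)// ge_min lexx.
- by rewrite (le_trans mj)// ge_min lexx orbT.
- by rewrite -lee_fin [X in (X <= _)%E](EFin_Rintegral iF measurable_I01); exact/ltW.
Unshelve. all: by end_near. Qed.

End measure_tools.

Section dot_squares.
Context {R : realType}.

Definition sqn {p} (a : 'rV[R]_p) : R := dot a a^T.

Lemma sqnE p (a : 'rV[R]_p) : sqn a = \sum_j a ord0 j ^+ 2.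
Proof. by rewrite /sqn dotE; apply: eq_bigr => j _; rewrite mxE expr2. Qed.

Lemma sqn_ge0 p (a : 'rV[R]_p) : 0 <= sqn a.
Proof. by rewrite sqnE; apply: sumr_ge0 => j _; rewrite sqr_ge0. Qed.

Lemma sqn_eq0 p (a : 'rV[R]_p) : sqn a = 0 -> a = 0.
Proof.
rewrite sqnE => a0; apply/rowP => j; rewrite mxE; apply/eqP; rewrite -sqrf_eq0.
have /eqP := a0; rewrite psumr_eq0; last by move=> i _; rewrite sqr_ge0.
by move=> /allP /(_ j (mem_index_enum _)).
Qed.

Lemma sqr_eucl p (a : 'rV[R]_p) : eucl a ^+ 2 = sqn a.
Proof. by rewrite /eucl big_ord1 sqr_sqrtr -sqnE// sqn_ge0. Qed.

Lemma dotC p (a b : 'rV[R]_p) : dot a b^T = dot b a^T.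
Proof. by rewrite !dotE; apply: eq_bigr => j _; rewrite !mxE mulrC. Qed.

Lemma dot_outer p q (a b : 'rV[R]_p) (d : 'rV[R]_q) y :
  dot a ((b^T *m d) *m y) = dot a b^T * dot d y.
Proof. by rewrite /dot -mulmxA mulmxA [LHS]mxE big_ord1. Qed.

Lemma row_outer p q (a : 'rV[R]_p) (d : 'rV[R]_q) : a *m (a^T *m d) = sqn a *: d.
Proof. by rewrite mulmxA [a *m _]mx11_scalar mul_scalar_mx. Qed.

(** The descent direction [h + max z 0 a] measures both the stationarity
    defect [h + z a] and the negative part of [z]. *)
Lemma descent_identity p (a : 'rV[R]_p) (h : 'cV[R]_p) (z : R) :
  z = 0 \/ z * sqn a = - dot a h ->
  dot h^T (h + Num.max z 0 *: a^T) =
    sqn (h + z *: a^T)^T + Num.min z 0 ^+ 2 * sqn a.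
Proof.
have ha : dot h^T a^T = dot a h by rewrite dotC trmxK.
move=> [->|za].
  by rewrite maxxx minxx !scale0r !addr0 expr0n mul0r addr0 /sqn trmxK.
have -> : sqn (h + z *: a^T)^T = dot h^T h - z ^+ 2 * sqn a.
  rewrite /sqn trmxK linearD /= linearZ /= trmxK dotDl !dotDr !dotZl !dotZr.
  by rewrite ha -/(sqn a) (_ : dot a h = - (z * sqn a)); [ring|rewrite za opprK].
rewrite dotDr dotZr ha (_ : dot a h = - (z * sqn a)); last by rewrite za opprK.
by case: (leP z 0) => _; ring.
Qed.

End dot_squares.

Section stationarity.
Context {R : realType} {n m : nat}.
Variables (L : R -> 'cV[R]_n -> 'cV[R]_m -> R).
Variables (f : R -> 'cV[R]_n -> 'cV[R]_m -> 'cV[R]_n).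
Variables (g : R -> 'cV[R]_n -> 'cV[R]_m -> R).
Variables (x0 : 'cV[R]_n) (xb : R -> 'cV[R]_n) (ub : R -> 'cV[R]_m) (r : R).
Hypothesis hdata : problem_data L f g.
Hypothesis hmin : weak_local_minimizer L f g x0 xb ub.
Hypothesis rb : forall t, I01 t -> `|xb t| <= r /\ `|ub t| <= r.

Let gb := along g xb ub.
Let gx := along (grad_x g) xb ub.
Let gu := along (grad_u g) xb ub.
Let Lx := along (grad_x L) xb ub.
Let Lu := along (grad_u L) xb ub.
Let fx := along (jac_x f) xb ub.
Let fu := along (jac_u f) xb ub.

(** Where [gu] vanishes the inverse is 0 by convention, so the weight is finite at every instant. *)
Definition active_weight t : R := (gb t == 0)%:R / sqn (gu t).

Lemma measurable_gb : measurable_fun I01 gb.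
Proof.
have [_ _ [cg _ _ _]] := hdata.
exact: (measurable_along cg ((mmx_mvec _).1 (mmx_state hmin))
  ((mmx_mvec _).1 (mmx_control hmin))).
Qed.

Lemma mmx_gu : mmx gu.
Proof. by have [_ _ hg] := hdata; have [_] := mmx_grad hmin hg. Qed.

Lemma measurable_sqn : measurable_fun I01 (fun t => sqn (gu t)).
Proof. by apply: mdot; [exact: mmx_gu|apply: mmxT; exact: mmx_gu]. Qed.

Lemma measurable_inv_sqn : measurable_fun I01 (fun t => (sqn (gu t))^-1).
Proof.
by apply: measurable_inv_nneg; [exact: measurable_sqn|move=> t _; exact: sqn_ge0].
Qed.

Lemma measurable_active_weight : measurable_fun I01 active_weight.
Proof.
apply: measurable_funM; last exact: measurable_inv_sqn.
apply: measurable_bool_indicator; apply: measurable_fun_eqr => //.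
exact: measurable_gb.
Qed.

Variables (lam : R -> 'cV[R]_n) (Lam : R).
Hypotheses (mlam : mmx lam) (lamb : forall t, I01 t -> `|lam t| <= Lam).
Let P s := costate_rhs fx fu Lx gx Lu gu active_weight s (lam s).
Let z s := zmult fu Lu gu active_weight s (lam s).
Let hs s := switching fu Lu s (lam s).
Hypothesis iP : forall i, L1 (fun s => P s i ord0).
Hypothesis iz : L1 z.
Hypothesis lamE : forall t i, I01 t ->
  lam t i ord0 = \int[leb]_(s in `[t, 1]) P s i ord0.

Lemma zmult_inactive t : gb t != 0 -> z t = 0.
Proof.
by move=> gt; rewrite /z /zmult /active_weight (negbTE gt) !mul0r oppr0.
Qed.

Lemma zmult_active t : gb t = 0 -> z t = - ((sqn (gu t))^-1 * dot (gu t) (hs t)).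
Proof. by move=> gt; rewrite /z /zmult /active_weight gt eqxx mul1r. Qed.

(** Integration by parts for [- lam' = P] and [y' = rr]; there are no boundary terms because [lam]
    vanishes at 1 and [y] at 0. *)
Lemma costate_duality (y rr : R -> 'cV[R]_n) (B : R) :
  mmx y -> (forall t, I01 t -> `|y t| <= B) ->
  (forall i, L1 (fun t => rr t i ord0)) ->
  (forall t i, I01 t -> y t i ord0 = \int[leb]_(q in `[0, t]) rr q i ord0) ->
  [/\ L1 (fun t => dot (lam t)^T (rr t)), L1 (fun t => dot (P t)^T (y t)) &
    \int[leb]_(t in I01) dot (lam t)^T (rr t) =
    \int[leb]_(t in I01) dot (P t)^T (y t)].
Proof.
move=> my yB irr yE.
have i1 i : L1 (fun t => rr t i ord0 * lam t i ord0).
  apply: (L1M_bounded (irr i) (mlam i ord0) (M := Lam)) => t It.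
  by apply: le_trans (mx_entry_le _ _ _) (lamb It).
have i2 i : L1 (fun t => P t i ord0 * y t i ord0).
  apply: (L1M_bounded (iP i) (my i ord0) (M := B)) => t It.
  by apply: le_trans (mx_entry_le _ _ _) (yB t It).
have e1 : (fun t => dot (lam t)^T (rr t)) = fun t => \sum_i rr t i ord0 * lam t i ord0.
  by apply/funext => t; rewrite dotE; apply: eq_bigr => i _; rewrite mxE mulrC.
have e2 : (fun t => dot (P t)^T (y t)) = fun t => \sum_i P t i ord0 * y t i ord0.
  by apply/funext => t; rewrite dotE; apply: eq_bigr => i _; rewrite mxE.
split; [by rewrite e1; exact: L1_sum|by rewrite e2; exact: L1_sum|].
rewrite e1 e2 !Rintegral_sum//; apply: eq_bigr => i _.
transitivity (\int[leb]_(t in I01)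
    (rr t i ord0 * \int[leb]_(s in `[t, 1]) P s i ord0)).
  by apply: eq_Rintegral => t; rewrite inE => It; rewrite lamE.
rewrite (Rintegral_exchange (iP i) (irr i)).
by apply: eq_Rintegral => t; rewrite inE => It; rewrite yE.
Qed.

Lemma dot_costate t (y : 'cV[R]_n) :
  dot (P t)^T y = dot (Lx t) y + (dot (lam t)^T (fx t *m y) + z t * dot (gx t) y).
Proof.
rewrite /P /costate_rhs !linearD /= linearZ /= !trmxK trmx_mul trmxK !dotDl dotZl.
by rewrite -/(z t) /dot -mulmxA; ring.
Qed.

Lemma dot_switching t (v : 'cV[R]_m) :
  dot (hs t)^T v = dot (lam t)^T (fu t *m v) + dot (Lu t) v.
Proof.
by rewrite /hs /switching linearD /= trmxK trmx_mul trmxK dotDl /dot -mulmxA.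
Qed.

Lemma mmx_hs : mmx hs.
Proof.
have [_ mfu] := mmx_jac hdata hmin; have [hL _ _] := hdata.
have [_ mLu] := mmx_grad hmin hL.
exact: mmx_switching.
Qed.

Lemma hs_bounded : exists2 H, 0 <= H & forall t, I01 t -> `|hs t| <= H.
Proof.
have [hL _ _] := hdata.
have [M M0 hM] := jac_bounded hdata rb; have [N N0 hN] := grad_bounded rb hL.
have L0 : 0 <= Lam.
  have I0 : (I01 : set R) 0 by rewrite /I01 /= lexx ler01.
  exact: le_trans (normr_ge0 _) (lamb I0).
exists (n%:R * M * Lam + N) => [|t It]; first by rewrite addr_ge0// !mulr_ge0.
have [_ fM] := hM t It; have [_ LN] := hN t It.
rewrite (le_trans (ler_normD _ _))// mx_normT lerD//.
rewrite (le_trans (mulmx_norm_le _ _))// mx_normT ler_pM ?mulr_ge0//; last exact: lamb.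
by rewrite ler_wpM2l.
Qed.

(** The integral of [phi = <h, v>] is shown to be at least [- const * e] for every [e > 0]. The
    control variation used for a given [e] is [v] switched off on a band adapted to [e], plus the
    push; the change from [v] costs a multiple of [e]. *)
Lemma stationarity_away_from_zero (eps c delta : R) : 0 < eps -> 0 < c ->
  {ae leb, forall t, I01 t -> delta <= t -> - eps <= gb t -> c <= eucl (gu t)} ->
  {ae leb, forall t, I01 t -> delta <= t -> 0 <= z t /\ hs t + z t *: (gu t)^T = 0}.
Proof.
move=> eps0 c0 reg; have [hL hf hg] := hdata.
have [[_ _ gle _] _] := hmin.
have mgu := mmx_gu; have mgb := measurable_gb; have msq := measurable_sqn.
have misq := measurable_inv_sqn; have mhs := mmx_hs.
have [mgx _] := mmx_grad hmin hg; have mz := L1_measurable iz.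
have [H H0 hsH] := hs_bounded; have [G G0 hG] := grad_bounded rb hg.
have guG t : I01 t -> `|gu t| <= G by move=> It; have [] := hG t It.
have gxG t : I01 t -> `|gx t| <= G by move=> It; have [] := hG t It.
pose k := (c ^+ 2)^-1.
have k0 : 0 <= k by rewrite invr_ge0 exprn_ge0// ltW.
have sqk t : c ^+ 2 <= sqn (gu t) -> (sqn (gu t))^-1 <= k.
  by move=> h; rewrite lef_pV2// posrE ?exprn_gt0// (lt_le_trans _ h)// exprn_gt0.
pose guhs := m%:R * G * H.
have guhs0 : 0 <= guhs by rewrite !mulr_ge0.
have guhsP t : I01 t -> `|dot (gu t) (hs t)| <= guhs.
  move=> It; rewrite (le_trans (dot_le _ _))// ler_pM ?mulr_ge0 ?hsH//.
  by rewrite ler_wpM2l// guG.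
(* A measurable substitute for the regularity hypothesis: it agrees almost everywhere with
   [delta <= t], but gives bounds at every instant. *)
pose good t := (delta <= t) && ((gb t == 0) ==> (c ^+ 2 <= sqn (gu t))).
pose v t : 'cV[R]_m := - ((good t)%:R *: (hs t + Num.max (z t) 0 *: (gu t)^T)).
pose phi t := dot (hs t)^T (v t).
have mdelta : measurable_fun I01 (fun t : R => delta <= t).
  by apply: measurable_fun_ler.
have mc2 : measurable_fun I01 (fun t => c ^+ 2 <= sqn (gu t)).
  by apply: measurable_fun_ler.
have mgood : measurable_fun I01 good.
  apply: measurable_and => //.
  rewrite (_ : (fun t => _) = fun t => ~~ (gb t == 0) || (c ^+ 2 <= sqn (gu t))).
    by apply: measurable_or => //; apply: measurable_neg; exact: measurable_fun_eqr.
  by apply/funext => t; rewrite implybE.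
have mv : mmx v.
  apply: mmxN; apply: mmxZ; first exact: measurable_bool_indicator.
  apply: mmxD; first exact: mhs.
  apply: mmxZ; [exact: measurable_maxr|exact: mmxT].
have zb t : I01 t -> good t -> `|z t| <= k * guhs.
  move=> It /andP[_ gt]; have [g0|g0] := eqVneq (gb t) 0; last first.
    by rewrite (zmult_inactive g0) normr0 mulr_ge0.
  rewrite g0 eqxx /= in gt; rewrite (zmult_active g0) normrN normrM.
  by rewrite ger0_norm ?invr_ge0 ?sqn_ge0// ler_pM ?invr_ge0 ?sqn_ge0 ?sqk ?guhsP.
pose V := H + k * guhs * G.
have V0 : 0 <= V by rewrite addr_ge0// !mulr_ge0.
have vV t : I01 t -> `|v t| <= V.
  move=> It; rewrite normrN normrZ; case: (boolP (good t)) => gt; last first.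
    by rewrite normr0 mul0r.
  rewrite normr1 mul1r (le_trans (ler_normD _ _))// lerD ?hsH//.
  rewrite normrZ mx_normT ler_pM ?guG// (le_trans _ (zb t It gt))//.
  by case: (leP (z t) 0) => _; rewrite ?normr0.
have phiE t : good t -> phi t =
    - (sqn (hs t + z t *: (gu t)^T)^T + Num.min (z t) 0 ^+ 2 * sqn (gu t)).
  move=> gt; rewrite /phi /v gt scale1r -descent_identity.
    by rewrite /dot mulmxN mxE.
  have [g0|g0] := eqVneq (gb t) 0; [right|left; exact: zmult_inactive].
  have /andP[_] := gt; rewrite g0 eqxx /= => csq.
  have s0 : sqn (gu t) != 0 by rewrite gt_eqF// (lt_le_trans _ csq)// exprn_gt0.
  by rewrite zmult_active// mulNr mulrAC mulVf// mul1r.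
have phi_le0 t : phi t <= 0.
  have [gt|gt] := boolP (good t); last first.
    by rewrite /phi /v (negbTE gt) scale0r oppr0 dot0r.
  rewrite phiE// oppr_le0; apply: addr_ge0; first exact: sqn_ge0.
  by apply: mulr_ge0; [exact: sqr_ge0|exact: sqn_ge0].
have phib t : I01 t -> `|phi t| <= m%:R * H * V.
  move=> It; rewrite (le_trans (dot_le _ _))// mx_normT ler_pM ?mulr_ge0 ?vV//.
  by rewrite ler_wpM2l// hsH.
have mphi : measurable_fun I01 phi by apply: mdot => //; exact: mmxT.
have iphi : L1 phi := L1_bounded mphi phib.
(* Bounds for [w] and [K] below that do not involve [eta], thanks to [eta <= 1] and [kN t <= k]. *)
pose Cw := V + k * G; pose Ck := k * (G * G).
have Cw0 : 0 <= Cw by rewrite addr_ge0// mulr_ge0.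
have Ck0 : 0 <= Ck by rewrite !mulr_ge0.
have [C C0 hC] := first_variation hdata hmin rb delta Cw0 Ck0.
have Lam0 : 0 <= Lam.
  have I0 : (I01 : set R) 0 by rewrite /I01 /= lexx ler01.
  exact: le_trans (normr_ge0 _) (lamb I0).
(* Per unit of [s], [C'] bounds the feedback term on the band, and [C4] adds the loss of [phi]
   there. *)
pose C' := k * guhs * (n%:R * G * C).
pose C4 := m%:R * H * V + C'.
have C'0 : 0 <= C' by rewrite !mulr_ge0.
have C40 : 0 <= C4 by rewrite addr_ge0// !mulr_ge0.
(* The constant collects the band ([C4]), the push ([k * guhs]), the linearization of the dynamics
   ([n%:R * Lam]) and the Taylor error of the cost (1). *)
suff key e : 0 < e -> - ((C4 + k * guhs + (n%:R * Lam + 1)) * e) <=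
    \int[leb]_(t in I01) phi t.
  have int0 : 0 <= \int[leb]_(t in I01) phi t.
    pose K := C4 + k * guhs + (n%:R * Lam + 1).
    have K0 : 0 < K.
      have kg0 : 0 <= k * guhs by rewrite mulr_ge0.
      have nL0 : 0 <= n%:R * Lam by rewrite mulr_ge0.
      by rewrite /K; lra.
    apply/ler_addgt0Pr => e e0; have := key (e / K) (divr_gt0 e0 K0); rewrite -/K.
    have -> : K * (e / K) = e by rewrite mulrC divfK// gt_eqF.
    by lra.
  have phi0 := ae_eq0_of_nonpos iphi (fun t _ => phi_le0 t) int0.
  apply: ae_imp (ae_and (ae_and phi0 reg) gle) => t [[p0 regt] gt] It dt.
  have goodt : good t.
    rewrite /good dt /=; apply/implyP => /eqP g0.
    rewrite -sqr_eucl lerXn2r ?nnegrE ?(ltW c0)//; first exact: sqrtr_ge0.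
    by apply: regt => //; rewrite g0 oppr_le0 ltW.
  have := p0 It; rewrite phiE// => /eqP; rewrite oppr_eq0 paddr_eq0; last 2 first.
    exact: sqn_ge0.
    by apply: mulr_ge0; [exact: sqr_ge0|exact: sqn_ge0].
  move=> /andP[/eqP/sqn_eq0 h0 /eqP mn0]; split; last by rewrite -[LHS]trmxK h0 trmx0.
  have [g0|g0] := eqVneq (gb t) 0; last by rewrite zmult_inactive.
  have /andP[_] := goodt; rewrite g0 eqxx /= => csq.
  have s0 : sqn (gu t) != 0 by rewrite gt_eqF// (lt_le_trans _ csq)// exprn_gt0.
  move: mn0 => /eqP; rewrite mulf_eq0 (negbTE s0) orbF sqrf_eq0 => /eqP.
  by case: (leP (z t) 0) => [_ ->|/ltW].
move=> e_gt0.
have e10 : 0 < Num.min 1 eps by rewrite lt_min ltr01.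
have [eta [eta0 etam etae band]] := small_band mgb e10 e_gt0.
have [eta1 etaeps] : eta <= 1 /\ eta <= eps.
  by move: etam; rewrite le_min => /andP[].
(* [N0] is the band where [v] is switched off; [Nb] is the larger near-active set where feedback and
   push act, cut down so that [1 / |gu|^2] is bounded everywhere. *)
pose N0 t := (- eta <= gb t) && (gb t < 0).
pose Nb t := (delta <= t) && ((- eta <= gb t) && (c ^+ 2 <= sqn (gu t))).
pose kN t : R := (Nb t)%:R * (sqn (gu t))^-1.
have mN0 : measurable_fun I01 N0.
  by apply: measurable_and; [exact: measurable_fun_ler|exact: measurable_fun_ltr].
have mkN : measurable_fun I01 kN.
  apply: measurable_funM => //; apply: measurable_bool_indicator.
  apply: measurable_and => //; apply: measurable_and => //.
  exact: measurable_fun_ler.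
have kN0 t : 0 <= kN t by rewrite mulr_ge0// invr_ge0 sqn_ge0.
have kNk t : kN t <= k.
  rewrite /kN; case: (boolP (Nb t)) => [/andP[_ /andP[_ h]]|_]; last by rewrite mul0r.
  by rewrite mul1r sqk.
pose w t : 'cV[R]_m := (~~ N0 t)%:R *: v t - (kN t * eta) *: (gu t)^T.
pose K t : 'M[R]_(m, n) := - (kN t *: ((gu t)^T *m gx t)).
have mw : mmx w.
  apply: mmxD; first apply: mmxZ => //.
    by apply: measurable_bool_indicator; exact: measurable_neg.
  apply: mmxN; apply: mmxZ; last exact: mmxT.
  exact: measurable_funM.
have mK : mmx K by apply: mmxN; apply: mmxZ => //; apply: mmxM => //; exact: mmxT.
have bd t : I01 t -> `|w t| <= Cw /\ `|K t| <= Ck.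
  move=> It; split.
    rewrite (le_trans (ler_normB _ _))// lerD//.
      rewrite normrZ; case: (~~ _); first by rewrite normr1 mul1r vV.
      by rewrite normr0 mul0r.
    have ke0 : 0 <= kN t * eta by rewrite mulr_ge0// ltW.
    rewrite normrZ mx_normT ger0_norm//; apply: ler_pM => //; last exact: guG.
    by apply: le_trans (kNk t); rewrite ler_piMr.
  rewrite normrN normrZ ger0_norm// ler_pM//.
  by rewrite (le_trans (mulmx_norm_le _ _))// mul1r mx_normT ler_pM// ?guG ?gxG.
have van t : I01 t -> t < delta -> w t = 0 /\ K t = 0.
  move=> It td; have dt : (delta <= t) = false by rewrite leNgt td.
  by rewrite /w /K /v /kN /Nb /good dt /= !(mul0r, scale0r, oppr0, scaler0, subr0).
have act : {ae leb, forall t, I01 t -> delta <= t -> gb t <= - eta \/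
    (dot (gu t) (w t) <= - eta /\ gx t + gu t *m K t = 0)}.
  apply: ae_imp (ae_and gle reg) => t [gt regt] It dt.
  have gt0 : gb t <= 0 := gt It.
  have [geta|geta] := leP (gb t) (- eta); [by left|right].
  have csq : c ^+ 2 <= sqn (gu t).
    rewrite -sqr_eucl lerXn2r ?nnegrE ?(ltW c0)//; first exact: sqrtr_ge0.
    by apply: regt => //; rewrite (le_trans _ (ltW geta))// lerN2.
  have s0 : sqn (gu t) != 0 by rewrite gt_eqF// (lt_le_trans _ csq)// exprn_gt0.
  have Nbt : Nb t by rewrite /Nb dt (ltW geta) csq.
  split; last first.
    rewrite /K mulmxN -scalemxAr row_outer scalerA /kN Nbt mul1r mulVf// scale1r.
    by rewrite subrr.
  rewrite /w dotBr !dotZr -/(sqn _) /kN Nbt mul1r mulrAC mulVf// mul1r.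
  have [N0t|N0t] := boolP (N0 t); first by rewrite mul0r sub0r.
  have g0 : gb t = 0.
    apply/eqP; rewrite eq_le gt0 /= leNgt; apply: contra N0t => gneg.
    by rewrite /N0 (ltW geta).
  have goodt : good t by rewrite /good dt g0 eqxx.
  (* Since [dot (gu t) (hs t) = - z t * sqn (gu t)] on the active set, the positive part of [z] is
     what keeps [v] from increasing [g] to first order. *)
  have -> : dot (gu t) (v t) = - ((Num.max (z t) 0 - z t) * sqn (gu t)).
    rewrite /v goodt scale1r /dot mulmxN mxE -/(dot _ _) dotDr dotZr -/(sqn _).
    congr (- _); rewrite mulrBl addrC; congr (_ + _).
    by rewrite (zmult_active g0) mulNr opprK mulrAC mulVf// mul1r.
  rewrite mul1r gerDr oppr_le0; apply: mulr_ge0; last exact: sqn_ge0.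
  by rewrite subr_ge0 le_max lexx.
have [s [y [rr [[s0 my yb y0] irr yE rrE J0]]]] := hC w K eta mw mK bd van eta0 act e e_gt0.
have [i1 i2 dual] := costate_duality my yb irr yE.
have [mfx mfu] := mmx_jac hdata hmin; have [mLx mLu] := mmx_grad hmin hL.
have [F F0 hF] := jac_bounded hdata rb; have [A A0 hA] := grad_bounded rb hL.
pose ups t := s *: w t + K t *m y t.
have mups : mmx ups by apply: mmxD; [exact: mmxZ|exact: mmxM].
have upsb t : I01 t -> `|ups t| <= s * Cw + n%:R * Ck * (C * s).
  move=> It; have [wC KC] := bd t It; rewrite (le_trans (ler_normD _ _))// lerD//.
    by rewrite normrZ gtr0_norm// ler_wpM2l// ltW.
  rewrite (le_trans (mulmx_norm_le _ _))// ler_pM ?mulr_ge0// ?yb//.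
  by rewrite ler_wpM2l.
have iLu : L1 (fun t => dot (Lu t) (ups t)).
  by apply: (L1_dot mLu mups _ upsb) => t It; have [_ h] := hA t It; exact: h.
have ifx : L1 (fun t => dot (lam t)^T (fx t *m y t)).
  apply: (L1_dot (A := Lam) (V := n%:R * F * (C * s)) (mmxT mlam) (mmxM mfx my)) => t It.
    by rewrite mx_normT lamb.
  have [fF _] := hF t It.
  rewrite (le_trans (mulmx_norm_le _ _))// ler_pM ?mulr_ge0// ?yb//.
  by rewrite ler_wpM2l.
have izg : L1 (fun t => z t * dot (gx t) (y t)).
  apply: (L1M_bounded (M := n%:R * G * (C * s)) iz); first exact: mdot.
  move=> t It; rewrite (le_trans (dot_le _ _))// ler_pM ?mulr_ge0// ?yb//.
  by rewrite ler_wpM2l// gxG.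
(* [dot_costate] expresses [dot (Lx t) (y t)] through [P], and duality trades the [P] term for
   [dot (lam t)^T (rr t)]; [Q] is what remains, and its [fx] term will cancel against the linearized
   dynamics. *)
pose Q t := dot (Lu t) (ups t) -
  (dot (lam t)^T (fx t *m y t) + z t * dot (gx t) (y t)).
have iQ : L1 Q by apply: L1B => //; exact: L1D.
have Jeq : \int[leb]_(t in I01) (dot (Lx t) (y t) + dot (Lu t) (ups t)) =
    \int[leb]_(t in I01) (dot (lam t)^T (rr t) + Q t).
  rewrite [RHS]RintegralD// dual -RintegralD//; apply: eq_Rintegral => t _.
  by rewrite dot_costate /Q; ring.
pose bound t := s * (phi t + (C4 * (N0 t)%:R + (k * guhs * eta + n%:R * Lam * e))).
have iN0 : L1 (fun t => (N0 t)%:R).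
  apply: (L1_bounded (M := 1) (measurable_bool_indicator mN0)) => t _.
  by case: (N0 t); rewrite ?normr1 ?normr0.
have iC4 : L1 (fun t => C4 * (N0 t)%:R) by exact: L1Z.
have iD : L1 (fun t => C4 * (N0 t)%:R + (k * guhs * eta + n%:R * Lam * e)).
  by apply: L1D => //; exact: L1_cst.
have ibound : L1 bound by apply: L1Z; exact: L1D.
have le_bound : {ae leb, forall t, I01 t -> dot (lam t)^T (rr t) + Q t <= bound t}.
  apply: ae_imp (ae_and gle reg) => t [gt regt] It.
  have gt0 : gb t <= 0 := gt It.
  have rr_le : dot (lam t)^T (rr t) <= dot (lam t)^T (fx t *m y t) +
      dot (lam t)^T (fu t *m ups t) + s * (n%:R * Lam * e).
    have -> : dot (lam t)^T (rr t) = dot (lam t)^T (fx t *m y t) +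
        dot (lam t)^T (fu t *m ups t) +
        dot (lam t)^T (rr t - (fx t *m y t + fu t *m ups t)).
      by rewrite dotBr dotDr; ring.
    rewrite lerD2l.
    rewrite (le_trans (ler_norm _))// (le_trans (dot_le _ _))// mx_normT.
    rewrite (_ : s * _ = n%:R * Lam * (e * s)); last by ring.
    by rewrite ler_pM ?mulr_ge0// ?rrE// ler_wpM2l// lamb.
  have sw := dot_switching t (ups t).
  have hsgu : dot (hs t)^T (gu t)^T = dot (gu t) (hs t) by rewrite dotC trmxK.
  have := guhsP t It; rewrite ler_norml => /andP[gh1 gh2].
  have hw : dot (hs t)^T (w t) <= phi t + (m%:R * H * V * (N0 t)%:R + k * guhs * eta).
    rewrite /w dotBr !dotZr hsgu -/(phi t) addrA.
    apply: lerD.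
      have := phib t It; rewrite ler_norml => /andP[p1 p2].
      case: (N0 t); rewrite /= ?mul0r ?mul1r ?mulr0 ?mulr1 ?addr0//.
      by rewrite -lerBlDr sub0r.
    rewrite (_ : k * guhs * eta = k * eta * guhs); last by ring.
    rewrite -mulrN; apply: (@le_trans _ _ (kN t * eta * guhs)).
      by apply: ler_wpM2l; [rewrite mulr_ge0// ltW|rewrite lerNl].
    by rewrite ler_wpM2r// ler_wpM2r ?kNk// ltW.
  (* On the active set [kN] is [1 / |gu|^2], and the feedback term equals [z t * dot (gx t) (y t)]
     exactly. Off the near-active set both vanish, and before [delta] so does [y]; only the band
     leaves an error. *)
  have hK : dot (hs t)^T (K t *m y t) - z t * dot (gx t) (y t) <= s * (C' * (N0 t)%:R).
    have sC : 0 <= s * (C' * (N0 t)%:R) by rewrite mulr_ge0 ?mulr_ge0// ltW.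
    have -> : dot (hs t)^T (K t *m y t) =
        - (kN t * (dot (gu t) (hs t) * dot (gx t) (y t))).
      by rewrite /K mulNmx -scalemxAl -scaleNr dotZr dot_outer hsgu mulNr.
    have [td|dt] := ltP t delta.
      by rewrite y0// !dot0r !mulr0 oppr0 addr0.
    have [g0|g0] := eqVneq (gb t) 0.
      have csq : c ^+ 2 <= sqn (gu t).
        rewrite -sqr_eucl lerXn2r ?nnegrE ?(ltW c0)//; first exact: sqrtr_ge0.
        by apply: regt => //; rewrite g0 oppr_le0 ltW.
      have -> : kN t = (sqn (gu t))^-1.
        by rewrite /kN /Nb dt g0 oppr_le0 (ltW eta0) csq mul1r.
      rewrite (zmult_active g0); apply: le_trans sC; rewrite le_eqVlt; apply/orP; left.
      by apply/eqP; ring.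
    rewrite zmult_inactive// mul0r subr0.
    have [N0t|N0t] := boolP (N0 t); last first.
      have -> : kN t = 0; last by rewrite mul0r oppr0 mulr0 mulr0.
      rewrite /kN /Nb (_ : (- eta <= gb t) = false) ?andbF ?mul0r//.
      by apply: contraNF N0t => ge; rewrite /N0 ge lt_neqAle g0.
    rewrite mulr1 (le_trans (ler_norm _))// normrN normrM ger0_norm//.
    rewrite (_ : s * C' = k * (guhs * (n%:R * G * (C * s)))); last by rewrite /C'; ring.
    rewrite ler_pM// ?kNk// normrM ler_pM// ?guhsP//.
    rewrite (le_trans (dot_le _ _))// ler_pM ?mulr_ge0// ?yb//.
    by rewrite ler_wpM2l// gxG.
  have shw := ler_wpM2l (ltW s0) hw.
  have upsE : dot (hs t)^T (ups t) =
      s * dot (hs t)^T (w t) + dot (hs t)^T (K t *m y t) by rewrite dotDr dotZr.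
  have fuE : dot (lam t)^T (fu t *m ups t) =
      s * dot (hs t)^T (w t) + dot (hs t)^T (K t *m y t) - dot (Lu t) (ups t).
    by rewrite -upsE sw addrK.
  rewrite fuE in rr_le; apply: le_trans (lerD rr_le (lexx (Q t))) _.
  apply: (@le_trans _ _ (s * dot (hs t)^T (w t) +
      (dot (hs t)^T (K t *m y t) - z t * dot (gx t) (y t)) + s * (n%:R * Lam * e))).
    by rewrite le_eqVlt; apply/orP; left; apply/eqP; rewrite /Q; ring.
  apply: le_trans (lerD (lerD shw hK) (lexx _)) _.
  by rewrite le_eqVlt; apply/orP; left; apply/eqP; rewrite /bound /C4; ring.
have J1 := ae_le_Rintegral (L1D i1 iQ) ibound le_bound.
move: J0; rewrite -/(ups _) [X in 0 <= X + _]Jeq => J0.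
have J2 : \int[leb]_(t in I01) bound t = s * (\int[leb]_(t in I01) phi t +
    (C4 * \int[leb]_(t in I01) (N0 t)%:R + (k * guhs * eta + n%:R * Lam * e))).
  rewrite RintegralZl//; last exact: L1D.
  rewrite RintegralD// RintegralD//; last exact: L1_cst.
  by rewrite RintegralZl// Rintegral_cst// [X in fine X]leb_I01 mulr1.
have J3 : 0 <= s * (\int[leb]_(t in I01) phi t +
    (C4 * \int[leb]_(t in I01) (N0 t)%:R + (k * guhs * eta + n%:R * Lam * e)) + e).
  by rewrite mulrDr -J2 (le_trans J0)// [e * s]mulrC lerD2r.
(* Dividing by [s] removes the size of the perturbation, on whose dependence on [e] there is no
   control. *)
rewrite pmulr_rge0// in J3.
have kg0 : 0 <= k * guhs by rewrite mulr_ge0.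
by move: J3 (ler_wpM2l C40 band) (ler_wpM2l kg0 etae); lra.
Qed.

End stationarity.

(** * Integrability from the bound by [1 / omega] *)

Section inverse_weight.
Context {R : realType}.

Lemma antitone_measurable (D : set R) (h : R -> R) : is_interval D ->
  (forall s t, D s -> D t -> s <= t -> h t <= h s) -> measurable_fun D h.
Proof.
move=> iD hh mD; apply: (measurability (@RGenCInfty.G R)) => //.
  exact: RGenCInfty.measurableE.
move=> /= _ [_] [q] -> <-.
apply: is_interval_measurable => s t/=.
rewrite !in_itv/= !andbT => -[Ds hs] [Dt ht] u /andP[su ut].
have Du : D u by apply: (iD s t) => //; rewrite su.
by split => //; rewrite in_itv/= andbT (le_trans ht)// hh.
Qed.

Lemma entry_le_eucl p q (v : 'M[R]_(p, q)) : `|v| <= eucl v.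
Proof.
apply: mx_norm_le; first exact: sqrtr_ge0.
move=> i j; rewrite -sqrtr_sqr ler_wsqrtr// (bigD1 i)//= (bigD1 j)//= -addrA lerDl.
by rewrite addr_ge0 ?sumr_ge0// => *; rewrite ?sumr_ge0// ?sqr_ge0// => *; rewrite sqr_ge0.
Qed.

(** Domination on []0, 1]]: [1 / omega] is measurable there because it is nonincreasing, and the
    instant 0 is a null set. *)
Lemma L1_of_ae_inverse_bound (b omega : R -> R) : measurable_fun I01 b ->
  (forall t, 0 <= b t) ->
  (forall t, 0 < t <= 1 -> 0 < omega t) ->
  (forall s t, 0 < s -> s <= t -> t <= 1 -> omega s <= omega t) ->
  (\int[leb]_(t in `]0%R, 1%R]) ((omega t)^-1)%:E < +oo)%E ->
  {ae leb, forall t, I01 t -> 0 < t -> b t <= (omega t)^-1} -> L1 b.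
Proof.
move=> mb b0 om0 omnd omint bom.
have sub : `]0, 1]%classic `<=` (I01 : set R).
  by move=> t /=; rewrite in_itv /= => /andP[/ltW t0 t1]; rewrite /I01 /= t0.
apply/integrableP; split; first exact/measurable_EFinP.
have mb' : measurable_fun (`]0, 1]%classic : set R) (fun t => `|(EFin \o b) t|%E).
  apply: measurableT_comp => //; apply/measurable_EFinP.
  exact: (measurable_funS measurable_I01 sub mb).
rewrite I01E -integral_itv_obnd_cbnd//; apply: le_lt_trans omint.
apply: ae_ge0_le_integral => //.
- move=> t /=; rewrite in_itv /= => t01.
  by rewrite lee_fin invr_ge0 ltW// om0.
- apply/measurable_EFinP; apply: antitone_measurable; first exact: interval_is_interval.
  move=> s t /=; rewrite !in_itv /= => /andP[s0 s1] /andP[t0 t1] st.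
  by rewrite lef_pV2 ?posrE ?om0 ?s0 ?t0// omnd.
- apply: ae_imp bom => t bt; rewrite /= in_itv /= => /andP[t0 t1].
  by rewrite lee_fin ger0_norm// bt// /I01 /= (ltW t0).
Qed.

End inverse_weight.

Section normal_multipliers.
Context {R : realType} {n m : nat}.
Variables (L : R -> 'cV[R]_n -> 'cV[R]_m -> R).
Variables (f : R -> 'cV[R]_n -> 'cV[R]_m -> 'cV[R]_n).
Variables (g : R -> 'cV[R]_n -> 'cV[R]_m -> R).
Variables (x0 : 'cV[R]_n) (xb : R -> 'cV[R]_n).
Hypothesis hdata : problem_data L f g.
Variables (eps : R) (omega : R -> R).
Hypothesis heps : 0 < eps.
Hypothesis om0 : forall t, 0 < t <= 1 -> 0 < omega t.
Hypothesis omnd : forall s t, 0 < s -> s <= t -> t <= 1 -> omega s <= omega t.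
Hypothesis omint : (\int[leb]_(t in `]0%R, 1%R]) ((omega t)^-1)%:E < +oo)%E.

Definition regular (ub : R -> 'cV[R]_m) :=
  {ae leb, forall t, I01 t -> - eps <= along g xb ub t ->
     omega t <= eucl (along (grad_u g) xb ub t)}.

(** The conditions for [lam0 = 1] and zero charge. Adjoint equation and terminal condition are
    stored as one integral identity, the form in which the Volterra theorem supplies them. *)
Definition normal_multiplier (ub : R -> 'cV[R]_m) (lam : R -> 'cV[R]_n) (z : R -> R) :=
  [/\ mmx lam, L1 z,
    forall i, L1 (fun s => adjoint_density L f g xb ub lam 1 z s i ord0),
    forall t i, I01 t -> lam t i ord0 =
      \int[leb]_(s in `[t, 1]) adjoint_density L f g xb ub lam 1 z s i ord0 &
    {ae leb, forall t, I01 t -> [/\ 0 <= z t, z t * along g xb ub t = 0 &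
      0 = (along (jac_u f) xb ub t)^T *m lam t
        + 1 *: (along (grad_u L) xb ub t)^T + z t *: (along (grad_u g) xb ub t)^T]}].

Lemma normal_multiplier_bounded ub r :
  weak_local_minimizer L f g x0 xb ub ->
  (forall t, I01 t -> `|xb t| <= r /\ `|ub t| <= r) -> regular ub ->
  exists lam z, normal_multiplier ub lam z.
Proof.
move=> hmin rb reg; have [hL hf hg] := hdata.
have [mfx mfu] := mmx_jac hdata hmin; have [mLx mLu] := mmx_grad hmin hL.
have [mgx mgu] := mmx_grad hmin hg.
have [F F0 hF] := jac_bounded hdata rb; have [A A0 hA] := grad_bounded rb hL.
have [G G0 hG] := grad_bounded rb hg.
pose kap := active_weight g xb ub.
pose gb := along g xb ub; pose gu := along (grad_u g) xb ub.
(* On the active set this is [1 / |gu|], hence at most [1 / omega] almost everywhere; elsewhere it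
   is 0. *)
pose b t := (gb t == 0)%:R * (eucl (gu t))^-1.
have mb : measurable_fun I01 b.
  apply: measurable_funM.
    apply: measurable_bool_indicator; apply: measurable_fun_eqr => //.
    exact: measurable_gb hdata hmin.
  apply: measurable_inv_nneg => [|t _]; last exact: sqrtr_ge0.
  apply: (@eq_measurable_fun _ _ _ _ _ (fun t => Num.sqrt (sqn (gu t)))).
    by move=> t _; rewrite -sqr_eucl sqrtr_sqr ger0_norm// sqrtr_ge0.
  have ms := continuous_measurable_fun (@sqrt_continuous R).
  exact: (measurableT_comp ms (measurable_sqn hdata hmin)).
have b0 t : 0 <= b t by rewrite mulr_ge0// invr_ge0 sqrtr_ge0.
have ib : L1 b.
  apply: (L1_of_ae_inverse_bound mb b0 om0 omnd omint).
  apply: ae_imp reg => t regt It t0; have /andP[_ t1] := It.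
  have omt : 0 < omega t by rewrite om0// t0.
  rewrite /b; have [g0|g0] := eqVneq (gb t) 0; last by rewrite mul0r invr_ge0 ltW.
  have omle : omega t <= eucl (gu t).
    by apply: regt => //; rewrite -[along _ _ _ _]/(gb t) g0 oppr_le0 ltW.
  by rewrite mul1r lef_pV2// posrE// (lt_le_trans omt).
have kap0 t : 0 <= kap t by rewrite mulr_ge0// invr_ge0 sqn_ge0.
have kb t : I01 t -> kap t * `|gu t| <= b t.
  move=> _; rewrite /kap /active_weight -mulrA ler_wpM2l// -sqr_eucl.
  have [->|e0] := eqVneq (eucl (gu t)) 0; first by rewrite expr0n /= invr0 mul0r.
  rewrite expr2 invfM -mulrA ler_piMr ?invr_ge0 ?sqrtr_ge0//.
  rewrite mulrC ler_pdivrMr ?mul1r ?entry_le_eucl//.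
  by rewrite lt_neqAle eq_sym e0 sqrtr_ge0.
have [||s Is|lam [Lam [mlam lamb iP iz lamE]]] := costate_exists mfx mfu mLx mgx mLu
  mgu (measurable_active_weight hdata hmin) kap0 ib (addr_ge0 F0 (addr_ge0 A0 G0)) _ _ _ kb.
- by move=> s Is; have [h1 h2] := hF s Is; split; [rewrite (le_trans h1)|rewrite (le_trans h2)];
    rewrite // lerDl addr_ge0.
- move=> s Is; have [h1 _] := hA s Is; have [h2 _] := hG s Is.
  by split; [rewrite (le_trans h1)|rewrite (le_trans h2)]; rewrite //; lra.
- by have [_ h] := hA s Is; rewrite (le_trans h)//; lra.
exists lam, (fun s => zmult (along (jac_u f) xb ub) (along (grad_u L) xb ub) gu kap s (lam s)).
have adE s : adjoint_density L f g xb ub lam 1 (fun s => zmult (along (jac_u f) xb ub)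
    (along (grad_u L) xb ub) gu kap s (lam s)) s = costate_rhs (along (jac_x f) xb ub)
    (along (jac_u f) xb ub) (along (grad_x L) xb ub) (along (grad_x g) xb ub)
    (along (grad_u L) xb ub) gu kap s (lam s).
  by rewrite /adjoint_density scale1r.
split=> //.
- by move=> i; apply: eq_L1 (iP i) => s _; rewrite adE.
- by move=> t i It; rewrite (lamE t i It); apply: eq_Rintegral => s _; rewrite adE.
(* By monotonicity [omega k.+1%:R^-1] is a constant lower bound for [|gu|] near the active set on
   [[1 / k.+1, 1]]. *)
have tail k : {ae leb, forall t, I01 t -> k.+1%:R^-1 <= t ->
    0 <= zmult (along (jac_u f) xb ub) (along (grad_u L) xb ub) gu kap t (lam t) /\
    switching (along (jac_u f) xb ub) (along (grad_u L) xb ub) t (lam t) +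
    zmult (along (jac_u f) xb ub) (along (grad_u L) xb ub) gu kap t (lam t) *: (gu t)^T = 0}.
  have k0 : 0 < k.+1%:R^-1 :> R by rewrite invr_gt0.
  have k1 : k.+1%:R^-1 <= 1 :> R by rewrite invf_le1 ?ler1n.
  have omk : 0 < omega k.+1%:R^-1 by rewrite om0// k0.
  apply: (stationarity_away_from_zero hdata hmin rb mlam lamb iP iz lamE heps omk).
  apply: ae_imp reg => t regt It kt ge; have /andP[_ t1] := It.
  by rewrite (le_trans _ (regt It ge))// omnd.
have nz : {ae leb, forall t : R, t != 0}.
  apply: negligibleS (_ : leb.-negligible [set (0 : R)]).
    by move=> t /= /negP; rewrite negbK => /eqP.
  by apply/negligibleP => //; exact: lebesgue_measure_set1.
(* Countably many exceptional null sets and the instant 0 are discarded together; any other instant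
   lies in one of the tails. *)
apply: ae_imp (ae_and (ae_foralln tail) nz) => t [tl t0] It.
have [k kt] : exists k : nat, k.+1%:R^-1 <= t.
  have tp : 0 < t by rewrite lt_neqAle eq_sym t0; have /andP[] := It.
  exists (Num.truncn t^-1); rewrite -[leRHS]invrK lef_pV2 ?posrE ?invr_gt0//.
  exact/ltW/truncnS_gt.
have [z0 hz] := tl k It kt; split=> //.
  have [g0|g0] := eqVneq (gb t) 0; first by rewrite -[along g xb ub t]/(gb t) g0 mulr0.
  by rewrite (zmult_inactive L f lam g0) mul0r.
by rewrite scale1r -hz.
Qed.

(** The estimates on boxes need a bound on the control at every instant, whereas the essential norm
    gives it almost everywhere; the control is set to 0 where it is too large. *)
Lemma Linfty_bounded_modification (ub : R -> 'cV[R]_m) : Linfty ub ->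
  exists (ub' : R -> 'cV[R]_m) (M : R),
    [/\ mmx ub', forall t, `|ub' t| <= M &
      {ae leb, forall t, I01 t -> ub' t = ub t}].
Proof.
move=> [mu lu].
have [M M0 /ess_supP hM] : exists2 M : R, 0 <= M & (Linfty_norm ub <= M%:E)%E.
  case: (Linfty_norm ub) lu => [q _| |_] //.
    by exists `|q| => //; rewrite lee_fin ler_norm.
  by exists 0 => //; rewrite leNye.
(* Comparing squares makes the test measurable as a condition on a polynomial in the entries. *)
pose good t := \sum_i ub t i ord0 ^+ 2 <= M ^+ 2.
have ue t : eucl (ub t) ^+ 2 = \sum_i ub t i ord0 ^+ 2.
  rewrite /eucl sqr_sqrtr.
    by apply: eq_bigr => i _; rewrite big_ord1.
  by apply: sumr_ge0 => i _; apply: sumr_ge0 => j _; rewrite sqr_ge0.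
have goodE t : good t = (eucl (ub t) <= M).
  by rewrite /good -ue ler_pXn2r// ?nnegrE// sqrtr_ge0.
exists (fun t => (good t)%:R *: ub t), M; split.
- apply: mmxZ; last exact/mmx_mvec.
  apply: measurable_bool_indicator; apply: measurable_fun_ler => //.
  apply: measurable_sum => i; apply: measurable_funX; exact: mu.
- move=> t; rewrite normrZ goodE; case: (leP (eucl (ub t)) M) => h.
    by rewrite normr1 mul1r (le_trans (entry_le_eucl _)).
  by rewrite normr0 mul0r.
- apply: ae_imp hM => t; rewrite patchE => h It; move: h; rewrite mem_set//.
  by rewrite lee_fin goodE => ->; rewrite scale1r.
Qed.

Lemma ae_eq_L1 (h a : R -> R) : measurable_fun I01 h -> L1 a ->
  {ae leb, forall t, I01 t -> a t = h t} -> L1 h.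
Proof.
move=> mh ia ah; have ma := L1_measurable ia; apply/integrableP; split.
  exact/measurable_EFinP.
have /integrableP[_] := ia; congr (_ < _)%E; apply: ae_eq_integral => //.
- by apply: measurableT_comp => //; exact/measurable_EFinP.
- by apply: measurableT_comp => //; exact/measurable_EFinP.
- by apply: ae_imp ah => t aht It /=; rewrite aht.
Qed.

Lemma ae_eq_Rintegral (D : set (measurableTypeR R)) (h a : R -> R) :
  measurable D -> D `<=` I01 -> measurable_fun I01 h -> measurable_fun I01 a ->
  {ae leb, forall t, I01 t -> a t = h t} ->
  \int[leb]_(t in D) a t = \int[leb]_(t in D) h t.
Proof.
move=> mD DI mh ma ah; congr fine; apply: ae_eq_integral => //.
- by apply/measurable_EFinP; exact: (measurable_funS measurable_I01 DI ma).
- by apply/measurable_EFinP; exact: (measurable_funS measurable_I01 DI mh).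
- by apply: ae_imp ah => t aht Dt; rewrite aht//; exact: DI.
Qed.

End normal_multipliers.

(** * Passage between controls that are equal almost everywhere *)

Section transfer.
Context {R : realType} {n m : nat}.
Variables (L : R -> 'cV[R]_n -> 'cV[R]_m -> R).
Variables (f : R -> 'cV[R]_n -> 'cV[R]_m -> 'cV[R]_n).
Variables (g : R -> 'cV[R]_n -> 'cV[R]_m -> R).
Variables (x0 : 'cV[R]_n) (xb : R -> 'cV[R]_n).
Hypothesis hdata : problem_data L f g.

Lemma weak_local_minimizer_ae (ub ub' : R -> 'cV[R]_m) M :
  weak_local_minimizer L f g x0 xb ub -> mmx ub' -> (forall t, `|ub' t| <= M) ->
  {ae leb, forall t, I01 t -> ub' t = ub t} ->
  weak_local_minimizer L f g x0 xb ub'.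
Proof.
move=> hmin mub' ub'M ubE; have [[[v xv vE] lu gle x0E] [e e0 opt]] := hmin.
have M0 : 0 <= M := le_trans (normr_ge0 _) (ub'M 0).
split.
  split => //.
  - exists v => //; apply: ae_imp (ae_and vE ubE) => t [vt ut] It.
    by rewrite vt// /along ut.
  - split; first exact/mmx_mvec.
    exact: le_lt_trans (Linfty_norm_le M0 (fun t _ => ub'M t)) (ltry _).
  - by apply: ae_imp (ae_and gle ubE) => t [gt ut] It; rewrite /along ut//; exact: gt.
exists e; [exact: e0|move=> x u ad xe ue]; have [hL _ _] := hdata; have [cL _ _ _] := hL.
have mx := (mmx_mvec _).1 (mmx_state hmin).
have -> : cost L xb ub' = cost L xb ub.
  apply: ae_eq_Rintegral => //.
  - exact: (measurable_along cL mx ((mmx_mvec _).1 (mmx_control hmin))).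
  - exact: (measurable_along cL mx ((mmx_mvec _).1 mub')).
  - by apply: ae_imp ubE => t ut It; rewrite /along ut.
apply: (opt x u ad xe); apply: le_lt_trans ue; apply: le_ess_sup.
apply: ae_imp ubE => t ut; rewrite !patchE; case: ifPn => // It.
by rewrite ut//; rewrite inE in It.
Qed.

Lemma state_bounded ub : weak_local_minimizer L f g x0 xb ub ->
  exists2 r, 0 <= r & forall t, I01 t -> `|xb t| <= r.
Proof.
move=> [[[v xv _] _ _ _] _].
have [i|i M M' hM MM' t It|r r0 hr] := @finite_uniform_upper R n
    (fun i M => forall t, I01 t -> `|xb t i ord0| <= M).
- have [M hM] := within_continuous_bounded (W11_continuous (i := i) xv).
  exists `|M| => // t It; exact: le_trans (hM t It) (ler_norm _).
- exact: le_trans (hM t It) MM'.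
- by exists r => // t It; apply: mx_norm_le => // i j; rewrite (ord1 j) hr.
Qed.

Lemma mmx_adjoint_density ub lam z : weak_local_minimizer L f g x0 xb ub ->
  mmx lam -> measurable_fun I01 z -> mmx (adjoint_density L f g xb ub lam 1 z).
Proof.
move=> hmin mlam mz; have [hL hf hg] := hdata.
have [mfx _] := mmx_jac hdata hmin; have [mLx _] := mmx_grad hmin hL.
have [mgx _] := mmx_grad hmin hg.
apply: mmxD; first apply: mmxD.
- by apply: mmxM => //; exact: mmxT.
- by apply: mmxZ => //; exact: mmxT.
- by apply: mmxZ => //; exact: mmxT.
Qed.

(** The multipliers are built for a bounded representative of the control. Going back alters the
    adjoint density on a null set only, hence none of the integrals that define [lam]. *)
Lemma normal_multiplier_exists ub (eps : R) (omega : R -> R) : 0 < eps ->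
  (forall t, 0 < t <= 1 -> 0 < omega t) ->
  (forall s t, 0 < s -> s <= t -> t <= 1 -> omega s <= omega t) ->
  (\int[leb]_(t in `]0%R, 1%R]) ((omega t)^-1)%:E < +oo)%E ->
  weak_local_minimizer L f g x0 xb ub -> regular g xb eps omega ub ->
  exists lam z, normal_multiplier L f g xb ub lam z.
Proof.
move=> eps0 om0 omnd omint hmin reg; have [[_ lu _ _] _] := hmin.
have [ub' [M [mub' ub'M ubE]]] := Linfty_bounded_modification lu.
have hmin' := weak_local_minimizer_ae hmin mub' ub'M ubE.
have [r0 r00 hr0] := state_bounded hmin.
have M0 : 0 <= M := le_trans (normr_ge0 _) (ub'M 0).
have rb t : I01 t -> `|xb t| <= r0 + M /\ `|ub' t| <= r0 + M.
  by move=> It; split; [rewrite ler_wpDr// hr0|rewrite ler_wpDl].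
have reg' : regular g xb eps omega ub'.
  by apply: ae_imp (ae_and reg ubE) => t [rt ut] It; rewrite /along ut//; exact: rt.
have [lam [z [mlam iz iad lamE ae]]] :=
  normal_multiplier_bounded hdata eps0 om0 omnd omint hmin' rb reg'.
have mz := L1_measurable iz.
have mad := mmx_adjoint_density hmin mlam mz.
have mad' := mmx_adjoint_density hmin' mlam mz.
have adE i : {ae leb, forall t, I01 t -> adjoint_density L f g xb ub' lam 1 z t i ord0 =
    adjoint_density L f g xb ub lam 1 z t i ord0}.
  by apply: ae_imp ubE => t ut It; rewrite /adjoint_density /along ut.
exists lam, z; split; [exact: mlam|exact: iz| | |].
- by move=> i; exact: ae_eq_L1 (mad i ord0) (iad i) (adE i).
- move=> t i It; rewrite (lamE t i It).
  exact: (ae_eq_Rintegral (measurable_itv _) (subI01r It) (mad i ord0) (mad' i ord0) (adE i)).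
- apply: ae_imp (ae_and ae ubE) => t [aet ut] It.
  by have := aet It; rewrite /along ut.
Qed.

End transfer.

(** * Multiplier tuples with vanishing charge *)

Section vanishing_charge.
Context {R : realType}.

(** Clipping the lower bound gives tail integrals their usual properties on
    the whole line, which [bounded_variation] and one-sided limits refer to. *)
Definition clip01 (t : R) : R := Num.max 0 (Num.min t 1).

Lemma clip01_id t : I01 t -> clip01 t = t.
Proof. by move=> /andP[t0 t1]; rewrite /clip01 min_l// max_r. Qed.

Lemma clip01_I01 t : I01 (clip01 t).
Proof. by rewrite /I01 /clip01 /= le_max lexx ge_max ler01 ge_min lexx orbT. Qed.

(** Tail integrals of the positive and negative parts of [p] are monotone in [t], and the tail
    integral of [p] is their difference. *)
Lemma tail_bounded_variation (p : R -> R) : L1 p ->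
  bounded_variation 0 1 (fun t => \int[leb]_(s in `[clip01 t, 1]) p s).
Proof.
move=> ip; have mp := L1_measurable ip.
have nneg (q : R -> R) : L1 q -> (forall t, 0 <= q t) ->
    bounded_variation 0 1 (\- (fun t => \int[leb]_(s in `[clip01 t, 1]) q s)).
  move=> iq q0; apply: nondecreasing_bounded_variation => s t.
  rewrite !in_itv /= => Is It st; rewrite lerN2 !clip01_id//.
  rewrite (Rintegral_restrict _ (subI01r Is)) (Rintegral_restrict _ (subI01r It)).
  have iqi u : L1 (fun r => q r * \1_(`[u, 1]%classic : set R) r).
    apply: (L1M_bounded (M := 1) iq); first exact: measurable_indic.
    by move=> r _; rewrite indicE; case: (_ \in _); rewrite ?normr1 ?normr0.
  apply: le_Rintegral => // [||r Ir]; [exact: iqi|exact: iqi|].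
  rewrite ler_wpM2l// !indicE ler_nat; case: (boolP (r \in `[t, 1]%classic)) => // rt.
  rewrite mem_set//; move: rt; rewrite inE /= !in_itv /= => /andP[tr ->].
  by rewrite (le_trans st tr).
pose p1 t := Num.max (p t) 0; pose p2 t := Num.max (- p t) 0.
have ip1 : L1 p1.
  apply: (L1_le _ (integrable_norm ip)); first exact: measurable_maxr.
  by move=> t _; rewrite /p1 /=; case: (leP (p t) 0); rewrite ?normr0.
have ip2 : L1 p2.
  apply: (L1_le _ (integrable_norm ip)).
    by apply: measurable_maxr => //; exact: measurableT_comp.
  by move=> t _; rewrite /p2 /=; case: (leP (- p t) 0); rewrite ?normr0 ?normrN.
have -> : (fun t => \int[leb]_(s in `[clip01 t, 1]) p s) =
    (\- (\- (fun t => \int[leb]_(s in `[clip01 t, 1]) p1 s))) \+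
    (\- (fun t => \int[leb]_(s in `[clip01 t, 1]) p2 s)).
  apply/funext => t /=; rewrite opprK.
  rewrite -RintegralB//; last 2 first.
    by apply: L1_sub => //; exact: subI01r (clip01_I01 t).
    by apply: L1_sub => //; exact: subI01r (clip01_I01 t).
  apply: eq_Rintegral => s _; rewrite /p1 /p2.
  by case: (leP (p s) 0) => h; case: (leP (- p s) 0) => h'; lra.
apply: bounded_variationD => //; last by apply: nneg => // t; rewrite le_max lexx orbT.
by apply: bounded_variationN; apply: nneg => // t; rewrite le_max lexx orbT.
Qed.

Lemma tail_right_continuous (p : R -> R) t : L1 p -> 0 < t < 1 ->
  \int[leb]_(s in `[clip01 u, 1]) p s @[u --> t^'+] -->
  \int[leb]_(s in `[clip01 t, 1]) p s.
Proof.
move=> ip t01; have := continuous_L1_tail ip.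
rewrite I01E => /(continuous_within_itvP _ ltr01)[ct _ _].
have {}ct := ct t; rewrite in_itv /= t01 in ct; have {}ct := ct isT.
have /andP[t0 t1] := t01.
rewrite clip01_id; last by rewrite /I01 /= !ltW.
have : \int[leb]_(s in `[u, 1]) p s @[u --> t^'+] --> \int[leb]_(s in `[t, 1]) p s.
  exact/cvg_at_right_filter.
apply: cvg_trans; apply: near_eq_cvg; near=> u; rewrite clip01_id//.
rewrite /I01 /=; apply/andP; split.
  by rewrite (le_trans (ltW t0))// ltW//; near: u; exact: nbhs_right_gt.
by near: u; exact: nbhs_right_le.
Unshelve. all: by end_near. Qed.

(** A tail integral of [p] has derivative [- p] and no jump at either end, so the charge of density
    [- p] represents it. *)
Lemma is_dmeasure_tail (p : R -> R) : L1 p ->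
  exists2 nu : {charge set (measurableTypeR R) -> \bar R},
    is_dmeasure (fun t => \int[leb]_(s in `[clip01 t, 1]) p s) nu &
    forall A : set R, measurable A -> A `<=` I01 ->
      (- nu A = \int[leb]_(t in A) (p t)%:E)%E.
Proof.
move=> ip; have inp := L1_restrictT (L1N ip).
pose nu : {charge set (measurableTypeR R) -> \bar R} := induced_charge inp.
have nuE (A : set (measurableTypeR R)) : measurable A -> A `<=` I01 ->
    nu A = (- \int[leb]_(t in A) p t)%:E.
  move=> mA AI; have -> : - (\int[leb]_(t in A) p t) = \int[leb]_(t in A) (- p t).
    rewrite -mulN1r -(RintegralZl _ mA (L1_sub mA AI ip)).
    by apply: eq_Rintegral => t _; rewrite mulN1r.
  rewrite (EFin_Rintegral (L1_sub mA AI (L1N ip)) mA).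
  apply: eq_integral => t; rewrite inE => At /=.
  by rewrite patchE mem_set//; exact: AI.
exists nu => [t /andP[t0 t1]|A mA AI].
  have It : I01 t by rewrite /I01 /= ltW.
  have I0 : I01 (0 : R) by rewrite /I01 /= lexx ler01.
  rewrite nuE//; last exact: subI01l.
  rewrite !clip01_id// (Rintegral_tail ip It) (Rintegral_tail ip I0).
  by rewrite set_itv1 Rintegral_set1; congr EFin; ring.
by rewrite nuE// EFinN oppeK (EFin_Rintegral (L1_sub mA AI ip) mA).
Qed.

(** Either [xget] returns its default value 0, or it returns the limit of simple integrals that are
    all 0. *)
Lemma charge_integral0 (E : set R) (k : R -> R) :
  charge_integral (fun=> 0) E k = 0.
Proof.
rewrite /charge_integral; case: xgetP => [r -> [s [_ _ sr]]|]//.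
have s0 : (fun j => simple_integral (fun=> 0) (s j)) = fun=> 0 :> R.
  by apply/funext => j; rewrite /simple_integral; apply: fsbig1 => y _; rewrite mulr0.
by rewrite s0 in sr; exact: (cvg_unique _ sr (cvg_cst _)).
Qed.

Lemma charge_integral_col0 p (E : set R) (K : R -> 'cV[R]_p) :
  charge_integral_col (fun=> 0) E K = 0.
Proof. by apply/colP => i; rewrite !mxE charge_integral0. Qed.

(** A set [E] without a finite partition into members of [Leb01] gives an empty family of sums,
    whose [sup] is 0 by convention; otherwise the only sum is 0. *)
Lemma tvar0 (E : set R) : tvar (fun=> 0) E = 0.
Proof.
rewrite /tvar; set S := [set _ | _].
have sub : S `<=` [set 0].
  by move=> r [N [A [_ _ _ ->]]]; apply: big1 => i _; rewrite normr0.
have [->|S0] := eqVneq S set0; first by rewrite sup0.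
have -> : S = [set 0]; last by rewrite sup1.
apply/seteqP; split => // _ ->; have /set0P[r Sr] := S0.
by rewrite -(sub r Sr).
Qed.

End vanishing_charge.

Theorem theorem4p4 (R : realType) (n m : nat)
    (L : R -> 'cV[R]_n -> 'cV[R]_m -> R)
    (f : R -> 'cV[R]_n -> 'cV[R]_m -> 'cV[R]_n)
    (g : R -> 'cV[R]_n -> 'cV[R]_m -> R)
    (x0 : 'cV[R]_n) (xb : R -> 'cV[R]_n) (ub : R -> 'cV[R]_m)
    (hdata : problem_data L f g)
    (hmin : weak_local_minimizer L f g x0 xb ub)
    (hg0 : ess_limit (along g xb ub) 0 0)
    (hgu0 : forall j,
       ess_limit (fun t => along (grad_u g) xb ub t ord0 j) 0 0)
    (eps : R) (heps : 0 < eps)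
    (omega : R -> R)
    (homega_pos : forall t, 0 < t <= 1 -> 0 < omega t)
    (homega_nd : forall s t, 0 < s -> s <= t -> t <= 1 -> omega s <= omega t)
    (homega_int :
       (\int[leb]_(t in `]0%R, 1%R]) ((omega t)^-1)%:E < +oo)%E)
    (hreg : {ae leb, forall t, I01 t -> - eps <= along g xb ub t ->
       omega t <= eucl (along (grad_u g) xb ub t)}) :
  exists (lam beta : R -> 'cV[R]_n) (lam0 : R) (z : R -> R)
      (zeta : set R -> R),
    [/\ multiplier_tuple L f g xb ub lam beta lam0 z zeta,
        forall E, Leb01 E -> zeta E = 0,
        forall t, I01 t -> beta t = 0
      & ~ degenerate g xb ub lam beta lam0 z zeta].
Proof.
have [lam [z [mlam iz iad lamE ae]]] :=
  normal_multiplier_exists hdata heps homega_pos homega_nd homega_int hmin hreg.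
(* Constant extension of [lam] outside the unit interval, to control the one-sided limits and the
   total functions occurring in [BV01]. *)
pose lam' t := lam (clip01 t).
have lam'E t : I01 t -> lam' t = lam t by move=> It; rewrite /lam' clip01_id.
pose p i t := adjoint_density L f g xb ub lam 1 z t i ord0.
have lam'I t i : lam' t i ord0 = \int[leb]_(s in `[clip01 t, 1]) p i s.
  by rewrite /lam' lamE//; exact: clip01_I01.
have lam'F i : (fun t => lam' t i ord0) =
    fun t => \int[leb]_(s in `[clip01 t, 1]) p i s.
  by apply/funext => t; rewrite lam'I.
have I0 : I01 (0 : R) by rewrite /I01 /= lexx ler01.
have I1 : I01 (1 : R) by rewrite /I01 /= lexx ler01.
(* Nondegeneracy is immediate from [lam0 = 1]. *)
exists lam', (fun=> 0), 1, z, (fun=> 0); split=> //; last by case=> /eqP; rewrite oner_eq0.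
have z_ge0 : {ae leb, forall t, I01 t -> 0 <= z t}.
  by apply: ae_imp ae => t aet It; have [] := aet It.
have z_gb : {ae leb, forall t, I01 t -> z t * along g xb ub t = 0}.
  by apply: ae_imp ae => t aet It; have [] := aet It.
split.
- split=> //; split=> i; split.
  + by rewrite lam'F; exact: tail_bounded_variation (iad i).
  + move=> t t01; rewrite lam'F lam'I.
    exact: (tail_right_continuous (iad i) t01).
  + apply: nondecreasing_bounded_variation => s t _ _ _.
    exact: lexx.
  + by move=> t _; exact: cvg_cst.
- split=> //.
  + split=> //; first by move=> *; rewrite addr0.
    by exists 0 => E _; rewrite normr0.
  (* A set function squeezed between 0 and the total variation of the zero charge is 0. *)
  + move=> nu _ nu0 E LE; have := nu0 E LE; rewrite tvar0 => h.
    by apply/eqP; rewrite eq_le andbC.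
- rewrite addr0 ltr_wpDr//; apply: Rintegral_ge0 => t _; exact: normr_ge0.
- by split=> // e e0; rewrite tvar0.
- split.
  + split=> //; apply/colP => i; rewrite lam'I clip01_id// set_itv1.
    by rewrite Rintegral_set1 mxE.
  + move=> i; have [nu nuE nuA] := is_dmeasure_tail (iad i).
    exists nu, czero; split.
    * by move=> t t01; rewrite nuE// !lam'I.
    * by move=> t _; rewrite /czero !mxE subrr.
    * move=> A mA AI; rewrite nuA// /czero adde0; apply: eq_integral => t.
      by rewrite inE => /AI It; rewrite /adjoint_density lam'E.
  + split; first by rewrite charge_integral_col0 oppr0.
    move=> t _; rewrite (_ : (fun k => _) = fun=> 0); first exact: cvg_cst.
    by apply/funext => k; rewrite charge_integral_col0 oppr0.
  + apply: ae_imp ae => t aet It; have [_ _ h] := aet It.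
    by rewrite lam'E.
  + by move=> E _; exact: charge_integral_col0.
Qed.
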